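(* Let $G=(P,B)$ be an irreducible braced triangulation with $b=|B|\geq 2$. Then $|V(P)|\leq 4b^2-2b$.
   Context: A sphere graph is a simple graph with a fixed embedding in the 2-sphere without edge crossings. A (sphere) triangulation $P$ is a maximal sphere graph with at least 3 vertices. An edge $e$ of $P$ is contractible in $P$ if it belongs to precisely two 3-cycles of $P$. A braced triangulation $G=(P,B)$ is the simple graph obtained from a triangulation $P$ by adjoining a set $B$ of additional edges (braces) joining pairs of vertices non-adjacent in $P$. An edge $e$ of $P$ is contractible in $G$ if $e$ is contractible in $P$ and $e$ does not belong to any 3-cycle of $G$ containing a brace. $G$ is irreducible if no edge of $P$ is contractible in $G$. *)

(* Defs.v *)
From HB Require Import structures.
From mathcomp Require Import all_boot all_order all_algebra.
From mathcomp Require Import all_classical all_reals all_analysis.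

Set Implicit Arguments.
Unset Strict Implicit.
Unset Printing Implicit Defensive.

Import Order.TTheory GRing.Theory Num.Theory.
Import numFieldNormedType.Exports.

Local Open Scope ring_scope.

(* A simple graph with vertex set [V] is given by its set of edges, which are
   two-element subsets of [V]. *)
Section SimpleGraph.
Variable V : finType.
Implicit Types (E : {set {set V}}) (e : {set V}).

Definition simple_graph E : Prop := forall e, e \in E -> #|e| = 2%N.

Definition three_cycle (x y z : V) : {set {set V}} :=
  [set [set x; y]; [set y; z]; [set z; x]]%SET.

(* Cycles are identified with their edge sets. *)
Definition three_cycles E : {set {set {set V}}} :=
  [set C : {set {set V}} | (C \subset E) &&
    [exists x, exists y, exists z,
      uniq [:: x; y; z] && (C == three_cycle x y z)]]%SET.

End SimpleGraph.

Section SphereGraph.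
Variable R : realType.

Definition sphere2 : set 'rV[R]_3 :=
  [set p : 'rV[R]_3 | \sum_i p 0 i ^+ 2 = 1]%classic.

Definition is_arc (A : set 'rV[R]_3) (a b : 'rV[R]_3) : Prop :=
  exists gamma : R -> 'rV[R]_3,
    [/\ {within `[0, 1], continuous gamma}%classic,
        set_inj `[0, 1]%classic gamma,
        gamma 0 = a, gamma 1 = b
      & (gamma @` `[0, 1])%classic = A].

(* The value of [sg_arc] outside [sg_edges] is irrelevant. *)
Record sphere_graph (V : finType) := SphereGraph {
  sg_edges : {set {set V}};
  sg_point : V -> 'rV[R]_3;
  sg_arc : {set V} -> set 'rV[R]_3;
  sg_simple : simple_graph sg_edges;
  sg_point_inj : injective sg_point;
  sg_point_sphere : forall v, sphere2 (sg_point v);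
  sg_arc_sphere : forall e, e \in sg_edges -> (sg_arc e `<=` sphere2)%classic;
  sg_arcP : forall u v, [set u; v]%SET \in sg_edges ->
    is_arc (sg_arc [set u; v]%SET) (sg_point u) (sg_point v);
  sg_vertex_arc : forall v e, e \in sg_edges ->
    sg_arc e (sg_point v) -> v \in e;
  (* Distinct edges meet only at common end vertices. *)
  sg_noncrossing : forall e f, e \in sg_edges -> f \in sg_edges -> e != f ->
    (sg_arc e `&` sg_arc f `<=` sg_point @` [set` e :&: f])%classic
}.

Variable V : finType.

(* Since embeddings are fixed, [P] is a subgraph of [Q] only if [Q] draws the
   vertices and edges of [P] as [P] does. *)
Definition sphere_subgraph (P Q : sphere_graph V) : Prop :=
  [/\ sg_edges P \subset sg_edges Q,
      forall v, sg_point Q v = sg_point P v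
    & forall e, e \in sg_edges P -> sg_arc Q e = sg_arc P e].

(* Maximality is among sphere graphs with the same vertices: no edge can be
   added. *)
Definition triangulation (P : sphere_graph V) : Prop :=
  (3 <= #|V|)%N /\
  forall Q, sphere_subgraph P Q -> sg_edges Q = sg_edges P.

Definition contractible (P : sphere_graph V) (e : {set V}) : Prop :=
  e \in sg_edges P /\
  #|[set C in three_cycles (sg_edges P) | e \in C]%SET| = 2%N.

Record braced_triangulation := BracedTriangulation {
  bt_graph : sphere_graph V;
  bt_braces : {set {set V}};
  bt_triangulation : triangulation bt_graph;
  bt_brace_pair : forall f, f \in bt_braces -> #|f| = 2%N;
  bt_brace_nonadjacent : forall f, f \in bt_braces -> f \notin sg_edges bt_graph
}.

Definition bt_edges (G : braced_triangulation) : {set {set V}} :=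
  sg_edges (bt_graph G) :|: bt_braces G.

Definition braced_contractible (G : braced_triangulation) (e : {set V}) : Prop :=
  contractible (bt_graph G) e /\
  ~ exists2 C, C \in three_cycles (bt_edges G) &
      e \in C /\ exists2 f, f \in bt_braces G & f \in C.

Definition irreducible_bt (G : braced_triangulation) : Prop :=
  forall e, e \in sg_edges (bt_graph G) -> ~ braced_contractible G e.

End SphereGraph.

(* Main.v *)
(**
  Let [W] be the set of the at most [2 * b] ends of braces. By irreducibility, an
  edge whose ends have exactly two common neighbours lies in a 3-cycle with a
  brace. Every vertex [y] has such an edge: take a neighbour of [y] in a smallest
  nonempty side of a 3-cycle through [y]. Hence each vertex outside [W] is a common
  neighbour of the two ends of some brace. For a brace [xz] with at least four
  common neighbours of [x] and [z] outside [W], the paths [x, y, z] through these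
  cut the sphere into regions, two at each [y]. If neither of the two regions at
  [y] contained an element of [W], then neither would contain any vertex, since a
  vertex outside [W] has two neighbours in [W]. So the neighbours of [y] would be
  [x], [z] and the middle vertices [a1], [a2] of the next two paths, and the edge
  from [y] to [a1], with the common neighbours [x] and [z] only, would be
  contractible. As each region is adjacent to two of the paths, there are at most
  [2 * (2 * b - 2)] paths for each brace, and [2 * b + b * (4 * b - 4)] vertices
  in all.

  Stereographic projection moves the drawing into the plane. There, two points are
  connected off a compact set if and only if their neighbours in fine grids bound a
  mod 2 grid chain that stays off the set by some margin. Adding such chains, after
  Alexander, shows that two compact sets with at most one common point do not
  jointly separate points that neither separates, and that with two common points
  they do not jointly separate all three of any three points; two arcs with common
  ends do separate. Maximality of the drawing is used as follows: a vertex in the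
  frontier of a face is the end of an arc inside the face, whence any two vertices
  in the frontier of one face are adjacent.
*)

From HB Require Import structures.
Require Import Defs.
From mathcomp Require Import all_boot all_order all_algebra.
From mathcomp Require Import zify lra ring.
From mathcomp Require Import all_classical all_reals all_analysis.

Set Implicit Arguments.
Unset Strict Implicit.
Unset Printing Implicit Defensive.

Import Order.TTheory GRing.Theory Num.Theory.
Import numFieldNormedType.Exports.

(** * Mod 2 chains on a grid *)

(* [h i j] tells whether a chain has the edge from [(i, j)] to [(i.+1, j)], [v i j]
   whether it has that to [(i, j.+1)], and [l i j] whether a set of faces has the
   one with corners [(i, j)] and [(i.+1, j.+1)]. *)
Section GridChains.
Implicit Types (h v l u : nat -> nat -> bool).

(** Edges are arbitrary continuous arcs, so the shape of a face near its frontier is unknown, and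
    parities replace local pictures: a finite closed chain in the grid bounds a set of faces, found
    by counting crossings along a ray. The value of that set near the common points of two compact
    sets is the obstruction to adding chains. With one common point it can be normalised away; with
    two it is an element of Z/2, additive under concatenation, whence the three points. An end of an
    edge is reached from a face through shrinking boxes, chosen so that in each box the face still
    touches the edge.

    Smallest sides help because an edge with three common neighbours lies on three triangles, one of
    which separates the other two apexes; hence a nonempty side contains a smaller one, unless some
    neighbour in it has only two common neighbours with [y]. The fourth path at a brace makes the
    two middle vertices next to [y] non-adjacent; up to three paths are within [4 * b - 4] since [b]
    is at least [2]. *)

Definition prevb (f : nat -> bool) (i : nat) : bool :=
  if i is i'.+1 then f i' else false.

(** The mod 2 boundary of a 1-chain; [bdh] and [bdv] are the two parts of the boundary of a 2-chain.
    The grid fills a quarter plane, so [prevb] supplies absent edges and faces beyond the axes. *)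
Definition bd h v i j :=
  (h i j (+) prevb (h^~ j) i) (+) (v i j (+) prevb (v i) j).
Definition bdh l i j := l i j (+) prevb (l i) j.
Definition bdv l i j := l i j (+) prevb (l^~ j) i.

(** The parity of crossings with the ray going down from a face, that is, the mod 2 winding number
    of a closed chain. *)
Definition fill h i j := \big[addb/false]_(k < j.+1) h i k.

Definition chain_bounded m h v :=
  forall i j, h i j || v i j -> (i < m)%N && (j < m)%N.

Lemma bd_face l i j : bd (bdh l) (bdv l) i j = false.
Proof.
rewrite /bd /bdh /bdv /prevb; case: i j => [|i] [|j].
- by case: (l 0 0)%N.
- by case: (l 0 j.+1)%N; case: (l 0 j)%N.
- by case: (l i.+1 0)%N; case: (l i 0)%N.
- by case: (l i.+1 j.+1); case: (l i j); case: (l i.+1 j); case: (l i j.+1).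
Qed.

Lemma prevb_add (f g : nat -> bool) i :
  prevb (fun i => f i (+) g i) i = prevb f i (+) prevb g i.
Proof. by case: i. Qed.

Lemma bd_add h v h' v' i j :
  bd (fun i j => h i j (+) h' i j) (fun i j => v i j (+) v' i j) i j =
  bd h v i j (+) bd h' v' i j.
Proof.
rewrite /bd (prevb_add (h^~ j) (h'^~ j)) prevb_add.
by rewrite [X in X (+) _]addbACA [X in _ (+) X]addbACA addbACA.
Qed.

Lemma eq_bd h v h' v' : h =2 h' -> v =2 v' -> bd h v =2 bd h' v'.
Proof.
move=> eh ev i j; rewrite /bd /prevb eh ev.
by case: i j => [|i] [|j]; rewrite ?eh ?ev.
Qed.

Lemma bdh_fill h i j : bdh (fill h) i j = h i j.
Proof.
rewrite /bdh /fill /prevb big_ord_recr /=; case: j => [|j].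
  by rewrite big_ord0 addbF.
by rewrite addbAC addbb addFb.
Qed.

(** With [bdh_fill], this says that a closed chain is a boundary. Two neighbouring columns of [h]
    differ, edge by edge, by increments of [v], which telescope. *)
Lemma bdv_fill h v : bd h v =2 (fun _ _ => false) -> bdv (fill h) =2 v.
Proof.
move=> z i j; have E k : h i k (+) prevb (h^~ k) i = v i k (+) prevb (v i) k.
  by move: (z i k); rewrite /bd; case: (h i k (+) _); case: (v i k (+) _).
have -> : bdv (fill h) i j = \big[addb/false]_(k < j.+1) (h i k (+) prevb (h^~ k) i).
  rewrite big_split /bdv /=; congr addb; rewrite /fill /prevb; case: i {E} => [|i] //.
  by rewrite big1.
elim: j => [|j IH]; first by rewrite big_ord1 E /= addbF.
by rewrite big_ord_recr /= IH E /= addbC -addbA addbb addbF.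
Qed.

Lemma bd_bounded m h v i j : chain_bounded m h v -> bd h v i j -> (i <= m)%N && (j <= m)%N.
Proof.
move=> B E; have: [|| h i j, v i j, prevb (h^~ j) i | prevb (v i) j].
  by move: E; rewrite /bd; case: (h i j); case: (v i j); case: prevb; case: prevb.
case/or4P => [hv|hv|hv|hv].
- by have /andP[/ltnW-> /ltnW->] := B i j (introT orP (or_introl hv)).
- by have /andP[/ltnW-> /ltnW->] := B i j (introT orP (or_intror hv)).
- case: i {E} hv => //= i hv.
  by have /andP[-> /ltnW->] := B i j (introT orP (or_introl hv)).
- case: j {E} hv => //= j hv.
  by have /andP[/ltnW-> ->] := B i j (introT orP (or_intror hv)).
Qed.

(** Every edge has two ends. In each direction the sum telescopes to its value at index [m], where
    the chain already vanishes. *)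
Lemma bd_even m h v : chain_bounded m h v ->
  \big[addb/false]_(i < m.+1) \big[addb/false]_(j < m.+1) bd h v i j = false.
Proof.
move=> B.
have T (f : nat -> bool) n : \big[addb/false]_(i < n.+1) (f i (+) prevb f i) = f n.
  elim: n => [|n IH]; first by rewrite big_ord1 /= addbF.
  by rewrite big_ord_recr /= IH addbC -addbA addbb addbF.
have F a b : (m <= a)%N || (m <= b)%N -> (h a b = false) * (v a b = false).
  move=> ab; suff: ~~ (h a b || v a b) by case: (h a b); case: (v a b).
  by apply: contraL ab => /B; rewrite negb_or -!ltnNge.
rewrite /bd; under eq_bigr do rewrite big_split.
rewrite big_split /= exchange_big /= big1 ?addFb.
  by apply: big1 => i _; rewrite T F // leqnn orbT.
by move=> j _; rewrite (T (h^~ j)) F // leqnn.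
Qed.

Lemma bd_not_single m h v (a : nat * nat) : chain_bounded m h v ->
  bd h v =2 (fun i j => (i, j) == a) -> False.
Proof.
move=> B E; have: bd h v a.1 a.2 by rewrite E -surjective_pairing.
move=> /(bd_bounded B)/andP[a1 a2].
have := bd_even B.
rewrite (bigD1 (Ordinal (a1 : (a.1 < m.+1)%N))) //= (bigD1 (Ordinal (a2 : (a.2 < m.+1)%N))) //=.
rewrite E -surjective_pairing eqxx big1; last first.
  move=> j nj; rewrite E; apply: contraNF nj => /eqP ja.
  by apply/eqP/val_inj; rewrite /= -ja.
rewrite big1 // => i ni; apply: big1 => j _; rewrite E.
by apply: contraNF ni => /eqP ja; apply/eqP/val_inj; rewrite /= -ja.
Qed.

(** Crossing an edge outside the boundary does not change membership. The two faces are compared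
    along column [i] and then along row [j']. *)
Lemma faces_const l i i' j j' :
  (forall a b, (minn i i' <= a <= maxn i i')%N -> (minn j j' <= b <= maxn j j')%N ->
     ~~ bdh l a b && ~~ bdv l a b) -> l i j = l i' j'.
Proof.
move=> H.
have A : l i j = l i j'.
  have Hb b : (minn j j' <= b <= maxn j j')%N -> ~~ bdh l i b.
      have hi : (minn i i' <= i <= maxn i i')%N by rewrite geq_minl leq_maxl.
    by move=> hb; have /andP[] := H i b hi hb.
  have gen n k : (forall b, (k <= b <= k + n)%N -> ~~ bdh l i b) -> l i k = l i (k + n)%N.
    elim: n => [|n IH] K; first by rewrite addn0.
    rewrite IH => [|b /andP[? hb]]; last by apply: K; rewrite ?(leq_trans hb) ?leq_add2l ?andbT.
    have := K (k + n.+1)%N; rewrite leqnn leq_addr => /(_ isT).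
    by rewrite addnS /bdh /=; case: (l i _); case: (l i _).
  case: (leqP j j') => jj.
    move: Hb; rewrite (minn_idPl jj) (maxn_idPr jj) => Hb.
    by rewrite (gen (j' - j)%N) ?subnKC.
  move/ltnW: jj => jj; move: Hb; rewrite (minn_idPr jj) (maxn_idPl jj) => Hb.
  by rewrite [RHS](gen (j - j')%N) ?subnKC.
rewrite A.
have Hb b : (minn i i' <= b <= maxn i i')%N -> ~~ bdv l b j'.
  have hj : (minn j j' <= j' <= maxn j j')%N by rewrite geq_minr leq_maxr.
  by move=> hb; have /andP[] := H b j' hb hj.
have gen n k : (forall b, (k <= b <= k + n)%N -> ~~ bdv l b j') -> l k j' = l (k + n)%N j'.
  elim: n => [|n IH] K; first by rewrite addn0.
  rewrite IH => [|b /andP[? hb]]; last by apply: K; rewrite ?(leq_trans hb) ?leq_add2l ?andbT.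
  have := K (k + n.+1)%N; rewrite leqnn leq_addr => /(_ isT).
  by rewrite addnS /bdv /=; case: (l _ j'); case: (l _ j').
case: (leqP i i') => jj.
  move: Hb; rewrite (minn_idPl jj) (maxn_idPr jj) => Hb.
  by rewrite (gen (i' - i)%N) ?subnKC.
move/ltnW: jj => jj; move: Hb; rewrite (minn_idPr jj) (maxn_idPl jj) => Hb.
by rewrite [RHS](gen (i - i')%N) ?subnKC.
Qed.

(* The edges of the path from [a] to [b] that is horizontal first. *)
Definition elh (a b : nat * nat) i j := (j == a.2) && ((i < a.1)%N (+) (i < b.1)%N).
Definition elv (a b : nat * nat) i j := (i == b.1) && ((j < a.2)%N (+) (j < b.2)%N).

Lemma prevb_lt x y z :
  (x < y)%N (+) (x < z)%N (+) prevb (fun x => (x < y)%N (+) (x < z)%N) x =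
  (x == y) (+) (x == z).
Proof.
(* A single half-line has a spurious end at [0], which cancels between the two half-lines. *)
have E t : (x < t)%N (+) prevb (fun x => (x < t)%N) x = (x == t) (+) (x == 0%N).
  case: x t => [|x] [|t] //; rewrite /= ?ltnS ?eqSS; case: ltngtP => //.
by rewrite (prevb_add (fun x => (x < y)%N)) addbACA !E addbACA addbb addbF.
Qed.

Lemma bd_el a b i j : bd (elh a b) (elv a b) i j = ((i, j) == a) (+) ((i, j) == b).
Proof.
case: a b => a1 a2 [b1 b2]; rewrite /bd /elh /elv !xpair_eqE /=.
have P (c : bool) f x : prevb (fun x => c && f x) x = c && prevb f x.
  by case: x => //=; rewrite andbF.
rewrite !P -!andb_addr !prevb_lt.
by case: (j == a2); case: (i == b1); case: (i == a1); case: (j == b2).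
Qed.
End GridChains.

Local Open Scope classical_set_scope.
Local Open Scope ring_scope.

Definition conn {T : topologicalType} (K : set T) : T -> T -> Prop :=
  connected_component (~` K).

Lemma connected_image_segment (R : realType) (T : topologicalType) (f : R -> T) a b :
  continuous f -> connected (f @` `[a, b]).
Proof.
move=> cf; apply: connected_continuous_connected; first exact: segment_connected.
exact: continuous_subspaceT.
Qed.

(** * Connection in the complement of a set *)

Section Conn.
Variable T : topologicalType.
Implicit Types (K C : set T) (p q r : T).

Lemma conn_refl K p : ~ K p -> conn K p p.
Proof. exact: connected_component_refl. Qed.

Lemma conn_sym K p q : conn K p q -> conn K q p.
Proof. exact: connected_component_sym. Qed.

Lemma conn_trans K q p r : conn K p q -> conn K q r -> conn K p r.
Proof. exact: connected_component_trans. Qed.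

Lemma connI K C p q : connected C -> C p -> C q -> C `<=` ~` K -> conn K p q.
Proof. by move=> cC Cp Cq CK; exists C. Qed.

Lemma conn_sub K K' p q : K `<=` K' -> conn K' p q -> conn K p q.
Proof.
move=> KK [C [Cp CK cC] Cq]; exists C => //; split=> //.
by move=> x /CK K'x Kx; apply: K'x; apply: KK.
Qed.

Lemma conn_outl K p q : conn K p q -> ~ K p.
Proof. by case=> C [Cp CK _] _; exact: CK. Qed.

Lemma conn_outr K p q : conn K p q -> ~ K q.
Proof. by case=> C [_ CK _] Cq; exact: CK. Qed.

End Conn.

(* Fixing the structure avoids expensive comparisons of the many paths by which
   a product gets a topology. *)
Definition plane (R : realType) : pseudoMetricType R := (R * R)%type.

Section Plane.
Variable R : realType.
Notation pl := (plane R).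
Implicit Types (p q : pl) (K F : set pl).

Lemma plballP p q (r : R) : ball p r q <->
  [/\ p.1 - r < q.1, q.1 < p.1 + r, p.2 - r < q.2 & q.2 < p.2 + r].
Proof.
split=> [[/ltr_normlP[h1 h2] /ltr_normlP[h3 h4]]|[h1 h2 h3 h4]].
  by split; lra.
by split; apply/ltr_normlP; split; lra.
Qed.

Lemma pair_cvg (T : Type) (F : set_system T) (FF : Filter F) (f g : T -> R) (a b : R) :
  f x @[x --> F] --> a -> g x @[x --> F] --> b ->
  ((f x, g x) : pl) @[x --> F] --> ((a, b) : pl).
Proof. by move=> fa gb; exact: (cvg_pair fa gb). Qed.

Lemma pair_continuous (T : topologicalType) (f g : T -> R) :
  continuous f -> continuous g -> continuous (fun t => (f t, g t) : pl).
Proof. by move=> cf cg x; apply: pair_cvg; [exact: cf | exact: cg]. Qed.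

Lemma aff_continuous (a b : R) : continuous (fun t : R => a + t * b).
Proof.
by move=> t; apply: cvgD; [exact: cvg_cst|apply: cvgM; [exact: cvg_id|exact: cvg_cst]].
Qed.

Lemma seg_continuous p q : continuous (fun t : R => (p.1 + t * (q.1 - p.1), p.2 + t * (q.2 - p.2)) : pl).
Proof. by apply: pair_continuous; exact: aff_continuous. Qed.

Lemma conn_seg K p q :
  (forall t, 0 <= t <= 1 -> ~ K (p.1 + t * (q.1 - p.1), p.2 + t * (q.2 - p.2))) -> conn K p q.
Proof.
move=> H; have := @seg_continuous p q; set f := (f in continuous f) => cf.
apply: (@connI _ _ (f @` `[0, 1])).
- exact: connected_image_segment.
- exists 0; first by rewrite /= in_itv /= lexx ler01.
  by rewrite /f !mul0r !addr0; case: (p).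
- exists 1; first by rewrite /= in_itv /= lexx ler01.
  by rewrite /f !mul1r !subrKC; case: (q).
- by move=> _ [t + <-]; rewrite /= in_itv /= => /H.
Qed.

Lemma lt_convex (u v r t : R) : u < r -> v < r -> 0 <= t <= 1 -> u + t * (v - u) < r.
Proof.
move=> ur vr /andP[t0 t1]; have [uv|vu] := leP u v.
  by apply: le_lt_trans vr; nra.
by apply: le_lt_trans ur; nra.
Qed.

Lemma conn_ball K c r p q : ball c r p -> ball c r q -> (forall x, ball c r x -> ~ K x) -> conn K p q.
Proof.
move=> /plballP[p1 p2 p3 p4] /plballP[q1 q2 q3 q4] H; apply: conn_seg => t t01; apply: H.
have lt_convex' (l u w : R) : l < u -> l < w -> l < u + t * (w - u).
  move=> lu lw; have := @lt_convex (- u) (- w) (- l) t; rewrite !ltrN2 => /(_ lu lw t01).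
  by rewrite -ltrN2 opprK; lra.
by apply/plballP; split; rewrite /=; (apply: lt_convex' || apply: lt_convex).
Qed.

Lemma closed_ball_miss K p : closed K -> ~ K p -> exists2 r, 0 < r & forall x, ball p r x -> ~ K x.
Proof.
move=> cK nKp; have /nbhs_ballP[r r0 H] : nbhs p (~` K) by apply: open_nbhs_nbhs; split => //; exact: closed_openC.
by exists r.
Qed.

Lemma conn_open K p q : closed K -> conn K p q -> exists2 r, 0 < r & forall x, ball q r x -> conn K p x.
Proof.
move=> cK pq; have [r r0 H] := closed_ball_miss cK (conn_outr pq).
exists r => // x qx; apply: conn_trans pq _; apply: conn_ball qx H => //; exact: ballxx.
Qed.

End Plane.

(** The points of [C] with [P] form a nonempty relatively open and closed subset. This is the
    induction principle by which local statements spread along connected sets. *)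
Lemma connected_ind (T : topologicalType) (C : set T) (P : T -> Prop) p q :
  connected C -> C p -> C q -> P p ->
  (forall x, C x -> \forall y \near x, C y -> (P x <-> P y)) -> P q.
Proof.
move=> cC Cp Cq Pp loc.
suff E : [set x | C x /\ P x] = C by move: Cq; rewrite -E => -[].
apply: cC; first by exists p.
- exists (interior [set y | C y -> P y]); first exact: open_interior.
  apply/seteqP; split=> x /= [Cx Px].
    by split=> //; apply: filterS (loc x Cx) => y h Cy; apply/h.
  by split=> //; exact: (nbhs_singleton Px).
- exists (~` (interior [set y | C y -> ~ P y])).
    by apply: open_closedC; exact: open_interior.
  apply/seteqP; split=> x /= [Cx Px]; split=> //.
    by move=> /nbhs_singleton /=; exact.
  apply: contrapT => nPx; apply: Px; apply: filterS (loc x Cx) => y h Cy.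
  by move=> /(h Cy).
Qed.

(** * Chains off a set *)

Section Link.
Variable R : realType.
Notation pl := (plane R).
Implicit Types (p q : pl) (K F : set pl) (N : nat) (a b : nat * nat).

Definition mesh N : R := N.+1%:R^-1.
(** The grid has mesh [1 / (N + 1)] and its corner at [- (N + 1)] in both coordinates, so a growing
    [N] both refines it and makes it cover any bounded set. *)
Definition pos N i : R := i%:R * mesh N - N.+1%:R.
Definition gp N a : pl := (pos N a.1, pos N a.2).
Definition idx1 N (r : R) := Num.truncn ((r + N.+1%:R) * N.+1%:R).
Definition idx N p := (idx1 N p.1, idx1 N p.2).

Lemma mesh_gt0 N : 0 < mesh N. Proof. by rewrite invr_gt0. Qed.

Lemma mesh_lt N (r : R) : 0 < r -> r^-1 <= N%:R -> mesh N < r.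
Proof.
move=> r0 rN; rewrite /mesh -[r]invrK ltf_pV2 ?posrE ?invr_gt0 //.
by apply: le_lt_trans rN _; rewrite ltr_nat.
Qed.

Lemma posS N i : pos N i.+1 = pos N i + mesh N.
Proof. by rewrite /pos -natr1 mulrDl mul1r addrAC. Qed.

Lemma pos_le N i j : (i <= j)%N -> pos N i <= pos N j.
Proof. by move=> ij; rewrite lerD2r ler_pM2r ?mesh_gt0 // ler_nat. Qed.

Lemma pos_idx N r : - N.+1%:R <= r -> pos N (idx1 N r) <= r < pos N (idx1 N r) + mesh N.
Proof.
move=> rN; rewrite -posS /pos /mesh.
have n0 : 0 < N.+1%:R :> R by [].
rewrite lerBlDr ltrBrDr -!/(_ / _) ler_pdivrMr // ltr_pdivlMr //.
by apply: truncn_itv; rewrite mulr_ge0 // -lerBlDr sub0r.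
Qed.

Lemma pos_lt_bound N (M : R) i : pos N i < M -> (i < (Num.truncn ((M + N.+1%:R) * N.+1%:R)).+1)%N.
Proof.
have n0 : 0 < N.+1%:R :> R by [].
rewrite /pos ltrBlDr -/(_ / _) ltr_pdivrMr // => iM.
by rewrite -(ltr_nat R); apply: lt_trans iM (truncnS_gt _).
Qed.

Definition nearF F (t : R) N a := exists2 y, F y & ball (gp N a) t y.

Lemma nearF_le F (s t : R) N a : s <= t -> nearF F s N a -> nearF F t N a.
Proof. by move=> st [y Fy ay]; exists y => //; exact: le_ball ay. Qed.

Lemma nearF_step1 F (t : R) N i j : nearF F t N (i.+1, j) -> nearF F (t + mesh N) N (i, j).
Proof.
move=> [y Fy /plballP[]]; rewrite /= posS => h1 h2 h3 h4; exists y => //; have m0 := mesh_gt0 N.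
by apply/plballP; split; rewrite /=; lra.
Qed.

Lemma nearF_step2 F (t : R) N i j : nearF F t N (i, j.+1) -> nearF F (t + mesh N) N (i, j).
Proof.
move=> [y Fy /plballP[]]; rewrite /= posS => h1 h2 h3 h4; exists y => //; have m0 := mesh_gt0 N.
by apply/plballP; split; rewrite /=; lra.
Qed.

(** Only the left or lower end of an edge is tested; the other end is one mesh away, which the
    thresholds absorb. *)
Definition chain_off K (t : R) N (h v : nat -> nat -> bool) :=
  forall i j, h i j || v i j -> ~ nearF K t N (i, j).

Definition link K (t : R) N a b := exists m h v,
  [/\ chain_bounded m h v, bd h v =2 (fun i j => ((i, j) == a) (+) ((i, j) == b)) &
      chain_off K t N h v].

Lemma chain_bounded_add m h v m' h' v' : chain_bounded m h v -> chain_bounded m' h' v' ->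
  chain_bounded (maxn m m') (fun i j => h i j (+) h' i j) (fun i j => v i j (+) v' i j).
Proof.
move=> B B' i j hv; rewrite !leq_max.
have [/B/andP[-> ->] //|nb] := boolP (h i j || v i j).
have [/B'/andP[-> ->] //|nb'] := boolP (h' i j || v' i j); first by rewrite !orbT.
by move: nb nb' hv; rewrite !negb_or => /andP[/negbTE-> /negbTE->] /andP[/negbTE-> /negbTE->].
Qed.

Lemma chain_off_add K t N h v h' v' : chain_off K t N h v -> chain_off K t N h' v' ->
  chain_off K t N (fun i j => h i j (+) h' i j) (fun i j => v i j (+) v' i j).
Proof.
move=> B B' i j hv.
have [/B //|nb] := boolP (h i j || v i j).
have [/B' //|nb'] := boolP (h' i j || v' i j).
by move: nb nb' hv; rewrite !negb_or => /andP[/negbTE-> /negbTE->] /andP[/negbTE-> /negbTE->].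
Qed.

Lemma chain_off_le K s t N h v : s <= t -> chain_off K t N h v -> chain_off K s N h v.
Proof. by move=> st H i j hv /(nearF_le st); exact: H. Qed.

Lemma link_le K s t N a b : s <= t -> link K t N a b -> link K s N a b.
Proof.
by move=> st [m [h [v [B D O]]]]; exists m, h, v; split=> //; exact: chain_off_le O.
Qed.

Lemma link_sym K t N a b : link K t N a b -> link K t N b a.
Proof.
move=> [m [h [v [B D O]]]]; exists m, h, v; split=> // i j.
by rewrite D addbC.
Qed.

Lemma link_trans K t N a b c : link K t N a b -> link K t N b c -> link K t N a c.
Proof.
move=> [m [h [v [B D O]]]] [m' [h' [v' [B' D' O']]]].
exists (maxn m m'), (fun i j => h i j (+) h' i j), (fun i j => v i j (+) v' i j).
split; [exact: chain_bounded_add| |exact: chain_off_add].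
move=> i j; rewrite bd_add D D' -addbA; congr addb.
by rewrite addbA addbb.
Qed.

Lemma conn_gp1 K t N i j : mesh N < t -> ~ nearF K t N (i, j) -> conn K (gp N (i, j)) (gp N (i.+1, j)).
Proof.
move=> et nK; have m0 := mesh_gt0 N; apply: (@conn_ball _ K (gp N (i, j)) t).
- by apply: ballxx; apply: lt_trans et.
- by apply/plballP; split; rewrite /= ?posS; lra.
- by move=> x bx Kx; apply: nK; exists x.
Qed.

Lemma conn_gp2 K t N i j : mesh N < t -> ~ nearF K t N (i, j) -> conn K (gp N (i, j)) (gp N (i, j.+1)).
Proof.
move=> et nK; have m0 := mesh_gt0 N; apply: (@conn_ball _ K (gp N (i, j)) t).
- by apply: ballxx; apply: lt_trans et.
- by apply/plballP; split; rewrite /= ?posS; lra.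
- by move=> x bx Kx; apply: nK; exists x.
Qed.

(* The part of the chain inside the component of [a] has the single end [a]
   unless it also ends at [b]. *)
Lemma link_conn K t N a b : mesh N < t -> ~ K (gp N a) -> link K t N a b ->
  conn K (gp N a) (gp N b).
Proof.
move=> et Ka [m [h [v [B D O]]]]; apply: contrapT => nab.
pose u i j := `[< conn K (gp N a) (gp N (i, j)) >].
have u1 i j : h i j -> u i.+1 j = u i j.
  move=> hij; have c := conn_gp1 et (O i j (introT orP (or_introl hij))).
  by apply/asboolP/asboolP => H; apply: conn_trans H _ => //; exact: conn_sym.
have u2 i j : v i j -> u i j.+1 = u i j.
  move=> hij; have c := conn_gp2 et (O i j (introT orP (or_intror hij))).
  by apply/asboolP/asboolP => H; apply: conn_trans H _ => //; exact: conn_sym.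
pose h' i j := h i j && u i j; pose v' i j := v i j && u i j.
have B' : chain_bounded m h' v'.
  by move=> i j /orP[|] /andP[hij _]; apply: B; rewrite hij ?orbT.
apply: (bd_not_single (a := a) B') => i j.
have -> : bd h' v' i j = bd h v i j && u i j.
  rewrite /bd /prevb /h' /v'; case: i j => [|i] [|j] /=; rewrite ?addbF ?andb_addl //.
  - by case: (boolP (v 0%N j)) => [/u2 <-|_]; rewrite ?addbF -?andb_addl.
  - by case: (boolP (h i 0%N)) => [/u1 <-|_]; rewrite ?addbF -?andb_addl.
  - case: (boolP (h i j.+1)) => [/u1 <-|_]; case: (boolP (v i.+1 j)) => [/u2 <-|_];
    by rewrite ?addbF -?andb_addl.
rewrite D; have [[-> ->]|na] := (i, j) =P (a.1, a.2); last first.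
  move: na; rewrite -surjective_pairing => /eqP/negbTE ->; rewrite addFb.
  by apply/andP => -[/eqP ijb /asboolP]; rewrite ijb.
rewrite -surjective_pairing eqxx.
have -> : u a.1 a.2 by apply/asboolP; rewrite -surjective_pairing; exact: conn_refl.
by rewrite andbT; have [ab|//] := eqVneq a b; case: nab; rewrite -ab; exact: conn_refl.
Qed.

End Link.

(** * Alexander's addition theorem *)

Section Addition.
Variable R : realType.
Notation pl := (plane R).
Implicit Types (p q : pl) (K F : set pl) (N : nat) (a b : nat * nat).

Lemma inv_le (x y : R) : 0 < x -> x <= y -> y^-1 <= x^-1.
Proof. by move=> x0 xy; rewrite lef_pV2 // posrE // (lt_le_trans x0). Qed.

(** One margin serves all fine grids and all points near [p] and [q]. This makes the relation stable
    under small shifts, so that it spreads along connected sets, and lets several chains be taken on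
    one grid. *)
Definition linked K p q := exists2 r : R, 0 < r & forall N p' q', r^-1 <= N%:R ->
  ball p r p' -> ball q r q' -> link K r N (idx N p') (idx N q').

Lemma linked_sym K p q : linked K p q -> linked K q p.
Proof.
by move=> [r r0 H]; exists r => // N p' q' rN pp qq; apply: link_sym; exact: H.
Qed.

Lemma linked_trans K p q s : linked K p q -> linked K q s -> linked K p s.
Proof.
move=> [r1 r10 H1] [r2 r20 H2]; exists (Num.min r1 r2); first by rewrite lt_min r10.
have m1 : Num.min r1 r2 <= r1 by rewrite ge_min lexx.
have m2 : Num.min r1 r2 <= r2 by rewrite ge_min lexx orbT.
have m0 : 0 < Num.min r1 r2 by rewrite lt_min r10.
move=> N p' s' rN pp ss; apply: (@link_trans _ _ _ _ _ (idx N q)).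
  apply: (link_le m1); apply: H1; [|exact: (le_ball m1)|exact: ballxx].
  by apply: (le_trans _ rN); exact: (inv_le m0 m1).
apply: (link_le m2); apply: H2; [|exact: ballxx|exact: (le_ball m2)].
by apply: (le_trans _ rN); exact: (inv_le m0 m2).
Qed.

Lemma linked_shift K p q : linked K p q -> \forall q' \near q, linked K p q'.
Proof.
move=> [r r0 H]; apply/nbhs_ballP; exists (r / 2) => /=; first by rewrite divr_gt0.
move=> q' qq; exists (r / 2); first by rewrite divr_gt0.
have h : r / 2 <= r by lra.
move=> N p' q'' rN pp qq'; apply: (link_le h); apply: H.
- by apply: (le_trans _ rN); apply: inv_le => //; rewrite divr_gt0.
- exact: (le_ball h).
- by rewrite [r]splitr; exact: ball_triangle qq qq'.
Qed.

Lemma idx_ball N p c (r : R) : - N.+1%:R <= p.1 -> - N.+1%:R <= p.2 ->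
  ball c r p -> ball c (r + mesh R N) (gp R N (idx N p)).
Proof.
move=> p1 p2 /plballP[h1 h2 h3 h4].
have /andP[a1 a2] := pos_idx p1; have /andP[b1 b2] := pos_idx p2.
have m0 := mesh_gt0 R N.
by apply/plballP; split; rewrite /=; lra.
Qed.

Lemma far_range (x y r : R) N : y - r < x -> r <= 1 -> `|y| + 1 <= N%:R -> - N.+1%:R <= x.
Proof.
move=> yx r1 yN; rewrite -natr1; have := ler_norm (- y); rewrite normrN; lra.
Qed.

Lemma linked_refl K p : closed K -> ~ K p -> linked K p p.
Proof.
move=> cK Kp; have [r0 r00 H] := closed_ball_miss cK Kp.
pose M := `|p.1| + `|p.2| + 1.
have M1 : 1 <= M by rewrite /M lerDr addr_ge0.
(* The grid points used lie within [2 * r] of [p], and a margin [r] beyond them must stay inside the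
   ball of radius [r0]. The bound by the inverse of [M] forces [M <= N], so that the grid covers the
   surroundings of [p]. *)
pose r := Num.min (r0 / 4) M^-1.
have r_gt0 : 0 < r by rewrite lt_min divr_gt0 //= invr_gt0; lra.
have rr0 : r <= r0 / 4 by rewrite ge_min lexx.
have rM : r <= M^-1 by rewrite ge_min lexx orbT.
have r1 : r <= 1 by apply: le_trans rM _; rewrite invf_le1 //; lra.
exists r => // N p' q' rN pp qq.
have MN : M <= N%:R by apply: (le_trans _ rN); rewrite -[M]invrK; exact: (inv_le r_gt0 rM).
have e0 := mesh_gt0 R N; have er := mesh_lt r_gt0 rN.
have N1 : `|p.1| + 1 <= N%:R by apply: le_trans MN; rewrite /M lerD2r lerDl.
have N2 : `|p.2| + 1 <= N%:R by apply: le_trans MN; rewrite /M lerD2r lerDr.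
have I x : ball p r x -> ball p (2 * r) (gp R N (idx N x)).
  move=> px; apply: (@le_ball _ _ _ (r + mesh R N)); first by lra.
  apply: idx_ball => //; move/plballP: px => [h1 h2 h3 h4].
    exact: (far_range h1).
  exact: (far_range h3).
have /plballP[] := I _ pp; have /plballP[] := I _ qq; rewrite /=.
set i' := idx1 N q'.1; set j' := idx1 N q'.2; set i := idx1 N p'.1; set j := idx1 N p'.2.
move=> b1 b2 b3 b4 a1 a2 a3 a4.
exists (maxn (maxn i i') (maxn j j')).+1, (elh (i, j) (i', j')), (elv (i, j) (i', j')).
have bt x y z : (x < y)%N (+) (x < z)%N -> (minn y z <= x < maxn y z)%N.
  by rewrite geq_min leq_max; case: (ltnP x y); case: (ltnP x z) => //= ->; rewrite ?orbT.
split; [|by move=> ? ?; rewrite bd_el|].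
  by move=> x y; rewrite /elh /elv /= => /orP[] /andP[/eqP-> /bt] /andP[_ /ltnW xm];
    rewrite !ltnS; apply/andP; split; rewrite ?leq_max ?leqnn ?orbT //;
    move: xm; rewrite leq_max => /orP[] ->; rewrite ?orbT.
have pmin x y z (l : R) : l < pos R N y -> l < pos R N z -> (minn y z <= x)%N -> l < pos R N x.
  by move=> ly lz; rewrite geq_min => /orP[] /(pos_le R N); apply: lt_le_trans.
have pmax x y z (l : R) : pos R N y < l -> pos R N z < l -> (x < maxn y z)%N -> pos R N x < l.
  by move=> ly lz; rewrite leq_max => /orP[] /ltnW /(pos_le R N) /le_lt_trans; apply.
move=> x y; rewrite /elh /elv /= => hv [k Kk xyk]; apply: (H k) => //.
have -> : r0 = (r0 - r) + r by lra.
suff: ball p (2 * r) (gp R N (x, y)).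
  move=> bp; apply: ball_triangle xyk; apply: le_ball bp; lra.
apply/plballP => /=; case/orP: hv => /andP[/eqP-> /bt/andP[m1 m2]]; split=> //.
- exact: pmin m1.
- exact: pmax m2.
- exact: pmin m1.
- exact: pmax m2.
Qed.

Lemma conn_linked K p q : closed K -> conn K p q -> linked K p q.
Proof.
move=> cK [C [Cp CK cC] Cq]; apply: (connected_ind cC Cp Cq).
  exact: linked_refl (CK _ Cp).
move=> x Cx; apply: filterS (linked_shift (linked_refl cK (CK _ Cx))) => y xy _.
by split=> [/linked_trans|/linked_trans]; apply=> //; exact: linked_sym.
Qed.

(* Alexander's addition argument: the given faces split into those near [F1],
   which are not near [F2], and the others; adding the boundary of the former to
   the second chain, or that of the latter to the first, gives the same chain. *)
Lemma alexander F1 F2 N (t M : R) a b h1 v1 h2 v2 l (c : bool) m1 m2 :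
  (forall y, F1 y -> `|y.1| <= M /\ `|y.2| <= M) -> M <= N%:R ->
  3 * mesh R N <= t -> 2 * mesh R N <= 1 ->
  chain_bounded m1 h1 v1 -> chain_bounded m2 h2 v2 ->
  bd h2 v2 =2 (fun i j => ((i, j) == a) (+) ((i, j) == b)) ->
  chain_off F1 t N h1 v1 -> chain_off F2 t N h2 v2 ->
  (forall i j, bdh l i j = (c && (j == 0%N)) (+) (h1 i j (+) h2 i j)) ->
  (forall i j, bdv l i j = (c && (i == 0%N)) (+) (v1 i j (+) v2 i j)) ->
  (forall i j, l i j -> nearF F1 (3 * mesh R N) N (i, j) ->
     nearF F2 (3 * mesh R N) N (i, j) -> False) ->
  link (F1 `|` F2) (2 * mesh R N) N a b.
Proof.
set e := mesh R N; move=> bM MN et e1 B1 B2 D2 O1 O2 lh lv sep.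
have e0 : 0 < e := mesh_gt0 R N.
pose n1 i j := `[< nearF F1 (3 * e) N (i, j) >].
pose l1 i j := l i j && n1 i j; pose l0 i j := l i j && ~~ n1 i j.
have ll1 i j : l i j = l1 i j (+) l0 i j by rewrite /l1 /l0; case: (l i j); case: (n1 i j).
have lh1 i j : bdh l i j = bdh l1 i j (+) bdh l0 i j.
  by rewrite /bdh /prevb; case: j => [|j]; rewrite !ll1 ?addbF // addbACA.
have lv1 i j : bdv l i j = bdv l1 i j (+) bdv l0 i j.
  by rewrite /bdv /prevb; case: i => [|i]; rewrite !ll1 ?addbF // addbACA.
pose h i j := h2 i j (+) bdh l1 i j; pose v i j := v2 i j (+) bdv l1 i j.
have hE i j : h i j = h1 i j (+) ((c && (j == 0%N)) (+) bdh l0 i j).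
  by have := lh1 i j; rewrite lh /h; case: (c && _); case: (h1 i j); case: (h2 i j);
  case: (bdh l1 i j); case: (bdh l0 i j).
have vE i j : v i j = v1 i j (+) ((c && (i == 0%N)) (+) bdv l0 i j).
  by have := lv1 i j; rewrite lv /v; case: (c && _); case: (v1 i j); case: (v2 i j);
  case: (bdv l1 i j); case: (bdv l0 i j).
pose K := Num.truncn ((M + 3 * e + N.+1%:R) * N.+1%:R).
have nb i j : n1 i j -> (i < K.+1)%N && (j < K.+1)%N.
  move=> /asboolP[y /bM [y1 y2] /plballP[/= h3 _ h4 _]].
  have := ler_norm y.1; have := ler_norm y.2.
  by move=> z2 z1; apply/andP; split; apply: pos_lt_bound; lra.
have Bl : chain_bounded K.+2 (bdh l1) (bdv l1).
  have nb' i j : l1 i j -> (i < K.+1)%N && (j < K.+1)%N by case/andP => _; exact: nb.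
  have nb2 i j : l1 i j -> (i < K.+2)%N && (j < K.+2)%N.
    by case/nb'/andP => x y; rewrite (leqW x) (leqW y). 
  move=> i j; rewrite /bdh /bdv /prevb => hv.
  have : [|| l1 i j, (if j is j'.+1 then l1 i j' else false) | (if i is i'.+1 then l1 i' j else false)].
    by move: hv; case: (l1 i j); case: j => [|j]; case: i => [|i] //=; case: (l1 _ _).
  case/or3P => [/nb2 //| |].
    by case: j {hv} => // j /nb'/andP[x y]; apply/andP; split; [exact: leqW x|exact: y].
  by case: i {hv} => // i /nb'/andP[x y]; apply/andP; split; [exact: x|exact: leqW y].
exists (maxn m2 K.+2), h, v; split; first exact: chain_bounded_add.
  by move=> i j; rewrite bd_add bd_face addbF D2.
have te : 2 * e <= t by lra.
move=> i j hv [y [F1y|F2y] ijy].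
- have ny : nearF F1 (2 * e) N (i, j) by exists y.
  have n1ij : n1 i j by apply/asboolP; apply: nearF_le ny; lra.
  have /negP nhv : ~ (h1 i j || v1 i j).
    by move=> /O1; apply; apply: nearF_le ny.
  have [y1 y2] := bM _ F1y; have := ler_norm (- y.1); have := ler_norm (- y.2).
  move: ijy => /plballP[/= h3 h4 h5 h6] n2 n3.
  have p0 : pos R N 0 = - N.+1%:R by rewrite /pos mul0r sub0r.
  (* If [c] holds, the boundary of [l] contains the axes. They have a coordinate [- (N + 1)] and are
     too far from [F1], which lies within [M <= N], to matter here. *)
  have i0 : (i == 0%N) = false.
    apply/eqP => i0; move: h4; rewrite i0 p0 -natr1 => h4; rewrite !normrN in n2 n3; lra.
  have j0 : (j == 0%N) = false.
    apply/eqP => j0; move: h6; rewrite j0 p0 -natr1 => h6; rewrite !normrN in n2 n3; lra.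
  move: hv nhv; rewrite negb_or hE vE i0 j0 !andbF !addFb => hv /andP[/negbTE nh /negbTE nv].
  move: hv; rewrite nh nv !addFb /bdh /bdv /l0 n1ij andbF !addFb /prevb => /orP[].
    case: j j0 ny {h3 h4 h5 h6 hE vE nh nv n1ij} => // j _ /nearF_step2 ny /andP[_ /negP]; apply.
    by apply/asboolP; apply: nearF_le ny; rewrite -/e; lra.
  case: i i0 ny {h3 h4 h5 h6 hE vE nh nv n1ij} => // i _ /nearF_step1 ny /andP[_ /negP]; apply.
  by apply/asboolP; apply: nearF_le ny; rewrite -/e; lra.
- have ny : nearF F2 (2 * e) N (i, j) by exists y.
  have nhv : ~~ (h2 i j || v2 i j).
    by apply/negP => /O2; apply; apply: nearF_le ny.
  have n1ij : l1 i j = false.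
    apply/negP => /andP[lij /asboolP n1ij]; apply: (sep i j) => //; apply: nearF_le ny; lra.
  move: hv nhv; rewrite negb_or /h /v => hv /andP[/negbTE nh /negbTE nv].
  move: hv; rewrite nh nv !addFb /bdh /bdv n1ij !addFb /prevb => /orP[].
    case: j ny {ijy nh nv n1ij} => // j /nearF_step2 ny /andP[lij /asboolP n1ij].
    by apply: (sep i j) => //; apply: nearF_le ny; rewrite -/e; lra.
  case: i ny {ijy nh nv n1ij} => // i /nearF_step1 ny /andP[lij /asboolP n1ij].
  by apply: (sep i j) => //; apply: nearF_le ny; rewrite -/e; lra.
Qed.

End Addition.

(** * Passage to fine grids *)

Section AdditionLimit.
Variable R : realType.
Notation pl := (plane R).
Implicit Types (p q : pl) (K F : set pl) (N : nat) (a b : nat * nat).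

Lemma plane_hausdorff : hausdorff_space (plane R).
Proof.
rewrite ball_hausdorff => p q pq.
have [d d0 H] : exists2 d : R, 0 < d & d <= `|p.1 - q.1| \/ d <= `|p.2 - q.2|.
  have [e1|n1] := eqVneq p.1 q.1; last first.
    by exists `|p.1 - q.1|; [rewrite normr_gt0 subr_eq0|left].
  have [e2|n2] := eqVneq p.2 q.2; last first.
    by exists `|p.2 - q.2|; [rewrite normr_gt0 subr_eq0|right].
  by move/eqP: pq; case; move: e1 e2; case: (p) (q) => [? ?] [? ?] /= -> ->.
have d2 : 0 < d / 2 by rewrite divr_gt0.
exists (PosNum d2, PosNum d2) => /=; apply/eqP/seteqP; split=> // z [/plballP[a1 a2 a3 a4] /plballP[b1 b2 b3 b4]].
by case: H; apply/negP; rewrite -ltNge; apply/ltr_normlP; split; lra.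
Qed.

Lemma pl_compact_closed K : compact K -> closed K.
Proof. by apply: compact_closed; exact: plane_hausdorff. Qed.

Lemma pl_compact_bounded K : compact K ->
  exists M : R, forall y, K y -> `|y.1| <= M /\ `|y.2| <= M.
Proof.
move=> /compact_near_coveringP/(_ R (pinfty_nbhs R)
  (fun M y => `|y.1| <= M /\ `|y.2| <= M) _) H.
have : \forall M \near +oo, K `<=` (fun y : pl => `|y.1| <= M /\ `|y.2| <= M).
  apply: H => x _.
  exists (ball x 1, [set M | Num.max `|x.1| `|x.2| + 1 < M]); last first.
    move=> [y M] /= [/plballP[h1 h2 h3 h4] hM].
    have m1 : `|x.1| <= Num.max `|x.1| `|x.2| by rewrite le_max lexx.
    have m2 : `|x.2| <= Num.max `|x.1| `|x.2| by rewrite le_max lexx orbT.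
    have := ler_norm x.1; have := ler_norm x.2; have := ler_norm (- x.1); have := ler_norm (- x.2).
    by rewrite !normrN => *; split; apply/ler_normlP; split; lra.
  split; first by apply: nbhsx_ballx.
  by exists (Num.max `|x.1| `|x.2| + 1); split=> //; apply: num_real.
case=> M [_ HM]; exists (M + 1) => y Ky.
by apply: (HM (M + 1)) => //; rewrite ltrDl.
Qed.

(** A point of [F1] either lies in [F2] or is at a positive distance from it; compactness of [F1]
    makes the resulting margin uniform. *)
Lemma compact_margin F1 F2 (t : R) : compact F1 -> closed F2 -> 0 < t ->
  exists2 s : R, 0 < s & forall c d1 d2, F1 d1 -> F2 d2 -> ball c s d1 -> ball c s d2 ->
    exists2 d, (F1 `&` F2) d & ball d t c.
Proof.
move=> cF1 cF2 t0.
move/compact_near_coveringP: cF1 => /(_ R (0^'+)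
  (fun s d1 => forall c d2, F2 d2 -> ball c s d1 -> ball c s d2 ->
    exists2 d, (F1 `&` F2) d & ball d t c) _) H.
have [] : \forall s \near 0^'+, F1 `<=` (fun d1 => forall c d2, F2 d2 -> ball c s d1 -> ball c s d2 ->
    exists2 d, (F1 `&` F2) d & ball d t c).
  apply: H => d F1d.
  have gen (u : R) : 0 < u -> (forall d1 s c d2, ball d u d1 -> s < u -> F2 d2 ->
      ball c s d1 -> ball c s d2 -> exists2 d, (F1 `&` F2) d & ball d t c) ->
      \forall d1 \near d & s \near 0^'+, forall c d2, F2 d2 -> ball c s d1 -> ball c s d2 ->
        exists2 d, (F1 `&` F2) d & ball d t c.
    move=> u0 Hu; exists (ball d u, [set s | s < u]).
      split; first exact: nbhsx_ballx.
      exact: nbhs_right_lt.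
    by move=> [d1 s] /= [? ?] c d2; exact: Hu.
  have [F2d|F2d] := pselect (F2 d).
    apply: (gen (t / 2)); first by rewrite divr_gt0.
    move=> d1 s c d2 dd1 st F2d2 cd1 _; exists d => //.
    rewrite [t]splitr; apply: ball_triangle dd1 _; apply: ball_sym.
    by apply: le_ball cd1; exact: ltW.
  have [r r0 Hr] := closed_ball_miss cF2 F2d.
  apply: (gen (r / 3)); first by rewrite divr_gt0.
  move=> d1 s c d2 dd1 st F2d2 cd1 cd2; case: (Hr d2) => //.
  have -> : r = r / 3 + (r / 3 + r / 3) by lra.
  apply: ball_triangle dd1 _; apply: (@ball_triangle _ _ c).
    by apply: ball_sym; apply: le_ball cd1; exact: ltW.
  by apply: le_ball cd2; exact: ltW.
move=> s /= s0 Hs; exists (s / 2); first by rewrite divr_gt0.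
move=> c d1 d2 F1d1 F2d2 cd1 cd2; apply: (Hs (s / 2) _ _ d1 F1d1 c d2 F2d2 cd1 cd2) => //=.
- by rewrite sub0r normrN gtr0_norm ?divr_gt0 //; lra.
- by rewrite divr_gt0.
Qed.

Lemma conn_idx K p : closed K -> ~ K p -> exists2 r : R, 0 < r &
  forall N, r^-1 <= N%:R -> conn K p (gp R N (idx N p)).
Proof.
move=> cK Kp; have [r0 r00 H] := closed_ball_miss cK Kp.
pose M := `|p.1| + `|p.2| + 1.
have M1 : 1 <= M by rewrite /M lerDr addr_ge0.
pose r := Num.min (r0 / 4) M^-1.
have r_gt0 : 0 < r by rewrite lt_min divr_gt0 //= invr_gt0; lra.
have rr0 : r <= r0 / 4 by rewrite ge_min lexx.
have rM : r <= M^-1 by rewrite ge_min lexx orbT.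
exists r => // N rN.
have MN : M <= N%:R by apply: (le_trans _ rN); rewrite -[M]invrK; exact: (inv_le r_gt0 rM).
have e0 := mesh_gt0 R N; have er := mesh_lt r_gt0 rN.
have N1 : `|p.1| + 1 <= N%:R by apply: le_trans MN; rewrite /M lerD2r lerDl.
have N2 : `|p.2| + 1 <= N%:R by apply: le_trans MN; rewrite /M lerD2r lerDr.
apply: (@conn_ball _ K p r0) => //; first exact: ballxx.
apply: (@le_ball _ _ _ (r + mesh R N)); first by lra.
apply: idx_ball; [| |exact: ballxx].
- by apply: (@far_range _ p.1 p.1 1) => //; lra.
- by apply: (@far_range _ p.2 p.2 1) => //; lra.
Qed.

Lemma idx_near c : exists2 s : R, 0 < s & forall (t : R) N, 0 < t -> s^-1 <= N%:R -> mesh R N < t ->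
   ball c t (gp R N (idx N c)).
Proof.
pose M := `|c.1| + `|c.2| + 1.
have M1 : 1 <= M by rewrite /M lerDr addr_ge0.
exists M^-1; first by rewrite invr_gt0; lra.
move=> t N t0; rewrite invrK => MN et; have e0 := mesh_gt0 R N.
have N1 : `|c.1| + 1 <= N%:R by apply: le_trans MN; rewrite /M lerD2r lerDl.
have N2 : `|c.2| + 1 <= N%:R by apply: le_trans MN; rewrite /M lerD2r lerDr.
have : ball c (t - mesh R N + mesh R N) (gp R N (idx N c)).
  apply: idx_ball; [| |by apply: ballxx; lra].
  - by apply: (@far_range _ c.1 c.1 1) => //; lra.
  - by apply: (@far_range _ c.2 c.2 1) => //; lra.
by rewrite subrK.
Qed.

(** Balls are axis-parallel squares, so with two grid points they contain the rectangle spanned by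
    them, in which the cycle has no edge. *)
Lemma fill_ball_const h v N (c : pl) (t : R) i j i' j' : bd h v =2 (fun _ _ => false) ->
  (forall k k', ball c t (gp R N (k, k')) -> ~~ h k k' && ~~ v k k') ->
  ball c t (gp R N (i, j)) -> ball c t (gp R N (i', j')) ->
  fill h i j = fill h i' j'.
Proof.
move=> z off /plballP[/= h1 h2 h3 h4] /plballP[/= g1 g2 g3 g4].
have pmin x y u (l : R) : l < pos R N y -> l < pos R N u -> (minn y u <= x)%N -> l < pos R N x.
  by move=> ly lz; rewrite geq_min => /orP[] /(pos_le R N); apply: lt_le_trans.
have pmax x y u (l : R) : pos R N y < l -> pos R N u < l -> (x <= maxn y u)%N -> pos R N x < l.
  by move=> ly lz; rewrite leq_max => /orP[] /(pos_le R N) /le_lt_trans; apply.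
apply: faces_const => k k' /andP[a1 a2] /andP[b1 b2].
rewrite bdh_fill (bdv_fill z); apply: off; apply/plballP; split=> /=.
- exact: pmin a1.
- exact: pmax a2.
- exact: pmin b1.
- exact: pmax b2.
Qed.

Definition faces h1 h2 := fill (fun i j => h1 i j (+) h2 i j).

(** Two chains with the same ends form a cycle, which bounds [faces h1 h2]. Neither chain comes near
    a common point, so the value there is well defined. It is the only obstruction: if all common
    points have the same value, the chains can be combined into one off both sets. *)
Lemma alexander_limit F1 F2 (t : R) : compact F1 -> compact F2 -> 0 < t ->
  exists2 s : R, 0 < s & forall N, s^-1 <= N%:R ->
    forall a b h1 v1 h2 v2 m1 m2,
    chain_bounded m1 h1 v1 -> chain_bounded m2 h2 v2 ->
    bd h1 v1 =2 (fun i j => ((i, j) == a) (+) ((i, j) == b)) ->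
    bd h2 v2 =2 (fun i j => ((i, j) == a) (+) ((i, j) == b)) ->
    chain_off F1 t N h1 v1 -> chain_off F2 t N h2 v2 ->
    (forall c i j i' j', (F1 `&` F2) c -> ball c t (gp R N (i, j)) -> ball c t (gp R N (i', j')) ->
      faces h1 h2 i j = faces h1 h2 i' j') /\
    ((exists cc, forall c i j, (F1 `&` F2) c -> ball c t (gp R N (i, j)) ->
       faces h1 h2 i j = cc) ->
     link (F1 `|` F2) (2 * mesh R N) N a b).
Proof.
move=> cF1 cF2 t0; have [s s0 Hs] := compact_margin cF1 (pl_compact_closed cF2) t0.
have [M0 HM] := pl_compact_bounded cF1.
pose M := Num.max M0 1; have M1 : 1 <= M by rewrite le_max lexx orbT.
pose u := Num.min (Num.min (t / 3) (s / 3)) (Num.min M^-1 2^-1).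
have Mp : 0 < M := lt_le_trans ltr01 M1.
have u0 : 0 < u.
  have [t3 s3] : 0 < t / 3 /\ 0 < s / 3 by split; rewrite divr_gt0.
  by rewrite !lt_min t3 s3 !invr_gt0 Mp /=.
exists u => // N uN a b h1 v1 h2 v2 m1 m2 B1 B2 D1 D2 O1 O2.
have eu := mesh_lt u0 uN; have e0 := mesh_gt0 R N.
have /andP[/andP[et es] /andP[eM e2]] : ((mesh R N < t / 3) && (mesh R N < s / 3)) &&
    ((mesh R N < M^-1) && (mesh R N < 2^-1)) by rewrite -!lt_min.
have MN : M <= N%:R.
  apply: (le_trans _ uN); rewrite -[M]invrK; apply: inv_le => //.
  by rewrite !ge_min lexx !orbT.
have z : bd (fun i j => h1 i j (+) h2 i j) (fun i j => v1 i j (+) v2 i j) =2 (fun _ _ => false).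
  by move=> i j; rewrite bd_add D1 D2 addbb.
split.
  move=> c i j i' j' [F1c F2c]; apply: fill_ball_const z _ => x y /ball_sym cxy.
  have /negP : ~ (h1 x y || v1 x y) by move/O1; apply; exists c.
  have /negP : ~ (h2 x y || v2 x y) by move/O2; apply; exists c.
  by rewrite !negb_or => /andP[/negbTE-> /negbTE->] /andP[/negbTE-> /negbTE->].
case=> cc Hcc.
(* Adding [cc] clears the faces near all common points. If this is a complementation, the axes enter
   the boundary, which is the role of [c] in [alexander]. *)
pose l i j := cc (+) faces h1 h2 i j.
apply: (@alexander _ F1 F2 N t M a b h1 v1 h2 v2 l cc m1 m2) => //.
- by move=> y /HM [y1 y2]; rewrite /M !le_max y1 y2.
- lra.
- lra.
- move=> i j; have := bdh_fill (fun i j => h1 i j (+) h2 i j) i j.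
  rewrite /bdh /l /faces /prevb => <-; case: j => [|j].
    by rewrite !addbF andbT.
  by rewrite andbF addFb addbACA addbb addFb.
- move=> i j; have := bdv_fill z i j.
  rewrite /bdv /l /faces /prevb => <-; case: i => [|i].
    by rewrite !addbF andbT.
  by rewrite andbF addFb addbACA addbb addFb.
- move=> i j lij [d1 Fd1 b1] [d2 Fd2 b2].
  have e3 : 3 * mesh R N <= s by lra.
  have [d Fd dd] := Hs _ _ _ Fd1 Fd2 (le_ball e3 b1) (le_ball e3 b2).
  by move: lij; rewrite /l (Hcc _ _ _ Fd dd) addbb.
Qed.

Lemma level (s : seq R) : all (fun x => 0 < x) s -> exists N, all (fun x => x^-1 <= N%:R) s.
Proof.
elim: s => [|x s IH] /=; first by exists 0%N.
case/andP => x0 /IH[N HN]; exists (maxn N (Num.truncn x^-1).+1).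
apply/andP; split.
  apply: ltW; apply: lt_le_trans (truncnS_gt _) _; by rewrite ler_nat leq_maxr.
by apply: sub_all HN => y /le_trans; apply; rewrite ler_nat leq_maxl.
Qed.

Lemma link_conn_idx K N p q : closed K -> conn K p (gp R N (idx N p)) -> conn K q (gp R N (idx N q)) ->
  link K (2 * mesh R N) N (idx N p) (idx N q) -> conn K p q.
Proof.
move=> cK pp qq L; apply: (conn_trans pp); apply: conn_trans (conn_sym qq).
apply: link_conn L; last exact: conn_outr pp.
have := mesh_gt0 R N; lra.
Qed.

Lemma closedU2 F1 F2 : compact F1 -> compact F2 -> closed (F1 `|` F2).
Proof. by move=> c1 c2; apply: closedU; exact: pl_compact_closed. Qed.

Lemma conn_add1 F1 F2 x p q : compact F1 -> compact F2 ->
  (forall c, F1 c -> F2 c -> c = x) -> conn F1 p q -> conn F2 p q -> conn (F1 `|` F2) p q.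
Proof.
move=> c1 c2 Fx pq1 pq2; have cF := closedU2 c1 c2.
have np : ~ (F1 `|` F2) p by move=> [/(conn_outl pq1)|/(conn_outl pq2)].
have nq : ~ (F1 `|` F2) q by move=> [/(conn_outr pq1)|/(conn_outr pq2)].
have [r1 r10 H1] := conn_linked (pl_compact_closed c1) pq1.
have [r2 r20 H2] := conn_linked (pl_compact_closed c2) pq2.
pose t := Num.min r1 r2; have t0 : 0 < t by rewrite lt_min r10.
have [s s0 Hs] := alexander_limit c1 c2 t0.
have [rp rp0 Hp] := conn_idx cF np; have [rq rq0 Hq] := conn_idx cF nq.
have [sx sx0 Hx] := idx_near x.
have [N] : exists N, all (fun x => x^-1 <= N%:R) [:: r1; r2; t; s; rp; rq; sx].
  by apply: level; rewrite /= r10 r20 t0 s0 rp0 rq0 sx0.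
case/and5P => N1 N2 Nt Ns /and4P[Np Nq Nx _].
have et := mesh_lt t0 Nt.
have t1 : t <= r1 by rewrite ge_min lexx.
have t2 : t <= r2 by rewrite ge_min lexx orbT.
have [m1 [h1 [v1 [B1 D1 O1]]]] := link_le t1 (H1 _ _ _ N1 (ballxx _ r10) (ballxx _ r10)).
have [m2 [h2 [v2 [B2 D2 O2]]]] := link_le t2 (H2 _ _ _ N2 (ballxx _ r20) (ballxx _ r20)).
have [C L] := Hs _ Ns _ _ _ _ _ _ _ _ B1 B2 D1 D2 O1 O2.
apply: (link_conn_idx cF (Hp _ Np) (Hq _ Nq)); apply: L.
exists (faces h1 h2 (idx N x).1 (idx N x).2) => c i j Fc cij.
have cx : c = x by case: Fc; exact: Fx.
by rewrite cx in Fc cij; apply: (C x) => //; rewrite -surjective_pairing; exact: Hx.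
Qed.

(** Whether the values at [x] and [y] differ is additive under concatenation of chains. It cannot be
    true for [p q], for [q r] and for their concatenation [p r], and a pair for which it fails is
    joined. *)
Lemma conn_add2 F1 F2 x y p q r : compact F1 -> compact F2 ->
  (forall c, F1 c -> F2 c -> c = x \/ c = y) -> conn F1 p q -> conn F2 p q ->
  conn F1 q r -> conn F2 q r ->
  [\/ conn (F1 `|` F2) p q, conn (F1 `|` F2) q r | conn (F1 `|` F2) p r].
Proof.
move=> c1 c2 Fx pq1 pq2 qr1 qr2; have cF := closedU2 c1 c2.
have np : ~ (F1 `|` F2) p by move=> [/(conn_outl pq1)|/(conn_outl pq2)].
have nq : ~ (F1 `|` F2) q by move=> [/(conn_outr pq1)|/(conn_outr pq2)].
have nr : ~ (F1 `|` F2) r by move=> [/(conn_outr qr1)|/(conn_outr qr2)].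
have [r1 r10 H1] := conn_linked (pl_compact_closed c1) pq1.
have [r2 r20 H2] := conn_linked (pl_compact_closed c2) pq2.
have [r3 r30 H3] := conn_linked (pl_compact_closed c1) qr1.
have [r4 r40 H4] := conn_linked (pl_compact_closed c2) qr2.
pose t := Num.min (Num.min r1 r2) (Num.min r3 r4).
have t0 : 0 < t by rewrite !lt_min r10 r20 r30.
have [s s0 Hs] := alexander_limit c1 c2 t0.
have [rp rp0 Hp] := conn_idx cF np; have [rq rq0 Hq] := conn_idx cF nq.
have [rr rr0 Hr] := conn_idx cF nr.
have [sx sx0 Hx] := idx_near x; have [sy sy0 Hy] := idx_near y.
have [N] : exists N, all (fun x => x^-1 <= N%:R) [:: r1; r2; r3; r4; t; s; rp; rq; rr; sx; sy].
  by apply: level; rewrite /= r10 r20 r30 r40 t0 s0 rp0 rq0 rr0 sx0 sy0.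
case/and5P => N1 N2 N3 N4 /and5P[Nt Ns Np Nq /and4P[Nr Nx Ny _]].
have et := mesh_lt t0 Nt.
have t1 : t <= r1 by rewrite !ge_min lexx.
have t2 : t <= r2 by rewrite !ge_min lexx !orbT.
have t3 : t <= r3 by rewrite !ge_min lexx !orbT.
have t4 : t <= r4 by rewrite !ge_min lexx !orbT.
have [m1 [h1 [v1 [B1 D1 O1]]]] := link_le t1 (H1 _ _ _ N1 (ballxx _ r10) (ballxx _ r10)).
have [m2 [h2 [v2 [B2 D2 O2]]]] := link_le t2 (H2 _ _ _ N2 (ballxx _ r20) (ballxx _ r20)).
have [m3 [h3 [v3 [B3 D3 O3]]]] := link_le t3 (H3 _ _ _ N3 (ballxx _ r30) (ballxx _ r30)).
have [m4 [h4 [v4 [B4 D4 O4]]]] := link_le t4 (H4 _ _ _ N4 (ballxx _ r40) (ballxx _ r40)).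
have [C12 L12] := Hs _ Ns _ _ _ _ _ _ _ _ B1 B2 D1 D2 O1 O2.
have [C34 L34] := Hs _ Ns _ _ _ _ _ _ _ _ B3 B4 D3 D4 O3 O4.
have D13 : bd (fun i j => h1 i j (+) h3 i j) (fun i j => v1 i j (+) v3 i j) =2
    (fun i j => ((i, j) == idx N p) (+) ((i, j) == idx N r)).
  by move=> i j; rewrite bd_add D1 D3 -addbA; congr addb; rewrite addbA addbb.
have D24 : bd (fun i j => h2 i j (+) h4 i j) (fun i j => v2 i j (+) v4 i j) =2
    (fun i j => ((i, j) == idx N p) (+) ((i, j) == idx N r)).
  by move=> i j; rewrite bd_add D2 D4 -addbA; congr addb; rewrite addbA addbb.
have [C L] := Hs _ Ns _ _ _ _ _ _ _ _ (chain_bounded_add B1 B3) (chain_bounded_add B2 B4)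
  D13 D24 (chain_off_add O1 O3) (chain_off_add O2 O4).
have split_faces i j : faces (fun i j => h1 i j (+) h3 i j) (fun i j => h2 i j (+) h4 i j) i j
    = faces h1 h2 i j (+) faces h3 h4 i j.
  by rewrite /faces /fill -big_split /=; apply: eq_bigr => k _; rewrite addbACA.
have ix : ball x t (gp R N ((idx N x).1, (idx N x).2)) by rewrite -surjective_pairing; exact: Hx.
have iy : ball y t (gp R N ((idx N y).1, (idx N y).2)) by rewrite -surjective_pairing; exact: Hy.
have const l : (forall c i j i' j', (F1 `&` F2) c -> ball c t (gp R N (i, j)) ->
      ball c t (gp R N (i', j')) -> l i j = l i' j') ->
    l (idx N x).1 (idx N x).2 = l (idx N y).1 (idx N y).2 ->
    exists cc : bool, forall c i j, (F1 `&` F2) c -> ball c t (gp R N (i, j)) -> l i j = cc.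
  move=> Cl exy; exists (l (idx N x).1 (idx N x).2) => c i j Fc cij.
  have [cx|cy] : c = x \/ c = y by case: Fc; exact: Fx.
    by rewrite cx in Fc cij; exact: (Cl x).
  by rewrite exy; rewrite cy in Fc cij; exact: (Cl y).
have [e12|n12] := eqVneq (faces h1 h2 (idx N x).1 (idx N x).2) (faces h1 h2 (idx N y).1 (idx N y).2).
  by apply: Or31; apply: (link_conn_idx cF (Hp _ Np) (Hq _ Nq)); apply/L12/const.
have [e34|n34] := eqVneq (faces h3 h4 (idx N x).1 (idx N x).2) (faces h3 h4 (idx N y).1 (idx N y).2).
  by apply: Or32; apply: (link_conn_idx cF (Hq _ Nq) (Hr _ Nr)); apply/L34/const.
apply: Or33; apply: (link_conn_idx cF (Hp _ Np) (Hr _ Nr)); apply/L/const => //.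
rewrite !split_faces; move: n12 n34.
by do 4!case: (faces _ _ _ _).
Qed.

End AdditionLimit.

(** * Separation by two arcs *)

Section Separation.
Variable R : realType.
Notation pl := (plane R).
Implicit Types (p q : pl) (K F : set pl) (N : nat).

Lemma fill_bdh l i j : fill (bdh l) i j = l i j.
Proof.
rewrite /fill; elim: j => [|j IH]; first by rewrite big_ord1 /bdh /= addbF.
by rewrite big_ord_recr /= IH /bdh /= addbC -addbA addbb addbF.
Qed.

Lemma idx_gp N i j : idx N (gp R N (i, j)) = (i, j).
Proof.
have E k : idx1 N (pos R N k) = k.
  by rewrite /idx1 /pos subrK /mesh mulrVK ?unitfE // natrK.
by rewrite /idx /= !E.
Qed.

Lemma link_all K (t : R) N (a0 : nat * nat) (s : seq (nat * nat)) :
  (forall a, a \in s -> link K t N a0 a) ->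
  exists m h v, [/\ chain_bounded m h v,
    bd h v =2 (fun i j => (odd (size s) && ((i, j) == a0)) (+) odd (count_mem (i, j) s)) &
    chain_off K t N h v].
Proof.
elim: s => [|a s IH] H.
  by exists 0%N, (fun _ _ => false), (fun _ _ => false); split=> // i j; rewrite /bd /prevb; case: i j => [|i] [|j].
have [m [h [v [B D O]]]] : exists m h v, [/\ chain_bounded m h v,
    bd h v =2 (fun i j => (odd (size s) && ((i, j) == a0)) (+) odd (count_mem (i, j) s)) &
    chain_off K t N h v].
  by apply: IH => b bs; apply: H; rewrite inE bs orbT.
have [m' [h' [v' [B' D' O']]]] := H a (mem_head _ _).
exists (maxn m m'), (fun i j => h i j (+) h' i j), (fun i j => v i j (+) v' i j).
split; [exact: chain_bounded_add| |exact: chain_off_add].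
move=> i j; rewrite bd_add D D' /= oddD oddb [a == _]eq_sym.
by case: (odd (size s)); case: ((i, j) == a0); case: (odd _); case: ((i, j) == a).
Qed.

(** The points of the boundary are joined to the hub [a0]. Their number is even, as for any finite
    chain, so the hub cancels in the sum. *)
Lemma link_boundary K (t : R) N (a0 : nat * nat) m h v : chain_bounded m h v ->
  (forall i j, bd h v i j -> link K t N a0 (i, j)) ->
  exists m' h' v', [/\ chain_bounded m' h' v', bd h' v' =2 bd h v & chain_off K t N h' v'].
Proof.
move=> B L.
pose s := [seq a <- [seq (i, j) | i <- iota 0 m.+1, j <- iota 0 m.+1] | bd h v a.1 a.2].
have us : uniq s by rewrite filter_uniq // allpairs_uniq ?iota_uniq // => -[? ?] [? ?].
have sE i j : ((i, j) \in s) = bd h v i j.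
  rewrite mem_filter andb_idr // => /(bd_bounded B)/andP[im jm].
  by apply/allpairsPdep; exists i, j; rewrite !mem_iota !add0n !ltnS im jm.
have [|m' [h' [v' [B' D' O']]]] := @link_all K t N a0 s.
  by move=> [i j]; rewrite sE; exact: L.
have D2 : bd h' v' =2 (fun i j => (odd (size s) && ((i, j) == a0)) (+) bd h v i j).
  by move=> i j; rewrite D' count_uniq_mem // sE oddb.
have es : odd (size s) = false.
  apply/negP => os; apply: (bd_not_single (a := a0) (chain_bounded_add B' B)) => i j.
  by rewrite bd_add D2 os -addbA addbb addbF.
by exists m', h', v'; split=> // i j; rewrite D2 es.
Qed.

(** The winding parity of a cycle is locally constant off the cycle, hence constant on a connected
    set that the cycle avoids. *)
Lemma fill_connected_const K h v N (t M : R) x y : bd h v =2 (fun _ _ => false) ->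
  connected K -> K x -> K y -> (forall c, K c -> `|c.1| <= M /\ `|c.2| <= M) ->
  M + 1 <= N%:R -> 0 < t -> mesh R N < t / 2 -> chain_off K t N h v ->
  fill h (idx N x).1 (idx N x).2 = fill h (idx N y).1 (idx N y).2.
Proof.
move=> z cK Kx Ky bM MN t0 et O.
apply: (connected_ind (P := fun c => fill h (idx N x).1 (idx N x).2 = fill h (idx N c).1 (idx N c).2) cK Kx Ky) => //.
move=> c Kc; have t2 : 0 < t / 2 by rewrite divr_gt0.
have range d : K d -> - N.+1%:R <= d.1 /\ - N.+1%:R <= d.2.
  move=> /bM [d1 d2]; rewrite -natr1; have := ler_norm (- d.1); have := ler_norm (- d.2).
  by rewrite !normrN => *; split; lra.
have inb d : K d -> ball c (t / 2) d -> ball c t (gp R N ((idx N d).1, (idx N d).2)).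
  move=> Kd cd; rewrite -surjective_pairing; have [d1 d2] := range _ Kd.
  by apply: le_ball (idx_ball d1 d2 cd); lra.
apply/nbhs_ballP; exists (t / 2) => //= d cd Kd.
suff -> : fill h (idx N c).1 (idx N c).2 = fill h (idx N d).1 (idx N d).2 by [].
apply: (fill_ball_const z _ (inb _ Kc _) (inb _ Kd cd)); last exact: ballxx.
move=> k k' ck; rewrite -negb_or; apply/negP => /O; apply.
by exists c => //; exact: ball_sym.
Qed.

Lemma closed_box_compact (x : pl) (r : R) :
  compact [set c : pl | x.1 - r <= c.1 <= x.1 + r /\ x.2 - r <= c.2 <= x.2 + r].
Proof.
have := compact_setX (@segment_compact R (x.1 - r) (x.1 + r)) (@segment_compact R (x.2 - r) (x.2 + r)).
by congr compact; apply/seteqP; split=> c /=; rewrite !in_itv /=.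
Qed.

Lemma bd_edge h v i j : bd h v i j -> exists i' j', (h i' j' || v i' j') /\
  [\/ i = i' /\ j = j', i = i'.+1 /\ j = j' | i = i' /\ j = j'.+1].
Proof.
move=> E; have: [|| h i j || v i j, prevb (h^~ j) i | prevb (v i) j].
  by move: E; rewrite /bd; case: (h i j); case: (v i j); case: prevb; case: prevb.
case/or3P => [hv|hv|hv]; first by exists i, j; split=> //; constructor 1.
  case: i {E} hv => //= i hv; exists i, j; rewrite hv; split=> //; by constructor 2.
case: j {E} hv => //= j hv; exists i, j; rewrite hv orbT; split=> //; by constructor 3.
Qed.

Lemma chain_off_end K (t : R) N h v i j : chain_off K t N h v -> bd h v i j ->
  ~ nearF K (t - mesh R N) N (i, j).
Proof.
move=> O /bd_edge[i' [j' [/O nK E]]] n; apply: nK; have e0 := mesh_gt0 R N.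
have -> : t = t - mesh R N + mesh R N by rewrite subrK.
case: E n => -[-> ->].
- by apply: nearF_le; rewrite lerDl ltW.
- exact: nearF_step1.
- exact: nearF_step2.
Qed.

(* Otherwise the boundary of a small square about [x] splits into a chain off [F1]
   and one off [F2], which close up, outside [F1 `|` F2], to cycles none of which
   separates [x] from [y]. *)
Lemma two_arc_separation F1 F2 x y : compact F1 -> compact F2 -> connected F1 -> connected F2 ->
  F1 x -> F2 x -> F1 y -> F2 y -> x <> y -> (forall c, F1 c -> F2 c -> c = x \/ c = y) ->
  exists p q, [/\ ~ (F1 `|` F2) p, ~ (F1 `|` F2) q & ~ conn (F1 `|` F2) p q].
Proof.
move=> c1 c2 k1 k2 F1x F2x F1y F2y xy F12; apply: contrapT => nsep.
have all_conn p q : ~ (F1 `|` F2) p -> ~ (F1 `|` F2) q -> conn (F1 `|` F2) p q.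
  by move=> np nq; apply: contrapT => npq; apply: nsep; exists p, q.
have cF := closedU2 c1 c2.
have [r r0 xyr] : exists2 r : R, 0 < r & ~ ball x (r + r) y.
  have [] := pselect (exists2 r : R, 0 < r & ~ ball x (r + r) y) => // nr.
  case: xy; apply: (close_eq (@plane_hausdorff R)).
  rewrite ball_close => e; apply: contrapT => nb; apply: nr; exists (e%:num / 2); first by rewrite divr_gt0.
  by rewrite -splitr.
(* A point within [s0] of both sets is within [r / 4] of [x] or [y], hence not on the square of
   half-side [r] about [x]: [x] is its centre and [y] is not in the square twice as large. *)
have [s0 s00 Hs0] := compact_margin c1 (pl_compact_closed c2) (divr_gt0 r0 (ltr0n R 4) : 0 < r / 4).
pose t := Num.min s0 (r / 4).
have t0 : 0 < t by rewrite lt_min s00 divr_gt0.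
have ts : t <= s0 by rewrite ge_min lexx.
have tr : t <= r / 4 by rewrite ge_min lexx orbT.
have [M1 HM1] := pl_compact_bounded c1; have [M2 HM2] := pl_compact_bounded c2.
pose M' := Num.max (Num.max M1 M2) 0; pose M := M' + r.
have M0 : 0 <= M' by rewrite le_max lexx orbT.
have MM : M' <= M by rewrite /M lerDl ltW.
have HM' c : (F1 `|` F2) c -> `|c.1| <= M' /\ `|c.2| <= M'.
  by move=> [/HM1|/HM2] [h1 h2]; rewrite /M' !le_max h1 h2 ?orbT.
have HM c : (F1 `|` F2) c -> `|c.1| <= M /\ `|c.2| <= M.
  by move=> /HM' [h1 h2]; split; exact: le_trans MM.
pose p0 : pl := (M + 1, 0).
have np0 : ~ (F1 `|` F2) p0.
  by move=> /HM [/= + _]; have := ler_norm (M + 1); lra.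
(* A compact set that will contain all ends of the two partial chains. On it the margin of the
   chains from [p0] can be chosen uniformly, before the grid is fixed. *)
pose C := [set c : pl | x.1 - (r + r) <= c.1 <= x.1 + (r + r) /\ x.2 - (r + r) <= c.2 <= x.2 + (r + r)]
  `&` ~` \bigcup_(y in F1 `|` F2) interior (ball y (t / 2)).
have cC : compact C.
  apply: (subclosed_compact _ (@closed_box_compact x (r + r))); last by move=> c [].
  apply: closedI; first by apply: pl_compact_closed; exact: closed_box_compact.
  by apply: open_closedC; apply: bigcup_open => c _; exact: open_interior.
have [s s_gt0 Hs] : exists2 s : R, 0 < s & forall c, C c -> forall N, s^-1 <= N%:R ->
    link (F1 `|` F2) s N (idx N p0) (idx N c).
  move/compact_near_coveringP: cC => /(_ R (0^'+)
    (fun s c => forall N, s^-1 <= N%:R -> link (F1 `|` F2) s N (idx N p0) (idx N c)) _) H.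
  have [] : \forall s \near 0^'+, C `<=` (fun c => forall N, s^-1 <= N%:R ->
      link (F1 `|` F2) s N (idx N p0) (idx N c)).
    apply: H => c [_ nc].
    have nFc : ~ (F1 `|` F2) c.
      by move=> Fc; apply: nc; exists c => //; apply: nbhsx_ballx; rewrite divr_gt0.
    have [u u0 Hu] := conn_linked cF (all_conn _ _ np0 nFc).
    exists (ball c u, [set s | 0 < s /\ s < u]).
      split; first exact: nbhsx_ballx.
      by near=> z; split; near: z; [exact: nbhs_right_gt|exact: nbhs_right_lt].
    move=> [c' s] /= [cc' [s0' su]] N sN; apply: (link_le (ltW su)); apply: Hu => //.
      by apply: (le_trans _ sN); apply: inv_le => //; exact: ltW.
    exact: ballxx.
  move=> s /= s_gt0 Hs; exists (s / 2); first by rewrite divr_gt0.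
  move=> c Cc N sN; apply: (Hs (s / 2)) => //=.
  - by rewrite sub0r normrN gtr0_norm ?divr_gt0 //; lra.
  - by rewrite divr_gt0.
have [sx sx0 Hx] := idx_near x; have [sy sy0 Hy] := idx_near y.
pose u := Num.min (Num.min (t / 4) (s / 4)) (M + 1)^-1.
have u0 : 0 < u by rewrite !lt_min !divr_gt0 //= invr_gt0; lra.
have [N] : exists N, all (fun x => x^-1 <= N%:R) [:: u; s; sx; sy].
  by apply: level; rewrite /= u0 s_gt0 sx0 sy0.
case/and5P => Nu Ns Nx Ny _.
have := mesh_lt u0 Nu; rewrite !lt_min => /andP[/andP[et es] eM].
have e0 := mesh_gt0 R N.
have MN : M + 1 <= N%:R.
  apply: (le_trans _ Nu); rewrite -[M + 1]invrK; apply: inv_le => //.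
  by rewrite !ge_min lexx !orbT.
pose l i j := `[< ball x r (gp R N (i, j)) >].
pose n1 i j := `[< nearF F1 t N (i, j) >].
(* The edges of the square near [F1] go to the second chain. No edge is near both sets, so these are
   off [F2]. *)
pose h1 i j := bdh l i j && ~~ n1 i j; pose v1 i j := bdv l i j && ~~ n1 i j.
pose h2 i j := bdh l i j && n1 i j; pose v2 i j := bdv l i j && n1 i j.
have bl i j : bdh l i j || bdv l i j ->
    ball x (r + mesh R N) (gp R N (i, j)) /\ ~ ball x (r - mesh R N) (gp R N (i, j)).
  have step i' j' : i = i'.+1 /\ j = j' \/ i = i' /\ j = j'.+1 -> l i j (+) l i' j' ->
      ball x (r + mesh R N) (gp R N (i, j)) /\ ~ ball x (r - mesh R N) (gp R N (i, j)).
    move=> ij; rewrite /l; case: asboolP => [lij|lij]; case: asboolP => // lij' _; split.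
    - by apply: le_ball lij; lra.
    - move=> /plballP[/= a1 a2 a3 a4]; apply: lij'; apply/plballP => /=.
      by case: ij a1 a2 a3 a4 => -[-> ->]; rewrite posS => a1 a2 a3 a4; clear -e0 a1 a2 a3 a4; split; lra.
    - move: lij' => /plballP[/= a1 a2 a3 a4]; apply/plballP => /=.
      by case: ij a1 a2 a3 a4 => -[-> ->]; rewrite posS => a1 a2 a3 a4; clear -e0 a1 a2 a3 a4; split; lra.
    - by move=> b; apply: lij; apply: le_ball b; lra.
  have nl0 i' j' : (i' == 0%N) || (j' == 0%N) -> l i' j' = false.
    move=> ij0; apply/negP => /asboolP/plballP[/= a1 _ a3 _].
    have [hx1 hx2] := HM' _ (or_introl F1x).
    have := ler_norm (- x.1); have := ler_norm (- x.2); rewrite !normrN => g1 g2.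
    have p00 : pos R N 0 = - N.+1%:R by rewrite /pos mul0r sub0r.
    have n1' : N.+1%:R = N%:R + 1 :> R by rewrite natr1.
    move: a1 a3 MN; rewrite /M => a1 a3 MN.
    suff : (0 : R) < 0 by rewrite ltxx.
    by case/orP: ij0 => /eqP E; [move: a1|move: a3]; rewrite E p00 => h; clear -h g1 g2 hx1 hx2 MN r0 M0; lra.
  rewrite /bdh /bdv /prevb => /orP[].
    by case: j step nl0 => [|j] step nl0; [rewrite nl0 ?orbT|apply: step; right].
  by case: i step nl0 => [|i] step nl0; [rewrite nl0|apply: step; left].
have er : mesh R N < r by lra.
have B : chain_bounded (maxn (Num.truncn ((x.1 + r + r + N.+1%:R) * N.+1%:R)).+1
    (Num.truncn ((x.2 + r + r + N.+1%:R) * N.+1%:R)).+1) (bdh l) (bdv l).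
  move=> i j /bl[/plballP[/= _ a2 _ a4] _]; apply/andP; split; rewrite leq_max; apply/orP.
    by left; apply: pos_lt_bound; lra.
  by right; apply: pos_lt_bound; lra.
have B1 : chain_bounded (maxn (Num.truncn ((x.1 + r + r + N.+1%:R) * N.+1%:R)).+1
    (Num.truncn ((x.2 + r + r + N.+1%:R) * N.+1%:R)).+1) h1 v1.
  by move=> i j hv; apply: B; case/orP: hv => /andP[-> _]; rewrite ?orbT.
have B2 : chain_bounded (maxn (Num.truncn ((x.1 + r + r + N.+1%:R) * N.+1%:R)).+1
    (Num.truncn ((x.2 + r + r + N.+1%:R) * N.+1%:R)).+1) h2 v2.
  by move=> i j hv; apply: B; case/orP: hv => /andP[-> _]; rewrite ?orbT.
have O1 : chain_off F1 t N h1 v1.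
  by move=> i j /orP[] /andP[_ /asboolPn].
have far12 i j : bdh l i j || bdv l i j -> nearF F1 t N (i, j) -> nearF F2 t N (i, j) -> False.
  move=> /bl[b1 b2] [d1 Fd1 bd1] [d2 Fd2 bd2].
  have [d [F1d F2d] bd] := Hs0 _ _ _ Fd1 Fd2 (le_ball ts bd1) (le_ball ts bd2).
  have [dx|dy] := F12 _ F1d F2d.
    by apply: b2; rewrite -dx; apply: le_ball bd; lra.
  apply: xyr; rewrite -dy; have -> : r + r = (r + mesh R N) + (r - mesh R N) by lra.
  by apply: ball_triangle b1 _; apply: ball_sym; apply: le_ball bd; lra.
have O2 : chain_off F2 t N h2 v2.
  move=> i j hv near2; apply: (far12 i j) => //.
    by case/orP: hv => /andP[-> _]; rewrite ?orbT.
  by case/orP: hv => /andP[_ /asboolP].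
have h12 i j : h1 i j (+) h2 i j = bdh l i j.
  by rewrite /h1 /h2; case: (bdh l i j); case: (n1 i j).
have v12 i j : v1 i j (+) v2 i j = bdv l i j.
  by rewrite /v1 /v2; case: (bdv l i j); case: (n1 i j).
have D12 : bd h1 v1 =2 bd h2 v2.
  move=> i j; have := bd_add h1 v1 h2 v2 i j.
  rewrite (eq_bd h12 v12) bd_face; by case: (bd h1 v1 i j); case: (bd h2 v2 i j).
have L i j : bd h1 v1 i j -> link (F1 `|` F2) s N (idx N p0) (i, j).
  move=> E; have nF1 := chain_off_end O1 E; have nF2 : ~ nearF F2 (t - mesh R N) N (i, j).
    by apply: (chain_off_end O2); rewrite -D12.
  rewrite -(idx_gp N i j); apply: Hs => //; split.
    have [i' [j' [hv ij]]] := bd_edge E.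
    have [/plballP[/= a1 a2 a3 a4] _] : ball x (r + mesh R N) (gp R N (i', j')) /\
        ~ ball x (r - mesh R N) (gp R N (i', j')).
      by apply: bl; case/orP: hv => /andP[-> _]; rewrite ?orbT.
    by clear -et tr e0 a1 a2 a3 a4 ij; case: ij => -[-> ->] /=; rewrite ?posS; split; lra.
  have half : t / 2 <= t - mesh R N by lra.
  move=> [d Fd /interior_subset bd]; case: Fd => Fd; [apply: nF1|apply: nF2];
    exists d => //; apply: ball_sym; exact: le_ball bd.
have [m [h [v [Bhv Dhv Ohv]]]] := link_boundary B1 L.
pose t' := Num.min t s.
have t'0 : 0 < t' by rewrite lt_min t0.
have t't : t' <= t by rewrite ge_min lexx.
have t's : t' <= s by rewrite ge_min lexx orbT.
have et' : mesh R N < t' / 2.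
  have [ht hs] : mesh R N < t / 4 /\ mesh R N < s / 4 by [].
  rewrite /t'; clear -e0 ht hs; case: (leP t s) => _; lra.
have Os1 : chain_off F1 t' N h v.
  by move=> i j /Ohv nF [d Fd bd]; apply: nF; exists d; [left|exact: le_ball bd].
have Os2 : chain_off F2 t' N h v.
  by move=> i j /Ohv nF [d Fd bd]; apply: nF; exists d; [right|exact: le_ball bd].
have z1 : bd (fun i j => h1 i j (+) h i j) (fun i j => v1 i j (+) v i j) =2 (fun _ _ => false).
  by move=> i j; rewrite bd_add Dhv addbb.
have z2 : bd (fun i j => h2 i j (+) h i j) (fun i j => v2 i j (+) v i j) =2 (fun _ _ => false).
  by move=> i j; rewrite bd_add Dhv D12 addbb.
have f1 := fill_connected_const z1 k1 F1x F1y (fun c Fc => HM c (or_introl Fc)) MN t'0 et'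
  (chain_off_add (chain_off_le t't O1) Os1).
have f2 := fill_connected_const z2 k2 F2x F2y (fun c Fc => HM c (or_intror Fc)) MN t'0 et'
  (chain_off_add (chain_off_le t't O2) Os2).
(* The square is the sum of the two completed cycles, each of which has the same parity at [x] as at
   [y]; but the square contains [x] and not [y]. *)
have lE i j : l i j = fill (fun i j => h1 i j (+) h i j) i j (+) fill (fun i j => h2 i j (+) h i j) i j.
  rewrite -[LHS](fill_bdh l) /fill -big_split /=; apply: eq_bigr => k _.
  by rewrite -h12 addbACA addbb addbF.
have lxy : l (idx N x).1 (idx N x).2 = l (idx N y).1 (idx N y).2 by rewrite !lE f1 f2.
have : l (idx N x).1 (idx N x).2.
  by apply/asboolP; rewrite -surjective_pairing; apply: Hx => //; lra.
rewrite lxy => /asboolP; rewrite -surjective_pairing => bxy; apply: xyr.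
by apply: ball_triangle bxy _; apply: ball_sym; apply: Hy => //; lra.
Unshelve. all: by end_near.
Qed.

End Separation.

(** * Arcs and Jordan curves *)

Section Arc.
Variables (R : realType).

(** The map is continuous on the whole line although only the unit interval matters; compositions
    then need no subspace topology, and clamping the parameter provides such an extension. *)
Definition arc (T : topologicalType) (A : set T) (a b : T) := exists g : R -> T,
  [/\ continuous g, set_inj `[0, 1] g, g 0 = a, g 1 = b & g @` `[0, 1] = A].

Lemma set_injP (T : Type) (g : R -> T) : set_inj `[0, 1] g <->
  (forall s t : R, 0 <= s <= 1 -> 0 <= t <= 1 -> g s = g t -> s = t).
Proof.
split=> H s t; first by move=> hs ht; apply: H; rewrite inE /= in_itv.
by rewrite !inE /= !in_itv /=; exact: H.
Qed.

Section AnyTop.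
Variable T : topologicalType.
Implicit Types (A B K : set T) (a b c x : T).

Lemma arcW A a b : arc A a b -> exists g : R -> T,
  [/\ continuous g, forall s t : R, 0 <= s <= 1 -> 0 <= t <= 1 -> g s = g t -> s = t,
     g 0 = a, g 1 = b & forall x, A x <-> exists2 t : R, 0 <= t <= 1 & g t = x].
Proof.
move=> [g [cg /set_injP ig g0 g1 <-]]; by exists g.
Qed.

Lemma arcI (g : R -> T) A : continuous g ->
  (forall s t : R, 0 <= s <= 1 -> 0 <= t <= 1 -> g s = g t -> s = t) ->
  (forall x, A x <-> exists2 t : R, 0 <= t <= 1 & g t = x) -> arc A (g 0) (g 1).
Proof.
move=> cg ig gA; exists g; split=> //; first exact/set_injP.
apply/seteqP; split=> x.
  by move=> [t]; rewrite /= in_itv /= => ht <-; apply/gA; exists t.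
by move/gA => [t ht <-]; exists t; rewrite //= in_itv.
Qed.

Lemma arcl A a b : arc A a b -> A a.
Proof. by move/arcW => [g [_ _ g0 _ gA]]; apply/gA; exists 0; rewrite ?lexx ?ler01. Qed.

Lemma arcr A a b : arc A a b -> A b.
Proof. by move/arcW => [g [_ _ _ g1 gA]]; apply/gA; exists 1; rewrite ?lexx ?ler01. Qed.

Lemma arc_neq A a b : arc A a b -> a <> b.
Proof.
move/arcW => [g [_ ig <- <- _]] /(ig _ _) E.
have : (0 : R) = 1 by apply: E; rewrite lexx ler01.
by move/eqP; rewrite eq_sym oner_eq0.
Qed.

Lemma arc_compact A a b : arc A a b -> compact A.
Proof.
move=> [g [cg _ _ _ <-]]; apply: continuous_compact; last exact: segment_compact.
exact: continuous_subspaceT.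
Qed.

Lemma arc_connected A a b : arc A a b -> connected A.
Proof. by move=> [g [cg _ _ _ <-]]; exact: connected_image_segment. Qed.

Lemma arc_sym A a b : arc A a b -> arc A b a.
Proof.
move/arcW => [g [cg ig g0 g1 gA]].
have := @arcI (fun t => g (1 + t * -1)) A; rewrite mul0r addr0 mul1r subrr g0 g1; apply.
- move=> t; apply: continuous_comp; [exact: aff_continuous|exact: cg].
- move=> s t hs ht /ig E; have : 1 + s * -1 = 1 + t * -1 by apply: E; lra.
  lra.
- move=> x; rewrite gA; split=> -[t ht <-]; exists (1 + t * -1) ; [lra|congr g; lra|lra|by []].
Qed.

Lemma arc_image_sub (g : R -> T) s t : continuous g ->
  (forall s t : R, 0 <= s <= 1 -> 0 <= t <= 1 -> g s = g t -> s = t) ->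
  0 <= s -> s < t -> t <= 1 -> arc (g @` `[s, t]) (g s) (g t).
Proof.
move=> cg ig s0 st t1.
have ts : 0 < t - s by rewrite subr_gt0.
have := @arcI (fun u => g (s + u * (t - s))) (g @` `[s, t]).
rewrite mul0r addr0 mul1r subrKC; apply.
- move=> u; apply: continuous_comp; [exact: aff_continuous|exact: cg].
- move=> u v hu hv /ig E; have : s + u * (t - s) = s + v * (t - s) by apply: E; nra.
  by move/addrI/mulIf; apply; rewrite gt_eqF.
- move=> x; split=> [[u]|[u hu <-]].
    rewrite /= in_itv /= => hu <-; exists ((u - s) / (t - s)).
      by rewrite divr_ge0 ?ler_pdivrMr ?mul1r //=; lra.
    by rewrite divfK ?gt_eqF // subrKC.
  by exists (s + u * (t - s)) => //; rewrite /= in_itv /=; nra.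
Qed.

Lemma first_hit (g : R -> T) K t0 : continuous g -> closed K -> 0 <= t0 -> K (g t0) ->
  exists t, [/\ 0 <= t <= t0, K (g t) & forall s, 0 <= s -> s < t -> ~ K (g s)].
Proof.
move=> cg cK t00 Kt0.
pose S := [set t | 0 <= t /\ K (g t)].
have S0 : S !=set0 by exists t0.
have lS : has_lbound S by exists 0 => t [].
have cS : closed S.
  apply: closedI; first exact: closed_ge.
  by apply: (closed_comp _ cK) => t _; exact: cg.
have Si : S (inf S).
  apply: contrapT => nS.
  have /nbhs_ballP[e /= e0 He] : nbhs (inf S) (~` S).
    by apply: open_nbhs_nbhs; split => //; exact: closed_openC.
  have [t St ti] := inf_adherent e0 (conj S0 lS).
  apply: (He t) => //; rewrite /ball /= ler0_norm; last by rewrite subr_le0; exact: ge_inf.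
  by rewrite opprB ltrBlDl.
exists (inf S); split; [|by case: Si|].
  by apply/andP; split; [case: Si|apply: ge_inf].
by move=> s s0 si Ks; move: si; rewrite ltNge => /negP; apply; apply: ge_inf.
Qed.

(** The points of [A] in [Y] are ends of [A] different from both [c] and [d], so the subarc between
    [c] and [d] avoids [Y]. *)
Lemma arc_conn Y A a b c d : arc A a b -> A c -> A d ->
  (forall e, A e -> Y e -> (e = a /\ c <> a /\ d <> a) \/ (e = b /\ c <> b /\ d <> b)) ->
  conn Y c d.
Proof.
move/arcW => [g [cg ig <- <- gA]] /gA[s hs <-] /gA[t ht <-].
wlog st : s t hs ht / s <= t.
  move=> W H; have [st|/ltW ts] := leP s t; first exact: W.
  apply: conn_sym; apply: W => // e Ae /(H _ Ae).
  by case=> -[? []]; [left|right].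
move=> H; apply: (@connI _ _ (g @` `[s, t])).
- exact: connected_image_segment.
- by exists s; rewrite //= in_itv /= lexx.
- by exists t; rewrite //= in_itv /= lexx andbT.
- move=> _ [u + <-]; rewrite /= in_itv /= => su Yu.
  have hu : 0 <= u <= 1 by lra.
  have [] := H (g u) _ Yu; first by apply/gA; exists u.
    move=> [/ig E [gs gt]]; apply: gs; congr g.
    have : u = 0 by apply: E => //; rewrite lexx ler01.
    lra.
  move=> [/ig E [gs gt]]; apply: gt; congr g.
  have : u = 1 by apply: E => //; rewrite lexx ler01.
  lra.
Qed.

Lemma arc_first_hit A a b K c : arc A a b -> closed K -> A c -> K c -> ~ K a ->
  exists A' x, [/\ arc A' a x, A' `<=` A, K x & forall y, A' y -> K y -> y = x].
Proof.
move/arcW => [g [cg ig g0 g1 gA]] cK /gA[t0 ht0 <-] Kt0 Ka.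
have [|t [ht Kt nK]] := first_hit cg cK _ Kt0; first by case/andP: ht0.
have t0' : 0 < t.
  rewrite lt_neqAle; case/andP: ht => -> _; rewrite andbT; apply/eqP => t00.
  by apply: Ka; rewrite -g0 t00.
exists (g @` `[0, t]), (g t); split=> //.
- by rewrite -g0; apply: arc_image_sub => //; lra.
- by move=> _ [u + <-]; rewrite /= in_itv /= => hu; apply/gA; exists u => //; lra.
- move=> _ [u + <-]; rewrite /= in_itv /= => /andP[u0]; rewrite le_eqVlt => /orP[/eqP-> //|ut] Ku.
  by case: (nK u).
Qed.

End AnyTop.

Notation pl := (plane R).
Implicit Types (A B K Y : set pl) (a b c x y p q : pl).

Definition clamp (t : R) := Num.min 1 (Num.max 0 t).

Lemma clamp_continuous : continuous clamp.
Proof.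
move=> t; apply: continuous_min; first exact: cvg_cst.
by apply: continuous_max; [exact: cvg_cst|exact: cvg_id].
Qed.

Lemma clamp_id t : 0 <= t <= 1 -> clamp t = t.
Proof.
by move=> /andP[t0 t1]; rewrite /clamp (max_idPr t0) (min_idPr t1).
Qed.

Lemma clamp0 t : t <= 0 -> clamp t = 0.
Proof. by move=> t0; rewrite /clamp (max_idPl t0) (min_idPr ler01). Qed.

Lemma clamp1 t : 1 <= t -> clamp t = 1.
Proof.
move=> t1; rewrite /clamp; have t0 : 0 <= t by apply: le_trans t1.
by rewrite (max_idPr t0) (min_idPl t1).
Qed.

Lemma coord_continuous (T : topologicalType) (g : T -> pl) : continuous g ->
  continuous (fun t => (g t).1) /\ continuous (fun t => (g t).2).
Proof.
move=> cg; split=> t; apply: (cvg_comp _ _ (cg t)).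
  exact: cvg_fst.
exact: cvg_snd.
Qed.

Lemma plane_eq p q : p.1 = q.1 -> p.2 = q.2 -> p = q.
Proof. by case: p q => [? ?] [? ?] /= -> ->. Qed.

(* Clamping the parameters turns concatenation into a sum of continuous maps. *)
Lemma arc_glue A B a b c : arc A a b -> arc B b c -> (forall x, A x -> B x -> x = b) ->
  arc (A `|` B) a c.
Proof.
move=> /arcW[g [cg ig g0 g1 gA]] /arcW[h [ch ih h0 h1 hB]] AB.
pose k t : pl := ((g (clamp (t * 2))).1 + (h (clamp (-1 + t * 2))).1 - b.1,
              (g (clamp (t * 2))).2 + (h (clamp (-1 + t * 2))).2 - b.2).
have kl t : t <= 2^-1 -> k t = g (clamp (t * 2)).
  move=> t2; rewrite /k (@clamp0 (-1 + t * 2)) ?h0; last by lra.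
  by rewrite !addrK; case: (g _).
have kr t : 2^-1 <= t -> k t = h (clamp (-1 + t * 2)).
  move=> t2; rewrite /k (@clamp1 (t * 2)) ?g1; last by lra.
  by rewrite ![_ + (h _).1]addrC ![_ + (h _).2]addrC !addrK; case: (h _).
have cc (f : R -> R) : continuous f -> continuous (clamp \o f).
  by move=> cf t; apply: continuous_comp; [exact: cf|exact: clamp_continuous].
have ck : continuous k.
  have [g1c g2c] := coord_continuous cg; have [h1c h2c] := coord_continuous ch.
  have a1 : continuous (fun t : R => t * 2) by move=> t; apply: cvgM; [exact: cvg_id|exact: cvg_cst].
  have a2 := @aff_continuous R (-1) 2.
  apply: pair_continuous => t; apply: cvgB; try exact: cvg_cst; apply: cvgD.
  - by apply: (continuous_comp (f := clamp \o (fun t => t * 2)) (g := fun t => (g t).1)); [exact: (cc _ a1)|exact: g1c].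
  - by apply: (continuous_comp (f := clamp \o (fun t => -1 + t * 2)) (g := fun t => (h t).1)); [exact: (cc _ a2)|exact: h1c].
  - by apply: (continuous_comp (f := clamp \o (fun t => t * 2)) (g := fun t => (g t).2)); [exact: (cc _ a1)|exact: g2c].
  - by apply: (continuous_comp (f := clamp \o (fun t => -1 + t * 2)) (g := fun t => (h t).2)); [exact: (cc _ a2)|exact: h2c].
have := @arcI _ k (A `|` B) ck.
have -> : k 0 = a by rewrite kl ?invr_ge0 // mul0r clamp_id ?lexx ?ler01.
have -> : k 1 = c.
  have e : (-1 : R) + 1 * 2 = 1 by lra.
  rewrite kr; last by lra.
  by rewrite e clamp_id ?lexx ?ler01.
apply.
- move=> s t; wlog st : s t / s <= t.
    by move=> W hs ht E; have [st|/ltW ts] := leP s t; [exact: W|exact/esym/W].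
  move=> hs ht; have [s2|s2] := leP s 2^-1; have [t2|t2] := leP t 2^-1.
  + rewrite !kl // !clamp_id; [|lra|lra] => /ig E.
    have : s * 2 = t * 2 by apply: E; lra.
    lra.
  + rewrite kl // kr ?(ltW t2) // !clamp_id; [|lra|lra] => E.
    have Ab : g (s * 2) = b.
      apply: AB; first by apply/gA; exists (s * 2) => //; lra.
      by rewrite E; apply/hB; exists (-1 + t * 2) => //; lra.
    have : -1 + t * 2 = 0 by apply: ih; [lra|rewrite lexx ler01|rewrite -E Ab h0].
    lra.
  + lra.
  + rewrite !kr ?ltW // !clamp_id; [|lra|lra] => /ih E.
    have : -1 + s * 2 = -1 + t * 2 by apply: E; lra.
    lra.
- move=> x; split.
    move=> [/gA[t ht <-]|/hB[t ht <-]].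
      exists (t / 2); first lra.
      rewrite kl; last by lra.
      by rewrite divfK // clamp_id.
    exists ((t + 1) / 2); first lra.
    rewrite kr; last by lra.
    by rewrite divfK // addrC addrK clamp_id.
  move=> [t ht <-]; have [t2|/ltW t2] := leP t 2^-1.
    by left; rewrite kl // clamp_id; [apply/gA; exists (t * 2) => //; lra|lra].
  by right; rewrite kr // clamp_id; [apply/hB; exists (-1 + t * 2) => //; lra|lra].
Qed.

Lemma arc_closed A a b : arc A a b -> closed A.
Proof. by move/arc_compact/pl_compact_closed. Qed.

Lemma pl_closed1 a : closed [set a].
Proof. by apply: pl_compact_closed; exact: compact_set1. Qed.

Lemma arc_upto A a b c : arc A a b -> A c -> c <> a -> exists2 A', arc A' a c & A' `<=` A.
Proof.
move=> aA Ac ca; have nca : ~ [set c] a by move=> /= ac; apply: ca.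
have [A' [x [aA' sub xc _]]] := arc_first_hit aA (@pl_closed1 c) Ac (erefl c) nca.
by exists A'; rewrite -?xc.
Qed.

(** Gluing requires arcs that meet only at the common end. So [A] is cut at its first point on [B],
    and [B] is followed from there. *)
Lemma arc_join A B a b c : arc A a b -> arc B b c -> a <> c ->
  exists2 C, arc C a c & C `<=` A `|` B.
Proof.
move=> aA aB ac; have [Ba|Ba] := pselect (B a).
  have [C aC CB] := arc_upto (arc_sym aB) Ba ac.
  by exists C; [exact: arc_sym|move=> x /CB; right].
have [A' [x [aA' A'A Bx A'x]]] := arc_first_hit aA (arc_closed aB) (arcr aA) (arcl aB) Ba.
have [xc|xc] := pselect (x = c).
  by exists A'; [rewrite -xc|move=> y /A'A; left].
have [B' aB' B'B] := arc_upto (arc_sym aB) Bx xc.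
exists (A' `|` B').
  by apply: (arc_glue aA' (arc_sym aB')) => y A'y /B'B; exact: A'x.
by move=> y [/A'A|/B'B]; [left|right].
Qed.

Lemma seg_arc p q : p <> q ->
  arc [set x : pl | exists2 t : R, 0 <= t <= 1 & (p.1 + t * (q.1 - p.1), p.2 + t * (q.2 - p.2)) = x] p q.
Proof.
move=> pq; have := @arcI _ _ [set x : pl | exists2 t : R, 0 <= t <= 1 & (p.1 + t * (q.1 - p.1), p.2 + t * (q.2 - p.2)) = x] (@seg_continuous R p q).
rewrite !mul0r !mul1r !addr0 !subrKC -!surjective_pairing; apply=> // s t _ _ [e1 e2].
have : s = t \/ q.1 - p.1 = 0 /\ q.2 - p.2 = 0.
  have [n1|n1] := eqVneq (q.1 - p.1) 0; last by left; move/addrI/mulIf: e1; apply.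
  have [n2|n2] := eqVneq (q.2 - p.2) 0; last by left; move/addrI/mulIf: e2; apply.
  by right.
case=> // -[/eqP + /eqP]; rewrite !subr_eq0 => /eqP z1 /eqP z2; case: pq; exact: plane_eq.
Qed.

Lemma ball_convex c (r : R) p q t : ball c r p -> ball c r q -> 0 <= t <= 1 ->
  ball c r ((p.1 + t * (q.1 - p.1), p.2 + t * (q.2 - p.2)) : pl).
Proof.
move=> /plballP[p1 p2 p3 p4] /plballP[q1 q2 q3 q4] t01.
have lt_convex' (l u w : R) : l < u -> l < w -> l < u + t * (w - u).
  move=> lu lw; have := @lt_convex _ (- u) (- w) (- l) t; rewrite !ltrN2 => /(_ lu lw t01).
  by rewrite -ltrN2 opprK; lra.
by apply/plballP; split; rewrite /=; (apply: lt_convex' || apply: lt_convex).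
Qed.

(** Being joined to [p] by an arc off [K] is a locally constant property, since balls are convex and
    a segment can be appended. The alternative [p = q] is carried along because the ends of an arc
    are distinct. *)
Lemma conn_arc K p q : closed K -> conn K p q -> p <> q ->
  exists2 A, arc A p q & forall x, A x -> ~ K x.
Proof.
move=> cK [C [Cp CK cC] Cq].
suff : p = q \/ exists2 A, arc A p q & forall x, A x -> ~ K x by case.
apply: (connected_ind (P := fun q => p = q \/ exists2 A, arc A p q & forall x, A x -> ~ K x)
  cC Cp Cq); first by left.
move=> x Cx; have [r r0 H] := closed_ball_miss cK (CK _ Cx).
have step y z : ball x r y -> ball x r z ->
    (p = y \/ exists2 A, arc A p y & forall x, A x -> ~ K x) ->
    (p = z \/ exists2 A, arc A p z & forall x, A x -> ~ K x).
  move=> xy xz Hy; have [->|yz] := pselect (z = y); first by [].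
  have [pz|pz] := pselect (p = z); [by left|right].
  have := @seg_arc y z; set S := (X in arc X _ _); move=> aS.
  have SK w : S w -> ~ K w by move=> [t ht <-]; apply: H; exact: ball_convex.
  have {}aS : arc S y z by apply: aS => yz'; apply: yz.
  case: Hy => [py|[A aA AK]]; first by exists S => //; rewrite py.
  have [D aD DAS] := arc_join aA aS pz.
  by exists D => // w /DAS[/AK|/SK].
apply/nbhs_ballP; exists r => //= y xy _.
by split; apply: step => //; exact: ballxx.
Qed.

End Arc.

Ltac lraF := intros; exfalso; match goal with R0 : realType |- _ =>
  have : (0 : R0) < 0; [lra | by rewrite ltxx] end.

(** * Sides of closed curves and their frontiers *)

Section Jordan.
Variable R : realType.
Notation pl := (plane R).
Local Notation arc := (arc R).
Implicit Types (A B C K Y : set pl) (a b c x y p q : pl).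

(** The outside of a square is the union of four half-planes, consecutive ones of which overlap;
    every point is led to one corner. *)
Lemma conn_outside_ball K c (r : R) p q : (forall x, K x -> ball c r x) ->
  ~ ball c r p -> ~ ball c r q -> conn K p q.
Proof.
move=> Kb np nq.
have seg (u v : pl) : (forall t : R, 0 <= t <= 1 ->
    ~ ball c r ((u.1 + t * (v.1 - u.1), u.2 + t * (v.2 - u.2)) : pl)) -> conn K u v.
  by move=> H; apply: conn_seg => t /H nb /Kb.
have left u v : u.1 <= c.1 - r -> v.1 <= c.1 - r -> conn K u v.
  by move=> u1 v1; apply: seg => t t01 /plballP[/= h _ _ _]; nra.
have right u v : c.1 + r <= u.1 -> c.1 + r <= v.1 -> conn K u v.
  by move=> u1 v1; apply: seg => t t01 /plballP[/= _ h _ _]; nra.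
have bot u v : u.2 <= c.2 - r -> v.2 <= c.2 - r -> conn K u v.
  by move=> u1 v1; apply: seg => t t01 /plballP[/= _ _ h _]; nra.
have top u v : c.2 + r <= u.2 -> c.2 + r <= v.2 -> conn K u v.
  by move=> u1 v1; apply: seg => t t01 /plballP[/= _ _ _ h]; nra.
suff corner u : ~ ball c r u -> conn K u (c.1 - r, c.2 - r).
  by apply: conn_trans (corner p np) (conn_sym (corner q nq)).
move=> nu; have [h1|h1] := leP u.1 (c.1 - r); first by apply: left => /=.
have [h2|h2] := leP (c.1 + r) u.1.
  by apply: (@conn_trans _ _ (c.1 + r, c.2 - r)); [exact: right|exact: bot].
have [h3|h3] := leP u.2 (c.2 - r); first by apply: bot.
have [h4|h4] := leP (c.2 + r) u.2.
  by apply: (@conn_trans _ _ (c.1 - r, c.2 + r)); [exact: top|exact: left].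
by case: nu; apply/plballP.
Qed.

Lemma ball_inner c (r : R) p : ball c r p -> exists2 e : R, 0 < e & forall z, ball p e z -> ball c r z.
Proof.
move=> /plballP[h1 h2 h3 h4].
pose e := Num.min (Num.min (p.1 - (c.1 - r)) (c.1 + r - p.1)) (Num.min (p.2 - (c.2 - r)) (c.2 + r - p.2)).
have e0 : 0 < e by rewrite !lt_min; apply/andP; split; apply/andP; split; lra.
have i1 : e <= p.1 - (c.1 - r) by rewrite /e !ge_min lexx.
have i2 : e <= c.1 + r - p.1 by rewrite /e !ge_min lexx !orbT.
have i3 : e <= p.2 - (c.2 - r) by rewrite /e !ge_min lexx !orbT.
have i4 : e <= c.2 + r - p.2 by rewrite /e !ge_min lexx !orbT.
exists e => // z /plballP[] j1 j2 j3 j4; apply/plballP; split; lra.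
Qed.

Lemma pl_ball_open c (r : R) : open (ball c r : set pl).
Proof.
rewrite openE => p /ball_inner[e e0 H]; apply/nbhs_ballP; exists e => //=.
Qed.

Lemma subarc_compact (g : R -> pl) s t : continuous g -> compact (g @` `[s, t]).
Proof.
move=> cg; apply: continuous_compact; last exact: segment_compact.
exact: continuous_subspaceT.
Qed.

(** By induction along the parameter: a short piece lies in a ball missing [p] and [q], hence does
    not separate them, and it meets the initial piece in a single point. *)
Lemma arc_nonsep A a b p q : arc A a b -> ~ A p -> ~ A q -> conn A p q.
Proof.
move/arcW => [g [cg ig g0 g1 gA]] Ap Aq.
have Eg : A = g @` `[0, 1].
  apply/seteqP; split=> x; first by move/gA => [t ht <-]; exists t.
  by move=> [t ht <-]; apply/gA; exists t.
have loc (t0 : R) : 0 <= t0 <= 1 -> \forall t \near t0, forall s s', Num.min t0 t <= s -> s' <= Num.max t0 t ->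
    conn (g @` `[s, s']) p q.
  move=> ht0; have cA : closed A by rewrite Eg; apply: pl_compact_closed; exact: subarc_compact.
  have gt0 : A (g t0) by apply/gA; exists t0.
  have [r r0 pqr] : exists2 r : R, 0 < r & ~ ball (g t0) r p /\ ~ ball (g t0) r q.
    have [r1 r10 H1] := closed_ball_miss (@pl_closed1 _ p) (fun e : g t0 = p => Ap (eq_ind _ A gt0 _ e)).
    have [r2 r20 H2] := closed_ball_miss (@pl_closed1 _ q) (fun e : g t0 = q => Aq (eq_ind _ A gt0 _ e)).
    exists (Num.min r1 r2); first by rewrite lt_min r10.
    split=> h; [apply: (H1 p) => //|apply: (H2 q) => //]; apply: le_ball h;
      by rewrite ge_min lexx ?orbT.
  have /nbhs_ballP[d /= d0 Hd] : nbhs t0 (g @^-1` (ball (g t0) r)) by apply: cg; exact: nbhsx_ballx.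
  apply/nbhs_ballP; exists d => //= t td s s' s1 s2; case: pqr; apply: conn_outside_ball.
  move=> _ [u + <-]; rewrite /= in_itv /= => /andP[su us']; apply: Hd.
  move: td; rewrite /ball /= => /ltr_normlP[h1 h2]; apply/ltr_normlP.
  by move: s1 s2; case: (leP t0 t) => ? ? ?; split; lra.
have h01 : (0 : R) <= 1 by exact: ler01.
suff : conn (g @` `[0, 1]) p q by rewrite Eg.
pose P (t : R) := conn (g @` `[0, t]) p q.
have C0 : [set` `[(0 : R), 1]] (0 : R) by rewrite /= in_itv /= lexx.
have C1 : [set` `[(0 : R), 1]] (1 : R) by rewrite /= in_itv /= lexx andbT.
apply: (connected_ind (P := P) (@segment_connected R 0 1) C0 C1).
  have /loc/nbhs_singleton H : 0 <= (0 : R) <= 1 by rewrite lexx.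
  by apply: H; rewrite ?minxx ?maxxx.
move=> t0; rewrite /= in_itv /= => ht0; apply: filterS (loc t0 ht0) => t H; rewrite in_itv /= => ht.
have sub (u v : R) : u <= v -> P v -> P u.
  move=> uv; apply: conn_sub => _ [z + <-]; rewrite /= !in_itv /= => /andP[z0 zu].
  by exists z => //; rewrite /= in_itv /= z0 (le_trans zu).
have ext (u v : R) : 0 <= u <= 1 -> 0 <= v <= 1 -> u <= v -> conn (g @` `[u, v]) p q -> P u -> P v.
  move=> hu hv uv c2 c1; have := @conn_add1 _ (g @` `[0, u]) (g @` `[u, v]) (g u) p q
    (@subarc_compact g 0 u cg) (@subarc_compact g u v cg) _ c1 c2.
  have E : g @` `[0, v] `<=` g @` `[0, u] `|` g @` `[u, v].
    move=> _ [z + <-]; rewrite /= in_itv /= => /andP[z0 zv]; have [zu|/ltW uz] := leP z u.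
      by left; exists z => //; rewrite /= in_itv /= z0.
    by right; exists z => //; rewrite /= in_itv /= uz.
  move=> h; apply: (conn_sub E); apply: h => _ [s + <-] [z + E']; rewrite /= !in_itv /= => hs hz.
  have zs : z = s by apply: ig E'; lra.
  by congr g; lra.
have [tt|/ltW tt] := leP t0 t.
  split; [apply: ext => //|exact: sub].
  by apply: H; rewrite ?(min_idPl tt) ?(max_idPr tt).
split; [exact: sub|apply: ext => //].
by apply: H; rewrite ?(min_idPr tt) ?(max_idPl tt).
Qed.

(** The closure of the component of [p] off [K]; for [c] in [K] this means that [c] is on the
    frontier of that component. *)
Definition touches K p c := forall r : R, 0 < r -> exists2 q, ball c r q & conn K p q.

Lemma touch_exists K C p q : closed K -> connected C -> C p -> C q -> ~ K p -> ~ conn K p q ->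
  exists c, [/\ C c, K c & touches K p c].
Proof.
move=> cK cC Cp Cq Kp npq; apply: contrapT => none; apply: npq.
apply: (connected_ind (P := conn K p) cC Cp Cq); first exact: conn_refl.
move=> x Cx; have [px|px] := pselect (conn K p x).
  have [r r0 H] := conn_open cK px; apply/nbhs_ballP; exists r => //= y xy _.
  by split=> // _; exact: H.
have [[r r0 H]|nt] := pselect (exists2 r : R, 0 < r & forall q, ball x r q -> ~ conn K p q).
  by apply/nbhs_ballP; exists r => //= y xy _; split=> // /(H _ xy).
have tx : touches K p x.
  move=> r r0; apply: contrapT => nq; apply: nt; exists r => // z xz pz.
  by apply: nq; exists z.
have Kx : ~ K x by move=> Kx; apply: none; exists x.
have [r r0 H] := closed_ball_miss cK Kx; have [z xz pz] := tx r r0.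
by case: px; apply: conn_trans pz _; apply: conn_ball xz (ballxx _ r0) H.
Qed.

Lemma touches_sub K K' p q c : (forall z, conn K p z -> conn K' q z) -> touches K p c -> touches K' q c.
Proof. by move=> H t r r0; have [z cz /H pz] := t r r0; exists z. Qed.

Lemma touches_half K p c : (forall r : R, 0 < r -> exists2 d, ball c r d & touches K p d) -> touches K p c.
Proof.
move=> H r r0; have r2 : 0 < r / 2 by rewrite divr_gt0.
have [d cd /(_ _ r2)[q dq pq]] := H _ r2; exists q => //.
by rewrite [r]splitr; exact: ball_triangle cd dq.
Qed.

(** Without a short piece about an inner point of [A], the curve consists of [B] and two subarcs.
    These are added one by one, each with at most one common point, and so do not separate [p] from
    the chosen point. A connected set joining the two meets the curve only in the short piece, and
    does so at a frontier point. The ends of [A] follow by approximation. *)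
Lemma jordan_frontier_half A B x y p c : arc A x y -> arc B x y ->
  (forall z, A z -> B z -> z = x \/ z = y) -> ~ (A `|` B) p -> A c -> touches (A `|` B) p c.
Proof.
move=> aA aB AB np Ac; have := aA => /arcW[g [cg ig g0 g1 gA]].
have inner (t : R) : 0 < t -> t < 1 -> touches (A `|` B) p (g t).
  move=> t0 t1 r r0.
  have /nbhs_ballP[d /= d0 Hd] : nbhs t (g @^-1` (ball (g t) r)) by apply: cg; exact: nbhsx_ballx.
  pose s := Num.max (t / 2) (t - d / 2); pose s' := Num.min ((t + 1) / 2) (t + d / 2).
  have hs : [/\ 0 < s, s < t & t - d < s].
    by rewrite /s; case: (leP (t / 2) (t - d / 2)) => *; split; lra.
  have hs' : [/\ t < s', s' < 1 & s' < t + d].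
    by rewrite /s'; case: (leP ((t + 1) / 2) (t + d / 2)) => *; split; lra.
  case: hs hs' => s0 st ds [ts' s1 ds'].
  have a1 : arc (g @` `[0, s]) (g 0) (g s) by apply: arc_image_sub => //; lra.
  have a2 : arc (g @` `[s', 1]) (g s') (g 1) by apply: arc_image_sub => //; lra.
  have sub1 z : (g @` `[0, s]) z -> A z.
    by move=> [u + <-]; rewrite /= in_itv /= => hu; apply/gA; exists u => //; lra.
  have sub2 z : (g @` `[s', 1]) z -> A z.
    by move=> [u + <-]; rewrite /= in_itv /= => hu; apply/gA; exists u => //; lra.
  have n1 : ~ (g @` `[0, s]) (g t).
    move=> [u + ]; rewrite /= in_itv /= => hu /ig E.
    have : u = t by apply: E; lra.
    lraF.
  have n2 : ~ (g @` `[s', 1]) (g t).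
    move=> [u + ]; rewrite /= in_itv /= => hu /ig E.
    have : u = t by apply: E; lra.
    lraF.
  have Agt : A (g t) by apply/gA; exists t => //; lra.
  have nB : ~ B (g t).
    move=> /(AB _ Agt); rewrite -g0 -g1 => -[] /ig E.
      have : t = 0 by apply: E; lra.
      lraF.
    have : t = 1 by apply: E; lra.
    lraF.
  have nAp : ~ A p by move=> Ap; apply: np; left.
  have nBp : ~ B p by move=> Bp; apply: np; right.
  have c1 : conn (g @` `[0, s]) p (g t) by apply: (arc_nonsep a1) => // /sub1.
  have c2 : conn (g @` `[s', 1]) p (g t) by apply: (arc_nonsep a2) => // /sub2.
  have c3 : conn B p (g t) by apply: (arc_nonsep aB).
  have c4 : conn (g @` `[0, s] `|` B) p (g t).
    apply: (@conn_add1 _ _ _ x) => //; [exact: arc_compact a1|exact: arc_compact aB|].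
    move=> z A1z Bz; case: (AB z (sub1 _ A1z) Bz) => // zy.
    move: A1z => [u + ]; rewrite zy -g1 /= in_itv /= => hu /ig E.
    have : u = 1 by apply: E; lra.
    lraF.
  have c5 : conn (g @` `[0, s] `|` B `|` g @` `[s', 1]) p (g t).
    apply: (@conn_add1 _ _ _ y) => //; last first.
    - move=> z [[u + <-]|Bz] A2z.
        move: A2z => [v + ]; rewrite /= !in_itv /= => hv E hu.
        have : v = u by apply: ig => //; lra.
        lraF.
      case: (AB z (sub2 _ A2z) Bz) => // zx.
      move: A2z => [u + ]; rewrite zx -g0 /= in_itv /= => hu /ig E.
      have : u = 0 by apply: E; lra.
      lraF.
    - exact: arc_compact a2.
    - by apply: compactU; [exact: arc_compact a1|exact: arc_compact aB].
  case: c5 => C [Cp CK cC] Cgt.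
  have [|c' [Cc' Kc' tc']] := touch_exists (closedU (arc_closed aA) (arc_closed aB)) cC Cp Cgt np.
    by move/conn_outr; apply; left.
  suff [u hu uc'] : exists2 u, s < u < s' & g u = c'.
    have ct : ball (g t) r c'.
      by rewrite -uc'; apply: Hd; rewrite /ball /=; apply/ltr_normlP; split; lra.
    have [e e0 He] := ball_inner ct.
    by have [q c'q pq] := tc' e e0; exists q => //; exact: He.
  case: Kc' => [/gA[u hu uc']|Bc']; last by case: (CK _ Cc'); left; right.
  exists u => //; apply/andP; split; rewrite ltNge; apply/negP => hus; apply: (CK _ Cc').
    by left; left; exists u => //; rewrite /= in_itv /=; lra.
  by right; exists u => //; rewrite /= in_itv /=; lra.
move/gA: Ac => [t ht <-]; apply: touches_half => r r0.
have /nbhs_ballP[d /= d0 Hd] : nbhs t (g @^-1` (ball (g t) r)) by apply: cg; exact: nbhsx_ballx.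
pose u := Num.min (d / 2) (1 / 4).
have hu : [/\ 0 < u, u < d & u <= 1 / 4] by rewrite /u; case: (leP (d / 2) (1 / 4)) => *; split; lra.
case: hu => u0 ud u4; have [t2|t2] := leP t (1 / 2).
  exists (g (t + u)); last by apply: inner; lra.
  by apply: Hd; rewrite /ball /=; apply/ltr_normlP; split; lra.
exists (g (t - u)); last by apply: inner; lra.
by apply: Hd; rewrite /ball /=; apply/ltr_normlP; split; lra.
Qed.

Lemma jordan_frontier A B x y p c : arc A x y -> arc B x y ->
  (forall z, A z -> B z -> z = x \/ z = y) -> ~ (A `|` B) p -> (A `|` B) c ->
  touches (A `|` B) p c.
Proof.
move=> aA aB AB np [Ac|Bc]; first exact: (jordan_frontier_half aA aB).
rewrite setUC in np *; apply: (jordan_frontier_half aB aA) => // z Bz Az.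
exact: AB.
Qed.

Lemma jordan_separation A B x y c : arc A x y -> arc B x y ->
  (forall z, A z -> B z -> z = x \/ z = y) -> ~ (A `|` B) c ->
  exists2 p, ~ (A `|` B) p & ~ conn (A `|` B) c p.
Proof.
move=> aA aB AB nc; have [p [q [np nq npq]]] := two_arc_separation (arc_compact aA) (arc_compact aB)
  (arc_connected aA) (arc_connected aB) (arcl aA) (arcl aB) (arcr aA) (arcr aB) (arc_neq aA) AB.
have [cp|ncp] := pselect (conn (A `|` B) c p); last by exists p.
exists q => // cq; apply: npq; apply: conn_trans (conn_sym cp) cq.
Qed.

(** At most two components touch an inner point [c] of [A]: off [Y] the three points are joined near
    [c], off [A] they are joined anyway, and [A] meets [Y] only in two points. *)
Lemma two_sides Y A a b c p q r : compact Y -> arc A a b ->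
  (forall z, A z -> Y z -> z = a \/ z = b) -> A c -> c <> a -> c <> b ->
  ~ (Y `|` A) p -> ~ (Y `|` A) q -> ~ (Y `|` A) r ->
  touches (Y `|` A) p c -> touches (Y `|` A) q c -> touches (Y `|` A) r c ->
  [\/ conn (Y `|` A) p q, conn (Y `|` A) q r | conn (Y `|` A) p r].
Proof.
move=> cY aA AY Ac ca cb np nq nr tp tq tr.
have cYc := pl_compact_closed cY.
have nYc : ~ Y c by move/(AY _ Ac) => [].
have toc s : touches (Y `|` A) s c -> conn Y s c.
  have [e e0 H] := closed_ball_miss cYc nYc => ts; have [z cz sz] := ts _ e0.
  apply: (@conn_trans _ _ z); first by apply: conn_sub sz => w; left.
  by apply: conn_ball cz (ballxx _ e0) H.
have cYY s s' : touches (Y `|` A) s c -> touches (Y `|` A) s' c -> conn Y s s'.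
  by move=> ts ts'; apply: conn_trans (toc s ts) (conn_sym (toc s' ts')).
have cAA s s' : ~ (Y `|` A) s -> ~ (Y `|` A) s' -> conn A s s'.
  by move=> ns ns'; apply: (arc_nonsep aA) => h; [apply: ns|apply: ns']; right.
apply: (conn_add2 cY (arc_compact aA) (x := a) (y := b)) => //.
- by move=> d Yd Ad; exact: AY.
- exact: cYY.
- exact: cAA.
- exact: cYY.
- exact: cAA.
Qed.

(** A short piece about [g t2] is deleted, and the part of the arc after it is counted with [Y]. Off
    this set [p] reaches [g t1] and then, along the arc, [g t2]. The part before the short piece
    does not separate them and has at most [g 0] in common with the set, so it can be added; the
    connected set obtained hits the drawing only in the short piece. *)
Lemma touches_along_lt Y (g : R -> pl) p t1 t2 : compact Y -> continuous g ->
  (forall s t : R, 0 <= s <= 1 -> 0 <= t <= 1 -> g s = g t -> s = t) ->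
  (forall t, 0 < t < 1 -> ~ Y (g t)) -> ~ (Y `|` g @` `[0, 1]) p ->
  0 < t1 -> t1 < t2 -> t2 < 1 ->
  touches (Y `|` g @` `[0, 1]) p (g t1) -> touches (Y `|` g @` `[0, 1]) p (g t2).
Proof.
move=> cY cg ig nY np t10 t12 t21 tt1 r r0; apply: contrapT => none.
have /nbhs_ballP[d /= d0 Hd] : nbhs t2 (g @^-1` (ball (g t2) r)) by apply: cg; exact: nbhsx_ballx.
pose t3 := Num.max ((t1 + t2) / 2) (t2 - d / 2); pose t4 := Num.min ((t2 + 1) / 2) (t2 + d / 2).
have [h1 h2 h3] : [/\ t1 < t3, t3 < t2 & t2 - d < t3].
  by rewrite /t3; case: (leP ((t1 + t2) / 2) (t2 - d / 2)) => *; split; lra.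
have [k1 k2 k3] : [/\ t2 < t4, t4 < 1 & t4 < t2 + d].
  by rewrite /t4; case: (leP ((t2 + 1) / 2) (t2 + d / 2)) => *; split; lra.
pose Y' := Y `|` g @` `[t4, 1].
have cY' : compact Y' by apply: compactU => //; exact: subarc_compact.
have img u v w : u <= v -> v <= w -> (g @` `[u, w]) (g v).
  by move=> uv vw; exists v; rewrite //= in_itv /= uv.
have noimg u v w : 0 <= u -> w <= 1 -> 0 <= v <= 1 -> (g @` `[u, w]) (g v) -> u <= v <= w.
  move=> u0 w1 hv [z + ]; rewrite /= in_itv /= => hz /ig E.
  have <- : z = v by apply: E => //; lra.
  by [].
have Y'sub : Y' `<=` Y `|` g @` `[0, 1].
  move=> z [|[u + <-]]; first by left.
  by rewrite /= in_itv /= => hu; right; apply: img; lra.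
have nY' t : t1 <= t <= t2 -> ~ Y' (g t).
  by move=> ht [|/noimg h]; [apply: nY; lra|have : t4 <= t <= 1 by [apply: h; lra]; lraF].
have c1 : conn Y' p (g t1).
  have [|e e0 He] := closed_ball_miss (pl_compact_closed cY') (nY' t1 _); first by lra.
  have [q bq pq] := tt1 e e0; apply: (@conn_trans _ _ q); first exact: conn_sub pq.
  exact: conn_ball bq (ballxx _ e0) He.
have c2 : conn Y' (g t1) (g t2).
  apply: (@connI _ _ (g @` `[t1, t2])).
  - exact: connected_image_segment.
  - by apply: img; lra.
  - by apply: img; lra.
  - by move=> _ [u + <-]; rewrite /= in_itv /=; exact: nY'.
have a3 : arc (g @` `[0, t3]) (g 0) (g t3) by apply: arc_image_sub => //; lra.
have c3 : conn (g @` `[0, t3]) p (g t2).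
  apply: (arc_nonsep a3) => h; last by have := noimg 0 t2 t3; move=> /(_ _ _ _ h); lraF.
  apply: np; right; case: h => u + <-; rewrite /= in_itv /= => hu; apply: img; lra.
have c4 : conn (Y' `|` g @` `[0, t3]) p (g t2).
  apply: (@conn_add1 _ _ _ (g 0) _ _ cY' (@subarc_compact g 0 t3 cg) _ (conn_trans c1 c2) c3) => z.
  move=> Y'z [u + uz]; rewrite /= in_itv /= => hu; rewrite -uz in Y'z *.
  have [->//|u0] := eqVneq u 0; case: Y'z => [Yu|h].
    have u0' : 0 < u by rewrite lt_neqAle eq_sym u0; case/andP: hu.
    by case: (nY u) => //; lra.
  by have := noimg t4 u 1; move=> /(_ _ _ _ h); lraF.
case: c4 => C [Cp CK cC] Cgt.
have cK : closed (Y `|` g @` `[0, 1]).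
  by apply: closedU2 => //; exact: subarc_compact.
have [|c' [Cc' Kc' tc']] := touch_exists cK cC Cp Cgt np.
  by move/conn_outr; apply; right; apply: img; lra.
suff [u hu uc'] : exists2 u, t3 < u < t4 & g u = c'.
  have ct : ball (g t2) r c'.
    by rewrite -uc'; apply: Hd; rewrite /ball /=; apply/ltr_normlP; split; lra.
  have [e e0 He] := ball_inner ct.
  by have [q c'q pq] := tc' e e0; apply: none; exists q => //; exact: He.
case: Kc' => [Yc'|[u + uc']]; first by case: (CK _ Cc'); left; left.
rewrite /= in_itv /= => hu; exists u => //; apply/andP; split; rewrite ltNge; apply/negP => hus; apply: (CK _ Cc').
  by right; rewrite -uc'; apply: img; lra.
by left; right; rewrite -uc'; apply: img; lra.
Qed.

Lemma touches_along Y A a b p c d : compact Y -> arc A a b ->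
  (forall z, A z -> Y z -> z = a \/ z = b) -> ~ (Y `|` A) p ->
  A c -> c <> a -> c <> b -> A d -> touches (Y `|` A) p c -> touches (Y `|` A) p d.
Proof.
move=> cY /arcW[g [cg ig g0 g1 gA]] AY np Ac ca cb Ad tc.
have Eg : A = g @` `[0, 1].
  apply/seteqP; split=> x; first by move/gA => [t ht <-]; exists t.
  by move=> [t ht <-]; apply/gA; exists t.
have gE t : 0 <= t <= 1 -> g t = a -> t = 0.
  by move=> ht; rewrite -g0 => /ig; apply=> //; rewrite lexx ler01.
have gE1 t : 0 <= t <= 1 -> g t = b -> t = 1.
  by move=> ht; rewrite -g1 => /ig; apply=> //; rewrite lexx ler01.
have nY t : 0 < t < 1 -> ~ Y (g t).
  move=> ht Yt; have ht' : 0 <= t <= 1 by lra.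
  have Agt : A (g t) by apply/gA; exists t.
  by case: (AY _ Agt Yt) => [/(gE _ ht')|/(gE1 _ ht')]; lraF.
have [t1 ht1 gt1] : exists2 t, 0 < t < 1 & g t = c.
  move/gA: Ac => [t ht gt]; exists t => //; rewrite !lt_neqAle; case/andP: (ht) => -> ->; rewrite !andbT.
  by apply/andP; split; apply/eqP => h; [apply: ca|apply: cb]; rewrite -gt -?h // h.
have inner t2 : 0 < t2 < 1 -> touches (Y `|` A) p (g t2).
  move=> ht2; have [tl|tg|<-] := ltgtP t1 t2; last by rewrite gt1.
    rewrite Eg; apply: (touches_along_lt cY cg ig nY _ _ tl); rewrite -?Eg ?gt1 //; lra.
  pose h t := g (1 + t * -1).
  have Eh : A = h @` `[0, 1].
    rewrite Eg; apply/seteqP; split=> _ [t + <-]; rewrite /= in_itv /= => ht.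
      by exists (1 + t * -1); [rewrite /= in_itv /=; lra|rewrite /h; congr g; lra].
    by exists (1 + t * -1) => //; rewrite /= in_itv /=; lra.
  have ch : continuous h by move=> t; apply: continuous_comp; [exact: aff_continuous|exact: cg].
  have ih s t : 0 <= s <= 1 -> 0 <= t <= 1 -> h s = h t -> s = t.
    move=> hs ht /ig E; have : 1 + s * -1 = 1 + t * -1 by apply: E; lra.
    lra.
  have nYh t : 0 < t < 1 -> ~ Y (h t) by move=> ht; apply: nY; lra.
  have hg t : g t = h (1 - t) by rewrite /h; congr g; lra.
  rewrite Eh hg; apply: (touches_along_lt (t1 := 1 - t1) cY ch ih nYh); rewrite -?Eh -?hg ?gt1 //; lra.
move/gA: Ad => [t ht <-]; apply: touches_half => r r0.
have /nbhs_ballP[e /= e0 He] : nbhs t (g @^-1` (ball (g t) r)) by apply: cg; exact: nbhsx_ballx.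
pose u := Num.min (e / 2) (1 / 4).
have [u0 ud u4] : [/\ 0 < u, u < e & u <= 1 / 4].
  by rewrite /u; case: (leP (e / 2) (1 / 4)) => *; split; lra.
have [t2|t2] := leP t (1 / 2).
  exists (g (t + u)); last by apply: inner; lra.
  by apply: He; rewrite /ball /=; apply/ltr_normlP; split; lra.
exists (g (t - u)); last by apply: inner; lra.
by apply: He; rewrite /ball /=; apply/ltr_normlP; split; lra.
Qed.

End Jordan.

(** * Accessibility from a face *)

Section Access.
Variable R : realType.
Notation pl := (plane R).
Local Notation arc := (arc R).
Implicit Types (A B C K Y : set pl) (a b c p q : pl).

Section InfiniteArc.
Variables (x : nat -> pl) (S : nat -> set pl) (a : pl).
Hypothesis aS : forall k, arc (S k) (x k) (x k.+1).
Hypothesis SS : forall j z, S j z -> S j.+1 z -> z = x j.+1.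
Hypothesis Sfar : forall j k z, (j.+1 < k)%N -> S j z -> ~ S k z.
Hypothesis Sa : forall k, ~ S k a.
Hypothesis Slim : forall e : R, 0 < e -> exists k0, forall k z, (k0 <= k)%N -> S k z -> ball a e z.

(** The parameter is inverted: at [s] the position in the infinite concatenation is [1 / s - 1], so
    [a] is reached at [0], where [Slim] gives continuity. *)
Lemma arc_infinite : arc ([set a] `|` \bigcup_k S k) a (x 0).
Proof.
have [h Hh] := choice (fun k => arcW (aS k)).
have hc k : continuous (h k) by case: (Hh k).
have hi k s t : 0 <= s <= 1 -> 0 <= t <= 1 -> h k s = h k t -> s = t by case: (Hh k) => _ + _ _ _; exact.
have h0 k : h k 0 = x k by case: (Hh k).
have h1 k : h k 1 = x k.+1 by case: (Hh k).
have hS k z : S k z <-> exists2 t : R, 0 <= t <= 1 & h k t = z by case: (Hh k).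
(* A sum of clamped increments: it is continuous, runs through each of the first [n] arcs in unit
   time and then rests at [x n]. *)
pose B n (t : R) : pl := ((x 0).1 + \sum_(k < n) ((h k (clamp (t - k%:R))).1 - (x k).1),
                        (x 0).2 + \sum_(k < n) ((h k (clamp (t - k%:R))).2 - (x k).2)).
have BS n t : B n.+1 t = ((B n t).1 + ((h n (clamp (t - n%:R))).1 - (x n).1),
                       (B n t).2 + ((h n (clamp (t - n%:R))).2 - (x n).2)).
  by rewrite /B !big_ord_recr /= !addrA.
have Bge n t : n%:R <= t -> B n t = x n.
  elim: n => [|n IH] nt; first by rewrite /B !big_ord0 !addr0; case: (x 0).
  rewrite BS IH; last by apply: le_trans nt; rewrite ler_nat.
  rewrite clamp1 ?h1; last by rewrite -natr1 in nt; lra.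
  by rewrite !subrKC; case: (x n.+1).
have Bstab n n' t : t <= n%:R -> (n <= n')%N -> B n' t = B n t.
  move=> tn; elim: n' => [|n' IH]; first by rewrite leqn0 => /eqP ->.
  rewrite leq_eqVlt => /orP[/eqP-> //|nn']; rewrite BS IH // clamp0; last first.
    by rewrite subr_le0; apply: le_trans tn _; rewrite ler_nat.
  by rewrite h0 !subrr !addr0; case: (B n t).
have BV n m t : m%:R <= t -> t <= m.+1%:R -> (m < n)%N -> B n t = h m (t - m%:R).
  move=> mt tm mn; rewrite (Bstab m.+1) // BS Bge // clamp_id; last first.
    by rewrite -natr1 in tm; lra.
  by rewrite !subrKC; case: (h m _).
have Bc n : continuous (B n).
  have cc k : continuous (fun t : R => clamp (t - k%:R)).
    move=> t; apply: (continuous_comp (f := fun t : R => t - k%:R) (g := clamp (R := R))).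
      by apply: cvgB; [exact: cvg_id|exact: cvg_cst].
    exact: clamp_continuous.
  elim: n => [|n IH].
    by apply: pair_continuous => t; under eq_fun do rewrite big_ord0 addr0; exact: cvg_cst.
  have [g1 g2] := coord_continuous IH; have [f1 f2] := coord_continuous (@hc n).
  have -> : B n.+1 = fun t => (((B n t).1 + ((h n (clamp (t - n%:R))).1 - (x n).1),
                       (B n t).2 + ((h n (clamp (t - n%:R))).2 - (x n).2)) : pl).
    by apply/funext => t; exact: BS.
  apply: pair_continuous => t.
    apply: cvgD; [exact: g1|apply: cvgB; [|exact: cvg_cst]].
    by apply: (continuous_comp (f := fun t : R => clamp (t - n%:R)) (g := fun t : R => (h n t).1)); [exact: cc|exact: f1].
  apply: cvgD; [exact: g2|apply: cvgB; [|exact: cvg_cst]].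
  by apply: (continuous_comp (f := fun t : R => clamp (t - n%:R)) (g := fun t : R => (h n t).2)); [exact: cc|exact: f2].
pose g (s : R) := if s <= 0 then a else B (Num.truncn s^-1).+1 (s^-1 - 1).
have gE s : 0 < s -> s <= 1 -> exists m (t : R), [/\ 0 <= t < 1, s^-1 = m%:R + t + 1 & g s = h m t].
  move=> s0 s1; have si : 1 <= s^-1 by rewrite invf_ge1.
  have t0 : 0 <= s^-1 - 1 by lra.
  have /andP[l u] := truncn_itv t0; set m := Num.truncn (s^-1 - 1) in l u.
  exists m, (s^-1 - 1 - m%:R); split; first by rewrite -natr1 in u; lra.
    by lra.
  rewrite /g leNgt s0 /=; apply: BV => //; first exact: ltW.
  rewrite ltnS truncn_ge_nat; last by lra.
  by lra.
have gS s : 0 < s -> s <= 1 -> exists m, S m (g s) /\ s^-1 < m%:R + 2.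
  move=> s0 s1; have [m [t [ht E ->]]] := gE s s0 s1; exists m; split; last by lra.
  by apply/hS; exists t => //; lra.
have gc : continuous g.
  move=> s; have [s0|s0] := leP s 0.
    rewrite /continuous_at {2}/g s0; apply/cvg_ballP => e e0.
    have [k0 Hk] := Slim e0.
    have kk : 0 < (k0 + 2)%:R^-1 :> R by rewrite invr_gt0 ltr0n addn2.
    near=> s'; have [s'0|s'0] := leP s' 0; first by rewrite /g s'0; exact: ballxx.
    have s'k : s' < (k0 + 2)%:R^-1 by near: s'; apply: lt_nbhsl; exact: le_lt_trans kk.
    have s'1 : s' <= 1.
      by apply/ltW/(lt_le_trans s'k); rewrite invf_le1 ?ltr0n ?addn2 // ler1n.
    have [m [Sm hm]] := gS s' s'0 s'1; apply: (Hk m) => //.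
    have : (k0 + 2)%:R < s'^-1 by rewrite -[X in X < _]invrK ltf_pV2 // posrE.
    by rewrite natrD => h2; rewrite -(ler_nat R); lra.
  pose N := (Num.truncn (2 * s^-1)).+1.
  have E : \forall s' \near s, B N (s'^-1 - 1) = g s'.
    near=> s'; have s's : s / 2 < s' by near: s'; apply: lt_nbhsr; lra.
    have s'0 : 0 < s' by lra.
    rewrite /g leNgt s'0 /=; apply: Bstab.
      have := truncnS_gt s'^-1; rewrite -natr1; lra.
    rewrite ltnS; apply: le_truncn.
    have -> : 2 * s^-1 = (s / 2)^-1 by rewrite invf_div.
    by apply/ltW; rewrite ltf_pV2 // posrE; lra.
  rewrite /continuous_at -(nbhs_singleton E); apply: cvg_trans (near_eq_cvg E) _.
  apply: (continuous_comp (f := fun s : R => s^-1 - 1) (g := B N)); last exact: Bc.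
  apply: cvgB; [|exact: cvg_cst]; apply: cvgV; [by rewrite gt_eqF|exact: cvg_id].
have g0 : g 0 = a by rewrite /g lexx.
have g1 : g 1 = x 0.
  have [m [t [ht E ->]]] := gE 1 ltr01 (lexx _).
  have [t0 m0] : t = 0 /\ m%:R = 0 :> R.
    by have m0 := ler0n R m; rewrite invr1 in E; split; lra.
  by move/eqP: m0; rewrite pnatr_eq0 => /eqP ->; rewrite t0 h0.
rewrite -g1 -[X in arc _ X _]g0; apply: arcI => //.
- have main s t : 0 < s -> s <= 1 -> 0 < t -> t <= 1 -> g s = g t -> s = t.
    move=> s0 s1 t0 t1; have [m [u [hu Eu ->]]] := gE s s0 s1; have [n [v [hv Ev ->]]] := gE t t0 t1.
    move=> E; suff mn : m = n.
      rewrite -mn in E Ev; have uv : u = v by apply: (hi m) => //; lra.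
      by apply: invr_inj; rewrite Eu Ev uv.
    have key m' n' (u' v' : R) : 0 <= u' < 1 -> 0 <= v' < 1 -> h m' u' = h n' v' -> ~ (m' < n')%N.
      move=> hu' hv' E'; rewrite leq_eqVlt => /orP[/eqP mn|mn].
        have Sm : S m' (h m' u') by apply/hS; exists u' => //; lra.
        have Sn : S m'.+1 (h m' u') by rewrite E' -mn; apply/hS; exists v' => //; lra.
        have := SS Sm Sn; rewrite -h1 => /(hi m') e.
        have : u' = 1 by apply: e; lra.
        lraF.
      apply: (Sfar mn (z := h m' u')); first by apply/hS; exists u' => //; lra.
      by rewrite E'; apply/hS; exists v' => //; lra.
    have [mn|mn|//] := ltngtP m n; first by case: (key m n u v hu hv E).
    by case: (key n m v u hv hu (esym E)).
  have na s : 0 < s -> s <= 1 -> g s <> a.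
    by move=> s0 s1 E; have [m [Sm _]] := gS s s0 s1; apply: (Sa (k := m)); rewrite -E.
  move=> s t /andP[s0 s1] /andP[t0 t1] E.
  move: s0 t0; rewrite !le_eqVlt => /orP[/eqP s0|s0] /orP[/eqP t0|t0].
  + by rewrite -s0 -t0.
  + by case: (na t t0 t1); rewrite -E -s0 g0.
  + by case: (na s s0 s1); rewrite E -t0 g0.
  + exact: main.
- move=> z; split.
    move=> [->|[m _ /hS[t ht <-]]]; first by exists 0; rewrite ?lexx ?ler01.
    have m0 := ler0n R m.
    have s0 : 0 < (m%:R + t + 1)^-1 by rewrite invr_gt0; lra.
    exists ((m%:R + t + 1)^-1); first by rewrite ltW //= invf_le1; lra.
    rewrite /g leNgt s0 /= invrK addrK.
    have -> : h m t = h m (m%:R + t - m%:R) by congr h; lra.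
    apply: BV; [lra|rewrite -natr1; lra|rewrite ltnS truncn_ge_nat; lra].
  move=> [t /andP[t0 t1] <-]; move: t0; rewrite le_eqVlt => /orP[/eqP<-|t0].
    by left; rewrite g0.
  by right; have [m [Sm _]] := gS t t0 t1; exists m.
Unshelve. all: by end_near.
Qed.

End InfiniteArc.

End Access.

(** * End points of arcs reached from a face *)

Section Accessible.
Variable R : realType.
Notation pl := (plane R).
Local Notation arc := (arc R).
Implicit Types (A B C K Y T : set pl) (a b c p q : pl) (r : R).

Definition accessible K p a := exists D q,
  [/\ arc D a q, conn K p q & forall z, D z -> K z -> z = a].

Definition box_boundary a r : set pl :=
  [set c : pl | a.1 - r <= c.1 <= a.1 + r /\ a.2 - r <= c.2 <= a.2 + r] `&` ~` ball a r.

Lemma box_boundary_compact a r : compact (box_boundary a r).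
Proof.
apply: (subclosed_compact _ (@closed_box_compact R a r)); last by move=> c [].
apply: closedI; first by apply: pl_compact_closed; exact: closed_box_compact.
by apply: open_closedC; exact: pl_ball_open.
Qed.

Lemma connected_in_ball C a r p q : connected C -> C p -> C q -> ball a r p ->
  (forall z, C z -> ~ box_boundary a r z) -> ball a r q.
Proof.
move=> cC Cp Cq ap Cb; apply: (connected_ind (P := ball a r) cC Cp Cq ap) => x Cx.
have [ax|ax] := pselect (ball a r x).
  have [e e0 H] := ball_inner ax; apply/nbhs_ballP; exists e => //= y xy _.
  by split=> // _; exact: H.
have [e e0 H] : exists2 e : R, 0 < e & forall y, ball x e y -> ~ [set c : pl |
    a.1 - r <= c.1 <= a.1 + r /\ a.2 - r <= c.2 <= a.2 + r] y.
  apply: closed_ball_miss; first by apply: pl_compact_closed; exact: closed_box_compact.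
  by move=> bx; case: (Cb x Cx).
apply/nbhs_ballP; exists e => //= y xy _; split=> // /plballP[h1 h2 h3 h4].
by case: (H y xy); rewrite /= !ltW.
Qed.

Section Param.
Variables (Y : set pl) (g : R -> pl).
Hypothesis cY : compact Y.
Hypothesis cg : continuous g.
Hypothesis ig : forall s t : R, 0 <= s <= 1 -> 0 <= t <= 1 -> g s = g t -> s = t.
Hypothesis gY : forall t, 0 < t < 1 -> ~ Y (g t).
Let A := g @` `[0, 1].
Let a := g 0.
Let Z r := Y `|` A `|` box_boundary a r.
Let tail K p := exists2 s : R, 0 < s & forall t, 0 < t <= s -> touches K p (g t).

Let compactYA : compact (Y `|` A).
Proof. by apply: compactU => //; exact: subarc_compact. Qed.

Let compactZ r : compact (Z r).
Proof. by apply: compactU; [exact: compactYA|exact: box_boundary_compact]. Qed.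

(** Moves into the box of radius [r] in such a way that the face still touches the beginning of the
    arc even after the boundary of the box has been added to the obstacle; thus the path need not
    leave the box again. Near a touched point [g t] the enlarged obstacle consists of a piece of the
    arc only, and [touches_along] spreads contact with one point of it over the whole beginning. *)
Lemma access_step K p r : 0 < r -> Y `|` A `<=` K -> tail K p ->
  exists p', [/\ ball a r p', ~ Z r p', conn K p p' & tail (Z r) p'].
Proof.
move=> r0 YK [s0 s00 Hs0].
have /nbhs_ballP[d /= d0 Hd] : nbhs (0 : R) (g @^-1` (ball a r)) by apply: cg; exact: nbhsx_ballx.
pose s1 := Num.min (d / 2) (1 / 2).
have [s10 s1d s11] : [/\ 0 < s1, s1 < d & s1 <= 1 / 2].
  by rewrite /s1; case: (leP (d / 2) (1 / 2)) => *; split; lra.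
have inb t : 0 <= t <= s1 -> ball a r (g t).
  by move=> ht; apply: Hd; rewrite /ball /=; apply/ltr_normlP; split; lra.
pose t := Num.min s0 s1 / 2.
have [t0 ts0 ts1] : [/\ 0 < t, t <= s0 & t < s1].
  by rewrite /t; case: (leP s0 s1) => *; split; lra.
have img u v w : u <= v -> v <= w -> (g @` `[u, w]) (g v).
  by move=> uv vw; exists v; rewrite //= in_itv /= uv.
have noimg u v w : 0 <= u -> w <= 1 -> 0 <= v <= 1 -> (g @` `[u, w]) (g v) -> u <= v <= w.
  move=> u0 w1 hv [z + ]; rewrite /= in_itv /= => hz /ig E.
  have <- : z = v by apply: E => //; lra.
  by [].
pose M := Y `|` box_boundary a r `|` g @` `[s1, 1] `|` [set a].
have cM : closed M.
  apply: closedU; last exact: pl_closed1.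
  apply: closedU; last by apply: pl_compact_closed; exact: subarc_compact.
  apply: closedU; first exact: pl_compact_closed.
  by apply: pl_compact_closed; exact: box_boundary_compact.
have nM : ~ M (g t).
  move=> [[[Yt|[_]]|h]|ta].
  - by apply: (gY _ Yt); lra.
  - by apply; apply: inb; lra.
  - by have := noimg s1 t 1; move=> /(_ _ _ _ h); lraF.
  - have : t = 0 by apply: ig => //; lra.
    lraF.
have [e1 e10 H1] := closed_ball_miss cM nM.
have [|e2 e20 H2] := ball_inner (inb t _); first by lra.
pose e := Num.min e1 e2; have e0 : 0 < e by rewrite lt_min e10.
have [|q bq pq] := Hs0 t _ e e0; first by lra.
have ee1 : e <= e1 by rewrite ge_min lexx.
have ee2 : e <= e2 by rewrite ge_min lexx orbT.
have ball1 z : ball (g t) e z -> ~ M z by move=> h; apply: H1; exact: (le_ball ee1).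
have aq : ball a r q by apply: H2; exact: (le_ball ee2).
have nYAq : ~ (Y `|` A) q by move/YK; exact: conn_outr pq.
have nq : ~ Z r q by move=> [//|h]; apply: (ball1 q bq); left; left; right.
exists q; split=> //; exists s1 => // u hu.
have [C [Cq CB cC] Ct] : conn (~` ball (g t) e) q (g t).
  by apply: conn_ball bq (ballxx _ e0) _ => x bx nbx; exact: nbx.
have {}CB z : C z -> ball (g t) e z by move/CB; exact: contrapT.
have [|c [Cc Zc tc]] := touch_exists (pl_compact_closed (@compactZ r)) cC Cq Ct nq.
  by move/conn_outr; apply; left; right; apply: img; lra.
have nMc := ball1 c (CB c Cc).
have [v [hv vc]] : exists v, 0 < v < s1 /\ g v = c.
  case: Zc => [[Yc|[v + vc]]|bc].
  - by case: nMc; left; left; left.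
  - rewrite /= in_itv /= => hv; exists v; split=> //; apply/andP; split; rewrite ltNge; apply/negP => h.
      apply: nMc; right; rewrite -vc /a /=; congr g; lra.
    by apply: nMc; left; right; rewrite -vc; apply: img; lra.
  - by case: nMc; left; left; right.
pose Y1 := Y `|` box_boundary a r `|` g @` `[s1, 1].
have cY1 : compact Y1.
  apply: compactU; last exact: subarc_compact.
  by apply: compactU => //; exact: box_boundary_compact.
have ZE : Z r = Y1 `|` g @` `[0, s1].
  apply/seteqP; split=> z.
    move=> [[Yz|[w + <-]]|bz]; first by left; left; left.
      rewrite /= in_itv /= => hw; have [ws|/ltW ws] := leP w s1.
        by right; apply: img; lra.
      by left; right; apply: img; lra.
    by left; left; right.
  move=> [[[Yz|bz]|[w + <-]]|[w + <-]]; first by left; left.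
  - by right.
  - by rewrite /= in_itv /= => hw; left; right; apply: img; lra.
  - by rewrite /= in_itv /= => hw; left; right; apply: img; lra.
have a1 : arc (g @` `[0, s1]) (g 0) (g s1) by apply: arc_image_sub => //; lra.
rewrite ZE -vc in tc *; rewrite ZE in nq; apply: (touches_along cY1 a1 _ nq _ _ _ _ tc).
- move=> z [w + <-]; rewrite /= in_itv /= => hw [[Yw|[_]]|h].
  + left; congr g; have [//|w0] := eqVneq w 0.
    have w0' : 0 < w by rewrite lt_neqAle eq_sym w0; case/andP: hw.
    by case: (gY _ Yw); lra.
  + by case; apply: inb.
  + right; congr g; have := noimg s1 w 1; move=> /(_ _ _ _ h); lra.
- by apply: img; lra.
- move=> /ig E; have : v = 0 by apply: E; lra.
  lraF.
- move=> /ig E; have : v = s1 by apply: E; lra.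
  lraF.
- by apply: img; lra.
Qed.

(* The end of the path so far, the radius of the box about [a] in which the path
   continues, and the last arc of the path. *)
Record state := State { st_p : pl; st_r : R; st_T : set pl }.
Let inv (s : state) := [/\ 0 < st_r s, ball a (st_r s) (st_p s), ~ Z (st_r s) (st_p s) &
  [/\ tail (Z (st_r s)) (st_p s), closed (st_T s), ~ st_T s a & st_T s (st_p s)]].
Let next (s s' : state) := [/\ arc (st_T s') (st_p s) (st_p s'),
  forall z, st_T s' z -> ball a (st_r s) z, forall z, st_T s' z -> ~ (Y `|` A) z,
  st_r s' <= st_r s / 2 & forall z, ball a (st_r s') z -> ~ st_T s z].

Lemma access_next s : inv s -> exists s', inv s' /\ next s s'.
Proof.
case: s => p r T [/= r0 ap Zp [tp cT Ta Tp]].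
have [e e0 He] := closed_ball_miss cT Ta.
(* Halving makes the path converge to [a]. The next arc still meets [T], but all later ones lie in
   the box of radius [r'], which misses [T]. *)
pose r' := Num.min e (r / 2); have r'0 : 0 < r' by rewrite lt_min e0 divr_gt0.
have r'e : r' <= e by rewrite ge_min lexx.
have r'r : r' <= r / 2 by rewrite ge_min lexx orbT.
have YZ : Y `|` A `<=` Z r by move=> z; left.
have [p' [ap' Zp' pp' tp']] := access_step r'0 YZ tp.
have bT z : ball a r' z -> ~ T z by move=> az; apply: He; exact: (le_ball r'e).
have npp : p <> p' by move=> E; apply: (bT p) => //; rewrite E.
have [D aD DZ] := conn_arc (pl_compact_closed (@compactZ r)) pp' npp.
have DYA z : D z -> ~ (Y `|` A) z by move/DZ => nZ YAz; apply: nZ; left.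
exists (State p' r' D); split; split=> //=.
- split=> //; [exact: arc_closed aD| |exact: arcr aD].
  by move=> /DYA; apply; right; exists 0; rewrite //= in_itv /= lexx ler01.
- move=> z Dz; apply: (connected_in_ball (arc_connected aD) (arcl aD) Dz ap) => w /DZ nZ bw.
  by apply: nZ; right.
Qed.

Lemma access_param p : ~ (Y `|` A) p -> tail (Y `|` A) p -> accessible (Y `|` A) p a.
Proof.
move=> np tp; have [p0 [ap0 Zp0 pp0 tp0]] := access_step ltr01 (subset_refl (A := Y `|` A)) tp.
have A_a : A a by exists 0; rewrite //= in_itv /= lexx ler01.
have pa : p0 <> a by move=> E; apply: Zp0; left; right; rewrite E.
have i0 : inv (State p0 1 [set p0]).
  split=> //=; split=> //; first exact: pl_closed1.
  by move=> /= ap; apply: pa.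
have nx s : exists s', inv s -> inv s' /\ next s s'.
  have [/access_next[s' ?]|ni] := pselect (inv s); first by exists s'.
  by exists s.
have [F HF] := choice nx.
pose st n := iter n F (State p0 1 [set p0]).
have ist n : inv (st n) by elim: n => // n /HF[].
have nst n : next (st n) (st n.+1) by have [] := HF _ (ist n).
pose al k := st_T (st k.+1); pose P k := st_p (st k); pose r k := st_r (st k).
have aal k : arc (al k) (P k) (P k.+1) by case: (nst k).
have alb k z : al k z -> ball a (r k) z by case: (nst k) => _ h _ _ _; exact: h.
have aloff k z : al k z -> ~ (Y `|` A) z by case: (nst k) => _ _ h _ _; exact: h.
have r0 k : 0 < r k by case: (ist k).
have rS k : r k.+1 <= r k / 2 by case: (nst k).
have miss k z : ball a (r k.+1) z -> ~ st_T (st k) z by case: (nst k) => _ _ _ _; exact.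
have rmono j k : (j <= k)%N -> r k <= r j.
  elim: k => [|k IH]; first by rewrite leqn0 => /eqP ->.
  rewrite leq_eqVlt => /orP[/eqP-> //|/IH h]; apply: le_trans h.
  by have := rS k; have := r0 k; lra.
have rinv k : r k * k.+1%:R <= 1.
  elim: k => [|k IH]; first by rewrite mulr1.
  have k0 := ler0n R k; have := rS k; have := r0 k.
  by rewrite -(natr1 k.+1); move: IH; rewrite -(natr1 k); nra.
have dis j k z : (j.+1 < k)%N -> al j z -> ~ al k z.
  by move=> jk alj /alb b; apply: (miss j.+1 z) => //; apply: le_ball b; exact: rmono.
(* Only arcs two or more apart are disjoint; consecutive ones may cross, so each is cut at its first
   point on the next. A point with [J] can start the part kept of arc [k], and the cutting point has
   [J] for the next arc. *)
pose J k x := al k x /\ ~ al k.+1 x.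
have chain kx : exists y : pl * set pl, J kx.1 kx.2 ->
    [/\ arc y.2 kx.2 y.1, y.2 `<=` al kx.1, J kx.1.+1 y.1 & forall z, y.2 z -> al kx.1.+1 z -> z = y.1].
  case: kx => k x /=; have [[xk nxk]|] := pselect (J k x); last by exists (x, setT).
  have nP : x <> P k.+1 by move=> E; apply: nxk; rewrite E; exact: arcl (aal k.+1).
  have [E aE Eal] : exists2 E, arc E x (P k.+1) & E `<=` al k.
    have [->|xP] := pselect (x = P k); first by exists (al k).
    by have [E /arc_sym aE ?] := arc_upto (arc_sym (aal k)) xk nP; exists E.
  have [A' [x' [aA' A'E x'K A'x]]] := arc_first_hit aE (arc_closed (aal k.+1)) (arcr aE) (arcl (aal k.+1)) nxk.
  exists (x', A') => _; split=> //=; first by move=> z /A'E /Eal.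
  by split=> //; apply: (dis k) => //; apply: Eal; apply: A'E; exact: arcr aA'.
have [G HG] := choice chain.
pose X := fix X k := if k is k'.+1 then (G (k', X k')).1 else p0.
pose S k := (G (k, X k)).2.
have JX k : J k (X k).
  elim: k => [|k IH]; last by have [] := HG (k, X k) IH.
  split; first exact: arcl (aal 0%N).
  by move=> /alb /miss; apply.
have HS k : [/\ arc (S k) (X k) (X k.+1), S k `<=` al k, J k.+1 (X k.+1) &
    forall z, S k z -> al k.+1 z -> z = X k.+1] by have := HG (k, X k) (JX k).
exists ([set a] `|` \bigcup_k S k), p0; split=> //; last first.
  by move=> z [-> //|[k _ Skz] YAz]; case: (HS k) => _ /(_ _ Skz) /aloff.
apply: (@arc_infinite R X S a).
- by move=> k; case: (HS k).
- move=> j z Sj Sj1; case: (HS j) => _ _ _; apply=> //; case: (HS j.+1) => _ h _ _; exact: h.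
- move=> j k z jk Sj Sk; apply: (dis j k z jk).
    by case: (HS j) => _ h _ _; exact: h.
  by case: (HS k) => _ h _ _; exact: h.
- by move=> k Ska; case: (HS k) => _ /(_ _ Ska) /aloff h _ _; apply: h; right.
- move=> e e0; exists (Num.truncn e^-1) => k z kk Skz.
  case: (HS k) => _ /(_ _ Skz) /alb b _ _; apply: le_ball b.
  have h : e^-1 <= k.+1%:R by apply/ltW/(lt_le_trans (truncnS_gt _)); rewrite ler_nat.
  have := rinv k; have h2 : 1 <= e * k.+1%:R by rewrite -ler_pdivrMl // mulr1.
  by move=> h3; rewrite -(ler_pM2r (ltr0Sn R k)); apply: le_trans h2.
Qed.

End Param.

Lemma access Y A a b p c : compact Y -> arc A a b ->
  (forall z, A z -> Y z -> z = a \/ z = b) -> ~ (Y `|` A) p ->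
  A c -> c <> a -> c <> b -> touches (Y `|` A) p c -> accessible (Y `|` A) p a.
Proof.
move=> cY aA AY np Ac ca cb tc; have := aA => /arcW[g [cg ig g0 g1 gA]].
have Eg : A = g @` `[0, 1].
  apply/seteqP; split=> x; first by move/gA => [t ht <-]; exists t.
  by move=> [t ht <-]; apply/gA; exists t.
have gE t : 0 <= t <= 1 -> g t = a -> t = 0.
  by move=> ht; rewrite -g0 => /ig; apply=> //; rewrite lexx ler01.
have gE1 t : 0 <= t <= 1 -> g t = b -> t = 1.
  by move=> ht; rewrite -g1 => /ig; apply=> //; rewrite lexx ler01.
have nY t : 0 < t < 1 -> ~ Y (g t).
  move=> ht Yt; have ht' : 0 <= t <= 1 by lra.
  have Agt : A (g t) by apply/gA; exists t.
  by case: (AY _ Agt Yt) => [/(gE _ ht')|/(gE1 _ ht')]; lraF.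
rewrite -g0 Eg; apply: access_param => //; rewrite -?Eg //.
exists 1; first exact: ltr01.
move=> t ht; apply: (touches_along cY aA AY np Ac ca cb) => //.
by apply/gA; exists t => //; lra.
Qed.

End Accessible.

(** * Arcs have empty interior *)

Section EmptyInterior.
Variables (R : realType) (T : topologicalType).
Hypothesis hT : hausdorff_space T.
Notation pl := (plane R).

Lemma point_nonsep (a p q : pl) : p <> a -> q <> a -> conn [set a] p q.
Proof.
move=> pa qa.
have [r1 r10 H1] := closed_ball_miss (@pl_closed1 _ p) (fun e : a = p => pa (esym e)).
have [r2 r20 H2] := closed_ball_miss (@pl_closed1 _ q) (fun e : a = q => qa (esym e)).
apply: (@conn_outside_ball _ _ a (Num.min r1 r2)).
- by move=> _ ->; apply: ballxx; rewrite lt_min r10.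
- by move=> h; apply: (H1 p) => //; apply: le_ball h; rewrite ge_min lexx.
- by move=> h; apply: (H2 q) => //; apply: le_ball h; rewrite ge_min lexx orbT.
Qed.

(** The addition theorem applies to the point [b] and the boundary of the square; a connected set
    avoiding that boundary stays inside. *)
Lemma punctured_ball (a : pl) (r : R) (b p q : pl) : ball a r b -> ball a r p -> ball a r q ->
  p <> b -> q <> b ->
  exists C, [/\ connected C, C p, C q & forall z, C z -> ball a r z /\ z <> b].
Proof.
move=> ab ap aq pb qb; have c1 := point_nonsep pb qb.
have c2 : conn (box_boundary a r) p q.
  by apply: conn_ball ap aq _ => x ax [_]; exact.
have [C [Cp CK cC] Cq] := @conn_add1 R _ _ b p q (@compact_set1 _ b) (@box_boundary_compact R a r)
  (fun c h _ => h) c1 c2.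
exists C; split=> // z Cz; split; last by move=> zb; apply: (CK z Cz); left.
by apply: (connected_in_ball cC Cp Cz ap) => w /CK nK bw; apply: nK; right.
Qed.

(* An arc that fills a disk is disconnected by any of its inner points, unlike the disk. *)
Lemma arc_empty_interior (psi : pl -> T) (A : set T) a b c r : continuous psi ->
  injective psi -> arc R A a b -> 0 < r -> exists2 z, ball c r z & ~ A (psi z).
Proof.
move=> cpsi ipsi /arcW[g [cg ig g0 g1 gA]] r0; apply: contrapT => none.
have BA z : ball c r z -> A (psi z).
  by move=> bz; apply: contrapT => nA; apply: none; exists z.
pose z1 : pl := (c.1 + r / 2, c.2); pose z2 : pl := (c.1 - r / 2, c.2).
have b1 : ball c r z1 by apply/plballP => /=; split; lra.
have b2 : ball c r z2 by apply/plballP => /=; split; lra.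
have b0 : ball c r c by exact: ballxx.
have main (t1 t2 t3 : R) x1 x2 x3 : 0 <= t1 -> t1 < t2 -> t2 < t3 -> t3 <= 1 ->
    g t1 = psi x1 -> g t2 = psi x2 -> g t3 = psi x3 ->
    ball c r x1 -> ball c r x2 -> ball c r x3 -> False.
  move=> t10 t12 t23 t31 e1 e2 e3 h1 h2 h3.
  have x12 : x1 <> x2.
    move=> E; have : t1 = t2 by apply: ig; rewrite ?e1 ?e2 ?E //; lra.
    lraF.
  have x32 : x3 <> x2.
    move=> E; have : t3 = t2 by apply: ig; rewrite ?e3 ?e2 ?E //; lra.
    lraF.
  have [C [cC C1 C3 HC]] := punctured_ball h2 h1 h3 x12 x32.
  have cl (s t : R) : closed (psi @^-1` (g @` `[s, t])).
    move/continuous_closedP: cpsi; apply; apply: compact_closed => //.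
    apply: continuous_compact; last exact: segment_compact.
    exact: continuous_subspaceT.
  have onC z : C z -> exists2 u, 0 <= u <= 1 /\ u <> t2 & g u = psi z.
    move=> /HC[bz zx]; have /gA[u hu E] := BA z bz; exists u => //; split=> // ut.
    by apply: zx; apply: ipsi; rewrite -e2 -E ut.
  suff [u + E] : (psi @^-1` (g @` `[0, t2])) x3.
    rewrite /= in_itv /= => hu; have : u = t3 by apply: ig; rewrite ?E ?e3 //; lra.
    lraF.
  apply: (connected_ind (P := psi @^-1` (g @` `[0, t2])) cC C1 C3).
    by exists t1; rewrite //= in_itv /=; lra.
  move=> x Cx; have [u [hu ut] gu] := onC x Cx; have [lt|gt] := ltP u t2.
    have nx : ~ (psi @^-1` (g @` `[t2, 1])) x.
      move=> [v + E]; rewrite /= in_itv /= => hv; have : v = u by apply: ig; rewrite ?E ?gu //; lra.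
      lraF.
    have [e e0 He] := closed_ball_miss (cl t2 1) nx.
    apply/nbhs_ballP; exists e => //= y xy Cy.
    have [v [hv vt] gv] := onC y Cy; split=> _.
      exists v => //=; rewrite in_itv /= (andP hv).1 leNgt; apply/negP => tv.
      by apply: (He y xy); exists v; rewrite //= in_itv /=; lra.
    by exists u; rewrite //= in_itv /=; lra.
  have {}gt : t2 < u by rewrite lt_neqAle gt andbT eq_sym; apply/eqP.
  have nx : ~ (psi @^-1` (g @` `[0, t2])) x.
    move=> [v + E]; rewrite /= in_itv /= => hv; have : v = u by apply: ig; rewrite ?E ?gu //; lra.
    lraF.
  have [e e0 He] := closed_ball_miss (cl 0 t2) nx.
  apply/nbhs_ballP; exists e => //= y xy Cy; split=> //.
  by move/(He y xy).
have /gA[t0 ht0 e0] := BA _ b0; have /gA[t1 ht1 e1] := BA _ b1; have /gA[t2 ht2 e2] := BA _ b2.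
have z01 : z1 <> c by move=> h; move: (congr1 fst h) => /=; lraF.
have z02 : z2 <> c by move=> h; move: (congr1 fst h) => /=; lraF.
have z12 : z1 <> z2 by move=> h; move: (congr1 fst h) => /=; lraF.
have n01 : t0 <> t1 by move=> E; apply: z01; apply: ipsi; rewrite -e1 -e0 E.
have n02 : t0 <> t2 by move=> E; apply: z02; apply: ipsi; rewrite -e2 -e0 E.
have n12 : t1 <> t2 by move=> E; apply: z12; apply: ipsi; rewrite -e1 -e2 E.
have [a01|a01|/n01[]] := ltgtP t0 t1; have [a02|a02|/n02[]] := ltgtP t0 t2;
  have [a12|a12|/n12[]] := ltgtP t1 t2.
- by apply: (main t0 t1 t2 c z1 z2); rewrite //; lra.
- by apply: (main t0 t2 t1 c z2 z1); rewrite //; lra.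
- lraF.
- by apply: (main t2 t0 t1 z2 c z1); rewrite //; lra.
- by apply: (main t1 t0 t2 z1 c z2); rewrite //; lra.
- lraF.
- by apply: (main t1 t2 t0 z1 z2 c); rewrite //; lra.
- by apply: (main t2 t1 t0 z2 z1 c); rewrite //; lra.
Qed.

End EmptyInterior.

(** * Maximal plane drawings *)

Section PlaneGraph.
Variable R : realType.
Notation pl := (plane R).
Local Notation arc := (arc R).
Variable V : finType.
Implicit Types (u v w t x y : V) (e f : {set V}) (p q c z : pl).

Lemma compact_finite_union (I : finType) (P : I -> Prop) (F : I -> set pl) :
  (forall i, P i -> compact (F i)) -> compact [set z | exists2 i, P i & F i z].
Proof.
move=> cF; suff H (s : seq I) : compact [set z | exists i, [/\ i \in s, P i & F i z]].
  have := H (enum I); congr compact; apply/seteqP; split=> z.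
    by move=> [i [_ Pi Fi]]; exists i.
  by move=> [i Pi Fi]; exists i; rewrite mem_enum.
elim: s => [|i s IH].
  by rewrite (_ : [set _ | _] = set0); [exact: compact0|apply/seteqP; split=> z // [i []]].
have [Pi|nPi] := pselect (P i).
  rewrite (_ : [set _ | _] = F i `|` [set z | exists i, [/\ i \in s, P i & F i z]]).
    by apply: compactU => //; exact: cF.
  apply/seteqP; split=> z.
    move=> [j []]; rewrite inE => /orP[/eqP->|js] Pj Fj; first by left.
    by right; exists j.
  by move=> [Fi|[j [js Pj Fj]]]; [exists i; rewrite mem_head|exists j; rewrite inE js orbT].
rewrite (_ : [set _ | _] = [set z | exists i, [/\ i \in s, P i & F i z]]) //.
apply/seteqP; split=> z.
  move=> [j []]; rewrite inE => /orP[/eqP->|js] Pj Fj //.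
  by exists j.
by move=> [j [js Pj Fj]]; exists j; rewrite inE js orbT.
Qed.

Record plane_graph := PlaneGraph {
  pg_edges : {set {set V}};
  pg_pt : V -> pl;
  pg_arc : {set V} -> set pl;
  pg_simple : forall e, e \in pg_edges -> #|e| = 2%N;
  pg_inj : injective pg_pt;
  pg_arcP : forall u v, [set u; v]%SET \in pg_edges -> arc (pg_arc [set u; v]%SET) (pg_pt u) (pg_pt v);
  pg_vertex : forall v e, e \in pg_edges -> pg_arc e (pg_pt v) -> v \in e;
  pg_cross : forall e f z, e \in pg_edges -> f \in pg_edges -> e != f ->
    pg_arc e z -> pg_arc f z -> exists v, [/\ v \in e, v \in f & z = pg_pt v]
}.

Variable G : plane_graph.
Local Notation E := (pg_edges G).
Local Notation pt := (pg_pt G).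
Local Notation ar := (pg_arc G).

Definition adj u v := [set u; v]%SET \in pg_edges G.
Definition support : set pl := [set z | (exists2 e, e \in E & ar e z) \/ exists v, z = pt v].
Notation X := support.

(** The form of maximality that passes through the projection: an arc [D] with these properties
    could be drawn as a further edge. *)
Definition maximal_graph := forall u v D, u <> v -> ~~ adj u v -> arc D (pt u) (pt v) ->
  ~ (forall z, D z -> X z -> z = pt u \/ z = pt v).

Lemma adjC u v : adj u v = adj v u. Proof. by rewrite /adj finset.setUC. Qed.

Lemma adj_neq u v : adj u v -> u <> v.
Proof. by move=> /pg_simple + E'; rewrite E' finset.setUid cards1. Qed.

Lemma edge_adj e : e \in E -> exists u v, e = [set u; v]%SET /\ adj u v.
Proof.
move=> eE; have /eqP/cards2P[u [v [uv Ee]]] := pg_simple eE.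
by exists u, v; split=> //; rewrite /adj -Ee.
Qed.

Lemma adj_arc u v : adj u v -> arc (ar [set u; v]%SET) (pt u) (pt v).
Proof. exact: pg_arcP. Qed.

Lemma edge_compact e : e \in E -> compact (ar e).
Proof. by move=> /edge_adj[u [v [-> /adj_arc]]]; exact: arc_compact. Qed.

Lemma pt_neq u v : u <> v -> pt u <> pt v.
Proof. by move=> uv /pg_inj. Qed.

Lemma edge_pt e v : e \in E -> ar e (pt v) <-> v \in e.
Proof.
move=> eE; split; first exact: pg_vertex.
have [u [w [Ee uw]]] := edge_adj eE; rewrite Ee !inE => /orP[] /eqP->.
  exact: arcl (adj_arc uw).
exact: arcr (adj_arc uw).
Qed.

Definition inner e z := ar e z /\ forall v, z <> pt v.

Lemma innerE u v z : adj u v -> (inner [set u; v]%SET z <-> ar [set u; v]%SET z /\ z <> pt u /\ z <> pt v).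
Proof.
move=> uv; split=> [[h1 h2]|[h1 [h2 h3]]]; first by split=> //; split; exact: h2.
split=> // w zw; move: h1; rewrite zw (edge_pt _ uv) !inE => /orP[] /eqP wu.
  by apply: h2; rewrite zw wu.
by apply: h3; rewrite zw wu.
Qed.

Lemma edge_support e z : e \in E -> ar e z -> X z.
Proof. by move=> eE ez; left; exists e. Qed.

Lemma pt_support v : X (pt v). Proof. by right; exists v. Qed.

(** All vertices are kept, also the ends of [e], so an inner point of [e] has a neighbourhood in
    which the drawing consists of [e] alone. *)
Definition rest e : set pl :=
  [set z | exists2 f, f \in E /\ f != e & ar f z] `|` [set z | exists2 v, True & [set pt v] z].

Lemma rest_compact e : compact (rest e).
Proof.
apply: compactU; apply: compact_finite_union; first by move=> f [/edge_compact].
by move=> v _; exact: compact_set1.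
Qed.

Lemma support_rest e : e \in E -> X = rest e `|` ar e.
Proof.
move=> eE; apply/seteqP; split=> z.
  move=> [[f fE fz]|[v ->]]; last by left; right; exists v.
  by have [fe|fe] := eqVneq f e; [right; rewrite -fe|left; left; exists f].
move=> [[[f [fE _] fz]|[v _ ->]]|ez]; first by left; exists f.
  exact: pt_support.
exact: edge_support ez.
Qed.

Lemma support_compact : compact X.
Proof.
have -> : X = [set z | exists2 e, e \in E & ar e z] `|` [set z | exists2 v, True & [set pt v] z].
  apply/seteqP; split=> z [[e eE ez]|h]; first by left; exists e.
  - by case: h => v ->; right; exists v.
  - by left; exists e.
  - by case: h => v _ ->; right; exists v.
apply: compactU; apply: compact_finite_union; first exact: edge_compact.
by move=> v _; exact: compact_set1.
Qed.

Lemma support_closed : closed X.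
Proof. exact: pl_compact_closed support_compact. Qed.

Lemma inner_rest e z : e \in E -> inner e z -> ~ rest e z.
Proof.
move=> eE [ez nz] [[f [fE fe] fz]|[v _ zv]]; last exact: (nz v).
by have [v [_ _ zv]] := pg_cross fE eE fe fz ez; exact: (nz v).
Qed.

Lemma rest_edge u v z : adj u v -> ar [set u; v]%SET z -> rest [set u; v]%SET z -> z = pt u \/ z = pt v.
Proof.
move=> uv ez rz; apply: contrapT => /not_orP[zu zv].
by apply: (inner_rest uv _ rz); apply/innerE.
Qed.

Lemma edge_access p u v c : adj u v -> ~ X p -> inner [set u; v]%SET c -> touches X p c ->
  accessible X p (pt u) /\ accessible X p (pt v).
Proof.
move=> uv Xp ic tc; have [ec [cu cv]] := (innerE _ uv).1 ic.
have XE := support_rest uv; rewrite XE in Xp tc *.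
have A := adj_arc uv; split.
  by apply: (access (@rest_compact _) A _ Xp ec cu cv tc) => // z; exact: rest_edge.
apply: (access (@rest_compact _) (arc_sym A) _ Xp ec cv cu tc) => // z ez rz.
by case: (rest_edge uv ez rz); [right|left].
Qed.

Lemma isolated_access p u q (r : R) : ball (pt u) r q -> conn X p q ->
  (forall z, ball (pt u) r z -> X z -> z = pt u) -> 0 < r -> accessible X p (pt u).
Proof.
move=> bq pq H r0; have uq : pt u <> q.
  by move=> E'; apply: (conn_outr pq); rewrite -E'; exact: pt_support.
have := seg_arc uq; set D := (D in arc D _ _) => aD; exists D, q; split=> // z Dz; apply: H.
by case: Dz => t ht <-; apply: ball_convex => //; exact: ballxx.
Qed.

Definition away u : set pl :=
  [set z | exists2 f, f \in E /\ u \notin f & ar f z] `|` [set z | exists2 v, v <> u & [set pt v] z].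

Lemma away_compact u : compact (away u).
Proof.
apply: compactU; apply: compact_finite_union; first by move=> f [/edge_compact].
by move=> v _; exact: compact_set1.
Qed.

Lemma away_pt u : ~ away u (pt u).
Proof.
move=> [[f [fE nuf] /(edge_pt _ fE) uf]|[v vu /pg_inj uv]]; first by rewrite uf in nuf.
by apply: vu.
Qed.

Lemma near_vertex u z : X z -> ~ away u z -> z <> pt u -> exists2 v, adj u v & inner [set u; v]%SET z.
Proof.
move=> Xz nz zu; case: Xz => [[f fE fz]|[v zv]]; last first.
  case: nz; right; exists v => // vu; by apply: zu; rewrite zv vu.
have uf : u \in f.
  by apply/negP => /negP nuf; apply: nz; left; exists f.
have [a [b [fab ab]]] := edge_adj fE.
have [v fuv] : exists v, f = [set u; v]%SET.
  by move: uf; rewrite fab !inE => /orP[] /eqP->; [exists b|exists a; rewrite finset.setUC].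
have uv : adj u v by rewrite /adj -fuv.
exists v => //; apply/innerE => //; rewrite -fuv; split=> //; split=> // zv.
by apply: nz; right; exists v => // vu; exact: (adj_neq uv (esym vu)).
Qed.

(** If the drawing is only [pt u] near that point, a segment will do. Otherwise a connected set in a
    small punctured ball leads from the face to a point of the drawing, and its frontier point is an
    inner point of an edge at [u], to which [edge_access] applies. *)
Lemma vertex_access p u : ~ X p -> touches X p (pt u) -> accessible X p (pt u).
Proof.
move=> Xp tu; have [r r0 Hr] := closed_ball_miss (pl_compact_closed (@away_compact u)) (@away_pt u).
have [iso|niso] := pselect (forall z, ball (pt u) r z -> X z -> z = pt u).
  by have [q bq pq] := tu r r0; exact: (isolated_access bq pq).
have [z [bz [Xz zu]]] : exists z, ball (pt u) r z /\ (X z /\ z <> pt u).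
  apply: contrapT => nz; apply: niso => z bz Xz; apply: contrapT => zu.
  by apply: nz; exists z.
have [q bq pq] := tu r r0.
have qu : q <> pt u by move=> E'; apply: (conn_outr pq); rewrite E'; exact: pt_support.
have [C [cC Cq Cz HC]] := punctured_ball (ballxx _ r0) bq bz qu zu.
have [|c [Cc Xc tc]] := touch_exists support_closed cC Cq Cz (conn_outr pq); first by move/conn_outr.
have [bc cu] := HC c Cc; have [v uv ic] := near_vertex Xc (Hr _ bc) cu.
suff tpc : touches X p c by have [] := edge_access uv Xp ic tpc.
by apply: touches_sub tc => w; exact: conn_trans.
Qed.

Lemma touched_vertex p c : ~ X p -> X c -> touches X p c ->
  (exists2 w, c = pt w & accessible X p (pt w)) \/
  (exists w w', [/\ adj w w', inner [set w; w']%SET c, accessible X p (pt w) & accessible X p (pt w')]).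
Proof.
move=> Xp Xc tc; have [[w cw]|nv] := pselect (exists w, c = pt w).
  by left; exists w => //; apply: vertex_access => //; rewrite -cw.
case: Xc => [[e eE ec]|[w cw]]; last by case: nv; exists w.
right; have [w [w' [Ee ww]]] := edge_adj eE.
have ic : inner [set w; w']%SET c by split; [rewrite -Ee|move=> v cv; apply: nv; exists v].
by have [h1 h2] := edge_access ww Xp ic tc; exists w, w'.
Qed.

Lemma frontier_sub K p q : closed K -> ~ X p -> (forall c, X c -> touches X p c -> K c) ->
  conn K p q -> conn X p q.
Proof.
move=> cK Xp H [C [Cp CK cC] Cq]; apply: contrapT => npq.
have [c [Cc Xc tc]] := touch_exists support_closed cC Cp Cq Xp npq.
exact: (CK c Cc (H c Xc tc)).
Qed.

(** The source of new vertices: if the frontier of the face of [p] were contained in [K], no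
    connected set off [K] could leave the face, so a vertex on the same side of [K] is
    impossible. *)
Lemma frontier_out K p v : closed K -> ~ X p -> conn K p (pt v) -> exists c,
  [/\ X c, touches X p c & ~ K c].
Proof.
move=> cK Xp pv; apply: contrapT => none.
have /conn_outr : conn X p (pt v); last by apply; exact: pt_support.
apply: frontier_sub pv => // c Xc tc; apply: contrapT => Kc.
by apply: none; exists c.
Qed.

Hypothesis maxG : maximal_graph.

Lemma access_adj p u v : accessible X p (pt u) -> accessible X p (pt v) -> u <> v -> adj u v.
Proof.
move=> [D [q [aD pq DX]]] [D' [q' [aD' pq' DX']]] uv; apply/negPn/negP => nuv.
have qq' := conn_trans (conn_sym pq) pq'.
have uq' : pt u <> q' by move=> E'; apply: (conn_outr pq'); rewrite -E'; exact: pt_support.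
have [B aB BX] : exists2 B, arc B (pt u) q' & forall z, B z -> X z -> z = pt u.
  have [qE|qn] := pselect (q = q'); first by exists D; rewrite -?qE.
  have [C aC CX] := conn_arc support_closed qq' qn.
  have [B aB BDC] := arc_join aD aC uq'; exists B => // z /BDC[Dz|/CX //].
  exact: DX.
have [C aC CBD] := arc_join aB (arc_sym aD') (pt_neq uv).
apply: (maxG uv nuv aC) => z /CBD[Bz|D'z] Xz; first by left; exact: BX.
by right; exact: DX'.
Qed.

(** Around an isolated vertex there is a face from which it is accessible. A single point does not
    separate that face from another vertex, so the frontier contains more than [pt u], hence
    provides an accessible vertex, which is adjacent to [u]. *)
Lemma has_neighbour u : (1 < #|V|)%N -> exists v, adj u v.
Proof.
move=> V2; apply: contrapT => nu.
have [r r0 Hr] := closed_ball_miss (pl_compact_closed (@away_compact u)) (@away_pt u).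
have iso z : ball (pt u) r z -> X z -> z = pt u.
  move=> bz Xz; apply: contrapT => zu; apply: nu.
  by have [v uv _] := near_vertex Xz (Hr _ bz) zu; exists v.
pose p : pl := ((pt u).1 + r / 2, (pt u).2).
have bp : ball (pt u) r p by apply/plballP => /=; split; lra.
have pu : p <> pt u by move=> h; move: (congr1 fst h) => /=; lraF.
have Xp : ~ X p by move=> Xp; apply: pu; exact: iso.
have au : accessible X p (pt u) by apply: (isolated_access bp) => //; exact: conn_refl.
have [v vu] : exists v, v <> u.
  have : (0 < #|predC1 u|)%N by rewrite cardC1; case: #|V| V2 => [|[]].
  by case/card_gt0P => v; rewrite inE => /eqP; exists v.
have [c [Xc tc cu]] := frontier_out (@pl_closed1 _ (pt u)) Xp (point_nonsep pu (pt_neq vu)).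
have [[w cw aw]|[w [w' [ww ic aw aw']]]] := touched_vertex Xp Xc tc.
  have uw : u <> w by move=> E'; apply: cu; rewrite cw E'.
  by apply: nu; exists w; exact: access_adj au aw uw.
have uw : u <> w by move=> E'; apply: nu; exists w'; rewrite E'.
by apply: nu; exists w; exact: access_adj au aw uw.
Qed.

(** Passes from a side of the subdrawing [K] to a face of the whole drawing along the same edge:
    close to [c] there is nothing but [e], so a nearby point off [K] is off the drawing. *)
Lemma near_face K p' e c : closed K -> e \in E -> ar e `<=` K -> K `<=` X -> inner e c -> touches K p' c ->
  exists p, [/\ ~ X p, conn K p' p & exists2 c', inner e c' & touches X p c'].
Proof.
move=> cK eE eK KX ic tc.
have [r r0 Hr] := closed_ball_miss (pl_compact_closed (@rest_compact e)) (inner_rest eE ic).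
have [q bq pq] := tc r r0.
have Xq : ~ X q.
  by rewrite (support_rest eE) => -[/(Hr _ bq) //|/eK]; exact: conn_outr pq.
exists q; split=> //.
have [C [Cq CB cC] Cc] : conn (~` ball c r) q c.
  by apply: conn_ball bq (ballxx _ r0) _ => x bx nbx; exact: nbx.
have Xc : X c by apply: edge_support eE (proj1 ic).
have [|c' [Cc' Xc' tc']] := touch_exists support_closed cC Cq Cc Xq.
  by move/conn_outr.
have bc' : ball c r c' by apply: contrapT; exact: CB.
exists c' => //; move: Xc'; rewrite (support_rest eE) => -[/(Hr _ bc') //|ec'].
by split=> // v c'v; apply: (Hr _ bc'); right; exists v.
Qed.

Lemma edge_nonsep e p q : e \in E -> ~ ar e p -> ~ ar e q -> conn (ar e) p q.
Proof. by move=> /edge_adj[u [v [-> /adj_arc aE]]]; exact: arc_nonsep aE. Qed.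

Lemma inner_exists u v : adj u v -> exists c, inner [set u; v]%SET c.
Proof.
move=> uv; have [g [cg ig g0 g1 gA]] := arcW (adj_arc uv).
exists (g 2^-1); apply/innerE => //; split; first by apply/gA; exists 2^-1 => //; lra.
rewrite -g0 -g1; split=> /ig h.
  have : (2^-1 : R) = 0 by apply: h; lra.
  lraF.
have : (2^-1 : R) = 1 by apply: h; lra.
lraF.
Qed.

Lemma out_of_set (s : seq V) : (size s < #|V|)%N -> exists t, t \notin s.
Proof.
move=> sV; apply/existsP; rewrite -negb_forall; apply/negP => /forallP all.
have : (#|V| <= size s)%N by rewrite cardE; apply: uniq_leq_size; [exact: enum_uniq|move=> x _; exact: all].
by rewrite leqNgt sV.
Qed.

(** Both ends are accessible from a face along the edge, so any third accessible vertex is a common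
    neighbour. There is one because the edge alone, being an arc, does not separate the face from a
    third vertex [t]. *)
Lemma edge_one_common u v : (2 < #|V|)%N -> adj u v -> exists w, adj u w /\ adj w v.
Proof.
move=> V3 uv; have uE : [set u; v]%SET \in E by [].
have [t] := @out_of_set [:: u; v] V3; rewrite !inE negb_or => /andP[/eqP tu /eqP tv].
have et : ~ ar [set u; v]%SET (pt t) by rewrite (edge_pt _ uE) !inE => /orP[] /eqP.
have [c ic] := inner_exists uv.
have tc : touches (ar [set u; v]%SET) (pt t) c.
  move=> r r0; have [z bz ez] := @arc_empty_interior R _ (@plane_hausdorff R) id _ _ _ c r
    (fun _ => cvg_id) (fun _ _ h => h) (adj_arc uv) r0.
  by exists z => //; exact: edge_nonsep.
have cE := pl_compact_closed (edge_compact uE).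
have [p [Xp tp [c' ic' tc']]] := near_face cE uE (subset_refl (A := _)) (fun z => edge_support uE) ic tc.
have [au av] := edge_access uv Xp ic' tc'.
have fin w : accessible X p (pt w) -> w <> u -> w <> v -> exists w, adj u w /\ adj w v.
  move=> aw wu wv; exists w; split; first by apply: (access_adj au aw) => h; exact: wu.
  exact: (access_adj aw av).
have [c2 [Xc2 tc2 nc2]] := frontier_out cE Xp (conn_sym tp).
have [[w cw aw]|[w [w' [ww icw aw aw']]]] := touched_vertex Xp Xc2 tc2.
  apply: (fin w) => // wu; apply: nc2; rewrite cw wu (edge_pt _ uE) !inE eqxx ?orbT //.
have [wu|wu] := eqVneq w u; last have [wv|wv] := eqVneq w v.
- apply: (fin w' aw') => w'E; first by apply: (adj_neq ww); rewrite wu w'E.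
  by apply: nc2; case: icw => + _; rewrite wu w'E.
- apply: (fin w' aw') => w'E; last by apply: (adj_neq ww); rewrite wv w'E.
  by apply: nc2; case: icw => + _; rewrite wv w'E finset.setUC.
- by apply: (fin w aw); exact/eqP.
Qed.

Definition path2 u w v := ar [set u; w]%SET `|` ar [set w; v]%SET.

Lemma edge_neq x y u v : (x != u) && (x != v) -> [set x; y]%SET != [set u; v]%SET.
Proof.
move=> /andP[ac ad]; apply/eqP => /setP/(_ x); rewrite !inE eqxx (negbTE ac) (negbTE ad).
by [].
Qed.

Lemma path2_arc u w v : adj u w -> adj w v -> u <> v -> arc (path2 u w v) (pt u) (pt v).
Proof.
move=> uw wv uv; apply: (arc_glue (adj_arc uw) (adj_arc wv)) => z z1 z2.
have uw' := adj_neq uw.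
have ne : [set u; w]%SET != [set w; v]%SET.
  by apply: edge_neq; apply/andP; split; apply/eqP.
have [x [x1 x2 ->]] := pg_cross uw wv ne z1 z2.
move: x1 x2; rewrite !inE => /orP[/eqP->|/eqP-> //] /orP[/eqP-> //|/eqP E']; by case: uv.
Qed.

Lemma path2_pt u w v x : adj u w -> adj w v -> path2 u w v (pt x) <-> x \in [:: u; w; v].
Proof.
move=> uw wv; rewrite /path2 !inE; split.
  by move=> [/(edge_pt _ uw)|/(edge_pt _ wv)]; rewrite !inE => /orP[] ->; rewrite ?orbT.
case/or3P => h; [left; apply/(edge_pt _ uw)|left; apply/(edge_pt _ uw)|right; apply/(edge_pt _ wv)];
  by rewrite !inE h ?orbT.
Qed.

Lemma path2_support u w v : adj u w -> adj w v -> path2 u w v `<=` X.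
Proof. by move=> uw wv z [] h; [apply: edge_support uw h|apply: edge_support wv h]. Qed.

Lemma edge_path2 u w v z : adj u v -> adj u w -> adj w v -> ar [set u; v]%SET z -> path2 u w v z ->
  z = pt u \/ z = pt v.
Proof.
move=> uv uw wv ez pz; apply: (rest_edge uv ez); left.
have [hu hw hv] : [/\ u <> w, w <> v & u <> v] by split; exact: adj_neq.
case: pz => h; [exists [set u; w]%SET|exists [set w; v]%SET] => //; split=> //.
  by rewrite finset.setUC; apply: edge_neq; apply/andP; split; apply/eqP => // e; apply: hu.
by apply: edge_neq; apply/andP; split; apply/eqP => // e; apply: hu.
Qed.

(** The triangle [u v w] is a closed curve, all of it on the frontier of the side of a fourth vertex
    [t]. The face along [u v] on that side has a frontier that leaves the triangle, since [t] is on
    the same side, and this gives an accessible vertex other than [u], [v], [w]. *)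
Lemma edge_two_common u v : (3 < #|V|)%N -> adj u v ->
  exists w w', [/\ w != w', adj u w, adj w v, adj u w' & adj w' v].
Proof.
move=> V4 uv; have uE : [set u; v]%SET \in E by [].
have [w [uw wv]] := edge_one_common (ltnW V4) uv.
have [hu hw hv] : [/\ u <> w, w <> v & u <> v] by split; exact: adj_neq.
have [t] := @out_of_set [:: u; v; w] V4; rewrite !inE !negb_or => /and3P[/eqP tu /eqP tv /eqP tw].
pose K := ar [set u; v]%SET `|` path2 u w v.
have a2 := path2_arc uw wv hv.
have cK : closed K by apply: closedU2; [exact: edge_compact|exact: arc_compact a2].
have nKt : ~ K (pt t).
  move=> [/(edge_pt _ uE)|/(path2_pt _ uw wv)]; rewrite !inE; first by case/orP => /eqP.
  by case/or3P => /eqP.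
have [c ic] := inner_exists uv.
have tc : touches K (pt t) c.
  apply: (jordan_frontier (adj_arc uv) a2 _ nKt (or_introl (proj1 ic))) => z.
  exact: edge_path2.
have KX : K `<=` X by move=> z [/(edge_support uE) //|]; exact: path2_support.
have [p [Xp tp [c' ic' tc']]] := near_face cK uE (fun z h => or_introl h) KX ic tc.
have [au av] := edge_access uv Xp ic' tc'.
suff [w' [aw' w'u w'v w'w]] : exists w', [/\ accessible X p (pt w'), w' <> u, w' <> v & w' <> w].
  exists w, w'; split=> //; first by apply/eqP => h; exact: w'w.
    by apply: (access_adj au aw') => h; exact: w'u.
  exact: (access_adj aw' av).
have [c2 [Xc2 tc2 nc2]] := frontier_out cK Xp (conn_sym tp).
have [[x cx ax]|[x [x' [xx icx ax ax']]]] := touched_vertex Xp Xc2 tc2.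
  exists x; split=> // xE; apply: nc2; rewrite cx xE.
  - by left; apply/(edge_pt _ uE); rewrite !inE eqxx.
  - by left; apply/(edge_pt _ uE); rewrite !inE eqxx orbT.
  - by right; apply/(path2_pt _ uw wv); rewrite !inE eqxx orbT.
have inK y y' : [set x; x']%SET = [set y; y']%SET ->
    [set y; y']%SET \in [:: [set u; v]%SET; [set u; w]%SET; [set w; v]%SET] -> False.
  move=> <-; rewrite !inE => h; apply: nc2; case: icx => cx _.
  by case/or3P: h => /eqP h; rewrite h in cx; [left|right; left|right; right].
have [xs|xs] := boolP (x \in [:: u; v; w]); last first.
  by exists x; move: xs; rewrite !inE !negb_or => /and3P[/eqP ? /eqP ? /eqP ?]; split.
have [xs'|xs'] := boolP (x' \in [:: u; v; w]); last first.
  by exists x'; move: xs'; rewrite !inE !negb_or => /and3P[/eqP ? /eqP ? /eqP ?]; split.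
exfalso; have nx := adj_neq xx; apply: (inK x x' erefl).
move: xs xs' nx; rewrite !inE => /or3P[] /eqP-> /or3P[] /eqP-> // _; rewrite ?eqxx ?orbT //.
- by rewrite [[set v; u]%SET]finset.setUC eqxx.
- by rewrite [[set v; w]%SET]finset.setUC eqxx ?orbT.
- by rewrite [[set w; u]%SET]finset.setUC eqxx ?orbT.
Qed.

End PlaneGraph.

Lemma touches_conn (R : realType) (K : set (plane R)) p c : closed K -> ~ K c -> touches K p c -> conn K p c.
Proof.
move=> cK Kc tc; have [r r0 H] := closed_ball_miss cK Kc; have [q bq pq] := tc r r0.
by apply: conn_trans pq _; apply: conn_ball bq (ballxx _ r0) H.
Qed.

(** * Arcs with common ends *)

Section Bundle.
Variable R : realType.
Notation pl := (plane R).
Local Notation arc := (arc R).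
Variables (I : finType) (x z : pl) (B : I -> set pl) (m : I -> pl).
Implicit Types (i j k : I) (p q c : pl).
Hypothesis aB : forall i, arc (B i) x z.
Hypothesis BB : forall i j c, i != j -> B i c -> B j c -> c = x \/ c = z.
Hypothesis mB : forall i, B i (m i).
Hypothesis mx : forall i, m i <> x.
Hypothesis mz : forall i, m i <> z.

Definition bundle : set pl := [set c | exists2 i, True & B i c].
Definition bundle_but i : set pl := [set c | exists2 j, j != i & B j c].
(** The side of [p] contains none of the other arcs. It is enough to speak of markers, since an arc
    without its ends lies on one side of the cycle. *)
Definition empty_side i j p := ~ (B i `|` B j) p /\
  forall k, k != i -> k != j -> ~ conn (B i `|` B j) p (m k).

Lemma cycle_closed i j : closed (B i `|` B j).
Proof. by apply: closedU2; exact: arc_compact (aB _). Qed.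

Lemma bundle_but_compact i : compact (bundle_but i).
Proof. by apply: compact_finite_union => j _; exact: arc_compact (aB j). Qed.

Lemma bundleE i : bundle = bundle_but i `|` B i.
Proof.
apply/seteqP; split=> c.
  move=> [j _ Bj]; have [ji|ji] := eqVneq j i; first by right; rewrite -ji.
  by left; exists j.
by move=> [[j _ Bj]|Bi]; [exists j|exists i].
Qed.

Lemma cycle_bundle i j : B i `|` B j `<=` bundle.
Proof. by move=> c [h|h]; [exists i|exists j]. Qed.

Lemma marker_off i j k : k != i -> k != j -> ~ (B i `|` B j) (m k).
Proof.
by move=> ki kj [h|h]; [have := BB ki (mB k) h|have := BB kj (mB k) h];
  case; [exact: mx|exact: mz|exact: mx|exact: mz].
Qed.

Lemma ends i : B i x /\ B i z.
Proof. by split; [exact: arcl (aB i)|exact: arcr (aB i)]. Qed.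

Lemma conn_marker i j k c : B k c -> ~ (B i `|` B j) c -> conn (B i `|` B j) c (m k).
Proof.
move=> kc nc; have [Bix Biz] := ends i.
have cx : c <> x by move=> E; apply: nc; left; rewrite E.
have cz : c <> z by move=> E; apply: nc; left; rewrite E.
have ki : k != i by apply/eqP => E; apply: nc; left; rewrite -E.
have kj : k != j by apply/eqP => E; apply: nc; right; rewrite -E.
apply: (arc_conn (aB k)) => // d kd ijd.
have [->|->] : d = x \/ d = z by case: ijd; [exact: BB ki kd|exact: BB kj kd].
  by left; split=> //; split=> //; exact: mx.
by right; split=> //; split=> //; exact: mz.
Qed.

(** An empty side of a cycle is thus a whole face of the bundle. *)
Lemma empty_side_bundle i j p q : empty_side i j p -> conn (B i `|` B j) p q -> conn bundle p q.
Proof.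
move=> [np emp] [C [Cp CK cC] Cq]; apply: (connI cC Cp Cq) => c Cc [k _ kc].
have nc := CK c Cc.
have ki : k != i by apply/eqP => E; apply: nc; left; rewrite -E.
have kj : k != j by apply/eqP => E; apply: nc; right; rewrite -E.
by apply: (emp k ki kj); apply: conn_trans (conn_marker kc nc); apply: (connI cC Cp Cc).
Qed.

Lemma cycle_frontier i j p c : i != j -> ~ (B i `|` B j) p -> (B i `|` B j) c -> touches (B i `|` B j) p c.
Proof. by move=> ij; apply: jordan_frontier (aB i) (aB j) _ => d; exact: BB. Qed.

Lemma empty_side_touches i j p c : i != j -> empty_side i j p -> (B i `|` B j) c -> touches bundle p c.
Proof.
move=> ij es ijc; apply: touches_sub (cycle_frontier ij es.1 ijc) => q.
exact: empty_side_bundle.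
Qed.

(** The common face touches the marker of [i']; for a third arc this marker would lie on the empty
    side of [i] and [j]. *)
Lemma same_side i j p i' j' p' : i != j -> i' != j' -> empty_side i j p -> empty_side i' j' p' ->
  conn bundle p p' -> i' = i \/ i' = j.
Proof.
move=> ij ij' es es' pp'; apply: contrapT => /not_orP[/eqP ii /eqP jj].
apply: (es.2 i') => //; apply: touches_conn (@cycle_closed i j) (marker_off ii jj) _.
apply: (@touches_sub _ bundle _ p') (empty_side_touches ij' es' (or_introl (mB i'))) => q p'q.
by apply: (conn_sub (@cycle_bundle i j)); exact: conn_trans p'q.
Qed.

Lemma empty_sideC i j p : empty_side i j p -> empty_side j i p.
Proof. by move=> [np es]; split=> [|k kj ki]; rewrite setUC //; exact: es. Qed.

Lemma same_pair i j p i' j' p' : i != j -> i' != j' -> empty_side i j p -> empty_side i' j' p' ->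
  conn bundle p p' -> (i' = i \/ i' = j) /\ (j' = i \/ j' = j).
Proof.
move=> ij ij' es es' pp'; split; first exact: (same_side ij ij' es es').
by apply: (@same_side i j p j' i' p') => //; [rewrite eq_sym|exact: empty_sideC].
Qed.

(** By induction on the number of markers on the side of [p]. If arc [k] runs there, the side of [i]
    and [k] without the marker of [j] is contained in the old side and has lost the marker of
    [k]. *)
Lemma wedge i j p : i != j -> ~ (B i `|` B j) p -> exists j' p',
  [/\ i != j', empty_side i j' p', forall q, conn (B i `|` B j') p' q -> conn (B i `|` B j) p q &
      j' = j \/ conn (B i `|` B j) p (m j')].
Proof.
have [n] := ubnP #|[set k | `[< conn (B i `|` B j) p (m k) >]]%SET|.
elim: n j p => // n IH j p cn ij np.
have [[k [ki kj pk]]|none] := pselect (exists k, [/\ k != i, k != j & conn (B i `|` B j) p (m k)]); last first.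
  exists j, p; split=> //; [split=> // k ki kj pk|by left]; by apply: none; exists k.
have ik : i != k by rewrite eq_sym.
have mj : ~ (B i `|` B k) (m j) by apply: marker_off; rewrite eq_sym.
have [p' np' jp'] := jordan_separation (aB i) (aB k) (fun d => @BB i k d ik) mj.
have [q' bq' [p'q' pq']] : exists2 q', ball (m k) 1 q' & conn (B i `|` B k) p' q' /\ conn (B i `|` B j) p q'.
  have [r r0 Hr] := conn_open (@cycle_closed i j) pk.
  have mr : 0 < Num.min r 1 by rewrite lt_min r0 ltr01.
  have [q' bq p'q] := cycle_frontier ik np' (or_intror (mB k)) mr.
  exists q'; first by apply: le_ball bq; rewrite ge_min lexx orbT.
  by split=> //; apply: Hr; apply: le_ball bq; rewrite ge_min lexx.
have sub q : conn (B i `|` B k) p' q -> conn (B i `|` B j) p q.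
  move=> p'q; apply: (conn_trans pq').
  have [C [Cq' CK cC] Cq] := conn_trans (conn_sym p'q') p'q.
  apply: (connI cC Cq' Cq) => c Cc [ic|jc]; first by apply: (CK c Cc); left.
  apply: jp'; apply: conn_trans (conn_sym (conn_marker jc (CK c Cc))) _.
  by apply: conn_trans (conn_sym p'q'); apply: (connI cC Cc Cq').
have [|j' [p'' [ij' es' sub' j'k]]] := IH k p' _ ik np'.
  rewrite ltnS in cn; apply: leq_trans cn; apply: proper_card; apply/properP; split.
    by apply/fintype.subsetP => l; rewrite !finset.in_set => /asboolP h; apply/asboolP; exact: (sub _ h).
  exists k; first by rewrite finset.in_set; apply/asboolP.
  rewrite finset.in_set; apply/asboolP => /conn_outr; apply; right; exact: mB.
exists j', p''; split=> //; first by move=> q /sub' /sub.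
by right; case: j'k => [->//|/sub].
Qed.

(** All three are faces of the bundle touching the inner point [m i] of one arc, where [two_sides]
    allows only two. *)
Lemma three_sides i j1 j2 j3 p1 p2 p3 : i != j1 -> i != j2 -> i != j3 ->
  empty_side i j1 p1 -> empty_side i j2 p2 -> empty_side i j3 p3 ->
  [\/ conn bundle p1 p2, conn bundle p2 p3 | conn bundle p1 p3].
Proof.
move=> ij1 ij2 ij3 es1 es2 es3; have bE := bundleE i.
have nb j p : empty_side i j p -> ~ bundle p.
  by move=> es; apply: conn_outl; apply: (empty_side_bundle es); exact: conn_refl es.1.
have tch j p : i != j -> empty_side i j p -> touches bundle p (m i).
  by move=> ij es; apply: (empty_side_touches ij es); left.
move: (nb _ _ es1) (nb _ _ es2) (nb _ _ es3) (tch _ _ ij1 es1) (tch _ _ ij2 es2) (tch _ _ ij3 es3).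
rewrite bE => *; apply: (two_sides (c := m i) (@bundle_but_compact i) (aB i)) => //.
by move=> c ic [k ki kc]; rewrite eq_sym in ki; exact: BB ki ic kc.
Qed.

(** The two empty sides come from the two sides of the cycle of [i] and [a]. The third arc [b]
    ensures that they do not both end at [a]. *)
Lemma two_wedges i a b : i != a -> i != b -> a != b -> exists a1 p1 a2 p2,
  [/\ i != a1, i != a2 & a1 != a2] /\
  [/\ empty_side i a1 p1, empty_side i a2 p2 & ~ conn bundle p1 p2].
Proof.
move=> ia ib ab; have nb : ~ (B i `|` B a) (m b) by apply: marker_off; rewrite eq_sym.
have [q nq bq] := jordan_separation (aB i) (aB a) (fun d => @BB i a d ia) nb.
have [a1 [p1 [ia1 es1 sub1 h1]]] := wedge ia nb.
have [a2 [p2 [ia2 es2 sub2 h2]]] := wedge ia nq.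
have bp1 : conn (B i `|` B a) (m b) p1 by apply: sub1; exact: conn_refl es1.1.
have qp2 : conn (B i `|` B a) q p2 by apply: sub2; exact: conn_refl es2.1.
have a1a : a1 != a.
  apply/eqP => E; rewrite E in es1; apply: (es1.2 b); rewrite ?[b == _]eq_sym //.
  exact: conn_sym.
exists a1, p1, a2, p2; split; split=> //.
  apply/eqP => E; case: h1 => [/eqP|h1]; first by rewrite (negbTE a1a).
  case: h2 => [h2|h2]; first by rewrite E h2 eqxx in a1a.
  by apply: bq; apply: conn_trans h1 _; rewrite E; exact: conn_sym.
move=> p12; apply: bq; apply: conn_trans bp1 _; apply: conn_trans (conn_sym qp2).
by apply: conn_sub p12; exact: cycle_bundle.
Qed.

(** The side of [i] and [k] away from [a1] contains an empty side at [i]. This is one of the two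
    given ones, hence ends at [a1] or [a2]; were both on the side of [a1], neither would be
    possible. *)
Lemma opposite_sides i a1 a2 p1 p2 k : i != a1 -> i != a2 -> k != i -> k != a1 -> k != a2 ->
  empty_side i a1 p1 -> empty_side i a2 p2 -> ~ conn bundle p1 p2 ->
  ~ conn (B i `|` B k) (m a1) (m a2).
Proof.
move=> ia1 ia2 ki ka1 ka2 es1 es2 n12 a12.
have ik : i != k by rewrite eq_sym.
have na1 : ~ (B i `|` B k) (m a1) by apply: marker_off; rewrite eq_sym.
have [p np a1p] := jordan_separation (aB i) (aB k) (fun d => @BB i k d ik) na1.
have [a3 [p3 [ia3 es3 _ h3]]] := wedge ik np.
have pair j pj : i != j -> k != j -> conn (B i `|` B k) (m a1) (m j) -> empty_side i j pj -> ~ conn bundle pj p3.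
  move=> ij kj a1j esj pj3; have [_ [E|E]] := same_pair ij ia3 esj es3 pj3.
    by move: ia3; rewrite E eqxx.
  case: h3 => h3; first by move: kj; rewrite -E h3 eqxx.
  by apply: a1p; apply: conn_trans a1j _; rewrite -E; exact: conn_sym.
case: (three_sides ia1 ia2 ia3 es1 es2 es3) => //; first exact: pair a12 es2.
exact: pair (conn_refl na1) es1.
Qed.

End Bundle.

(** * Common neighbours of adjacent vertices *)

Section Ear.
Variable R : realType.
Notation pl := (plane R).
Variable V : finType.
Variable G : plane_graph R V.
Implicit Types (u v w x y : V) (p q c z : pl).
Notation adj := (adj G).
Notation pt := (pg_pt G).
Notation ar u v := (pg_arc G [set u; v]%SET).
Notation path2 := (path2 G).

Lemma arC u v : ar u v = ar v u. Proof. by rewrite finset.setUC. Qed.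

Lemma edge_meet a b a' b' z : adj a b -> adj a' b' -> [set a; b]%SET != [set a'; b']%SET ->
  ar a b z -> ar a' b' z -> exists x, [/\ x \in [:: a; b], x \in [:: a'; b'] & z = pt x].
Proof.
move=> ab cd ne z1 z2; have [x [x1 x2 ->]] := pg_cross ab cd ne z1 z2.
by exists x; move: x1 x2; rewrite !inE.
Qed.

Lemma path2_path2 x w w' v z : adj x w -> adj w v -> adj x w' -> adj w' v -> w != w' -> x <> v ->
  path2 x w v z -> path2 x w' v z -> z = pt x \/ z = pt v.
Proof.
move=> xw wv xw' w'v ww xv; have [n1 n2] := (adj_neq xw, adj_neq wv); have [n3 n4] := (adj_neq xw', adj_neq w'v).
have ww' : w <> w' by apply/eqP.
have ne1 : [set x; w]%SET != [set x; w']%SET.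
  by rewrite [X in X != _]finset.setUC; apply: edge_neq; apply/andP; split; apply/eqP => // E; apply: n1.
have ne2 : [set x; w]%SET != [set w'; v]%SET by apply: edge_neq; apply/andP; split; apply/eqP.
have ne3 : [set w; v]%SET != [set x; w']%SET.
  by apply: edge_neq; apply/andP; split; apply/eqP => // E; apply: n1.
have ne4 : [set w; v]%SET != [set w'; v]%SET by apply: edge_neq; apply/andP; split; apply/eqP.
have fin a : (a = x \/ a = w) \/ (a = w \/ a = v) -> (a = x \/ a = w') \/ (a = w' \/ a = v) ->
    pt a = pt x \/ pt a = pt v.
  by case=> -[] E; case=> -[] E'; first [left; congruence|right; congruence].
have in2 (a b b' : V) : a \in [:: b; b'] -> a = b \/ a = b'.
  by rewrite !inE => /orP[] /eqP; [left|right].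
move=> [h|h] [h'|h'].
- by have [a [/in2 a1 /in2 a2 ->]] := edge_meet xw xw' ne1 h h'; apply: fin; left.
- by have [a [/in2 a1 /in2 a2 ->]] := edge_meet xw w'v ne2 h h'; apply: fin; [left|right].
- by have [a [/in2 a1 /in2 a2 ->]] := edge_meet wv xw' ne3 h h'; apply: fin; [right|left].
- by have [a [/in2 a1 /in2 a2 ->]] := edge_meet wv w'v ne4 h h'; apply: fin; right.
Qed.

Definition tri y v w : set pl := ar y v `|` path2 y w v.
Definition triangle y v w := [&& adj y v, adj y w & adj w v].

Lemma tri_pt y v w x : triangle y v w -> tri y v w (pt x) <-> x \in [:: y; v; w].
Proof.
move=> /and3P[yv yw wv]; rewrite /tri; split.
  move=> [/(edge_pt _ yv)|/(path2_pt _ yw wv)]; rewrite !inE; first by case/orP => ->; rewrite ?orbT.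
  by case/or3P => ->; rewrite ?orbT.
rewrite !inE => /or3P[] h; [left; apply/(edge_pt _ yv)|left; apply/(edge_pt _ yv)|
  right; apply/(path2_pt _ yw wv)]; by rewrite !inE h ?orbT.
Qed.

Lemma triE y v w z : tri y v w z <-> [\/ ar y v z, ar y w z | ar w v z].
Proof.
split; first by move=> [h|[h|h]]; [constructor 1|constructor 2|constructor 3].
by move=> [h|h|h]; [left|right; left|right; right].
Qed.

Lemma tri_edge y v w a b d : triangle y v w -> adj a b -> b \notin [:: y; v; w] ->
  ar a b d -> tri y v w d -> d = pt a.
Proof.
move=> /and3P[yv yw wv] ab; rewrite !inE !negb_or => /and3P[/eqP by_ /eqP bv /eqP bw] abd.
have ne a' e : b <> a' -> b <> e -> [set a; b]%SET != [set a'; e]%SET.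
  by move=> bc be; rewrite finset.setUC; apply: edge_neq; apply/andP; split; apply/eqP.
have fin a' e : adj a' e -> b <> a' -> b <> e -> ar a' e d -> d = pt a.
  move=> ce bc be ced; have [x [x1 x2 ->]] := edge_meet ab ce (ne _ _ bc be) abd ced.
  by move: x1 x2; rewrite !inE => /orP[] /eqP-> // /orP[] /eqP.
by move=> /triE[]; apply: fin.
Qed.

Lemma half_edge y v w a b z : triangle y v w -> adj a b -> b \notin [:: y; v; w] ->
  ar a b z -> z <> pt a -> conn (tri y v w) z (pt b).
Proof.
move=> T ab nb abz za; apply: (arc_conn (adj_arc ab)) => //; first exact: arcr (adj_arc ab).
move=> e abe Te; left; split; first exact: (tri_edge T ab nb).
by split=> //; apply: pt_neq => ba; exact: (adj_neq ab).
Qed.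

Lemma edge_off_tri y v w a b : triangle y v w -> adj a b -> a \notin [:: y; v; w] ->
  b \notin [:: y; v; w] -> conn (tri y v w) (pt a) (pt b).
Proof.
move=> T ab na nb; have aE := adj_arc ab.
apply: (arc_conn aE); [exact: arcl aE|exact: arcr aE|] => e abe Te.
by have := tri_edge T ab nb abe Te => ea; case/negP: na; apply/(tri_pt _ T); rewrite -ea.
Qed.

(** Otherwise each triangle has a side without the other two apexes. In the bundle of the edge
    ([None]) and the three paths ([Some n]) these are three different faces along the edge, contrary
    to [three_sides]. *)
Lemma book y v (ws : 'I_3 -> V) : injective ws -> adj y v -> (forall n, adj y (ws n) && adj (ws n) v) ->
  exists n a b, [/\ a != n, b != n & ~ conn (tri y v (ws n)) (pt (ws a)) (pt (ws b))].
Proof.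
move=> iw yv aw; apply: contrapT => none.
have yv' := adj_neq yv.
have sep n a b : a != n -> b != n -> conn (tri y v (ws n)) (pt (ws a)) (pt (ws b)).
  by move=> an bn; apply: contrapT => h; apply: none; exists n, a, b.
have [c ic] := inner_exists yv; have [yvc [cy cv]] := (innerE _ yv).1 ic.
pose B (k : option 'I_3) := if k is Some n then path2 y (ws n) v else ar y v.
pose m (k : option 'I_3) : pl := if k is Some n then pt (ws n) else c.
have aB k : arc R (B k) (pt y) (pt v).
  case: k => [n|]; last exact: adj_arc.
  by have /andP[h1 h2] := aw n; exact: path2_arc.
have BB i j d : i != j -> B i d -> B j d -> d = pt y \/ d = pt v.
  case: i j => [i|] [j|] ij //= h h'.
  - have /andP[a1 a2] := aw i; have /andP[a3 a4] := aw j.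
    apply: (path2_path2 a1 a2 a3 a4 _ yv' h h').
    by apply: contra ij => /eqP/iw ->.
  - by have /andP[h1 h2] := aw i; exact: edge_path2 h' h.
  - by have /andP[h1 h2] := aw j; exact: edge_path2 h h'.
have mB k : B k (m k).
  case: k => [n|] //=; have /andP[h1 h2] := aw n.
  by apply/(path2_pt _ h1 h2); rewrite !inE eqxx orbT.
have mx k : m k <> pt y.
  by case: k => [n|] //=; have /andP[h1 h2] := aw n; apply: pt_neq => E; exact: (adj_neq h1).
have mz k : m k <> pt v.
  by case: k => [n|] //=; have /andP[h1 h2] := aw n; apply: pt_neq => E; exact: (adj_neq h2).
have other (n : 'I_3) : exists a, a != n.
  by case: (eqVneq n 0) => [->|n0]; [exists 1|exists 0; rewrite eq_sym].
have ex n : exists p, empty_side B m None (Some n) p.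
  have [a an] := other n; have na : Some a != Some n by apply: contra an => /eqP[->].
  have nm := marker_off BB mB mx mz (isT : Some a != None) na.
  have [p np ap] := jordan_separation (aB None) (aB (Some n)) (fun d => @BB None (Some n) d isT) nm.
  exists p; split=> // -[b|] // _ bn pb; apply: ap; apply: conn_trans (conn_sym pb).
  by apply: sep => //; apply: contra bn => /eqP->.
have [p Hp] := choice ex.
have es n : empty_side B m None (Some n) (p n) := Hp n.
have nconn n l : n != l -> ~ conn (bundle B) (p n) (p l).
  move=> nl pnl.
  have [_ [//|[E]]] := same_pair aB BB mB mx mz (isT : None != Some n) (isT : None != Some l) (es n) (es l) pnl.
  by rewrite E eqxx in nl.
have [] := three_sides aB BB mB mx mz (isT : None != Some 0) (isT : None != Some 1) (isT : None != Some 2%:R)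
  (es 0) (es 1) (es 2%:R); exact: nconn.
Qed.

Definition cn u v := [set w | adj u w && adj w v]%SET.

Lemma three_common u v : (2 < #|cn u v|)%N -> exists ws : 'I_3 -> V, injective ws /\
  forall n, adj u (ws n) && adj (ws n) v.
Proof.
move=> c3; have s3 : (2 < size (enum (cn u v)))%N by rewrite -cardE.
exists (fun n => nth u (enum (cn u v)) n); split.
  move=> n l /eqP; rewrite nth_uniq ?enum_uniq //; last by apply: leq_trans s3; exact: ltn_ord.
    by move=> /eqP/val_inj.
  by apply: leq_trans s3; exact: ltn_ord.
move=> n; have : nth u (enum (cn u v)) n \in cn u v.
  by rewrite -mem_enum mem_nth //; apply: leq_trans s3; exact: ltn_ord.
by rewrite finset.in_set.
Qed.

(** A descent on the number of neighbours of [y] on the side of [u]. A triangle on the edge [y u]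
    given by [book] has a side that contains a neighbour of [y] and lies inside the old side; it no
    longer contains [u]. *)
Lemma ear_step y : (forall v, adj y v -> (2 < #|cn y v|)%N) -> forall n u v w, triangle y v w ->
  adj y u -> u \notin [:: y; v; w] ->
  (#|[set x | adj y x && `[< conn (tri y v w) (pt u) (pt x) >]]%SET| < n)%N -> False.
Proof.
move=> H; elim=> // n IH u v w T yu nu cn'.
have [ws [iw aw]] := three_common (H u yu).
have [k [a [b [ak bk nab]]]] := book iw yu aw.
have /and3P[yv yw wv] := T.
pose T' := tri y u (ws k).
have /andP[yk ku] := aw k.
have tT' : triangle y u (ws k) by apply/and3P.
move: nu; rewrite !inE !negb_or => /and3P[uy uv uw].
have yv' : v != y by apply/eqP => E; apply: (adj_neq yv).
have yw' : w != y by apply/eqP => E; apply: (adj_neq yw).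
have vw' : v != w by apply/eqP => E; apply: (adj_neq wv).
have [vu' wu'] : v != u /\ w != u by rewrite ![_ == u]eq_sym.
have inT' x : x != y -> x != u -> x \in [:: y; u; ws k] -> x = ws k.
  by rewrite !inE => /negbTE-> /negbTE-> /eqP.
(* The vertices [v] and [w] are adjacent: if both are off [T'] they are on the same side of it, and
   otherwise at most one of them is on a side at all. So of two separated apexes one has neither [v]
   nor [w] on its side. *)
have [s [sk sv sw]] : exists s, [/\ s != k, ~ conn T' (pt (ws s)) (pt v) & ~ conn T' (pt (ws s)) (pt w)].
  apply: contrapT => none.
  have cvw s : s != k -> conn T' (pt (ws s)) (pt v) \/ conn T' (pt (ws s)) (pt w).
    move=> sk; apply: contrapT => /not_orP[h1 h2]; apply: none; by exists s.
  have [vT|vT] := boolP (v \in [:: y; u; ws k]).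
    have nv q : ~ conn T' q (pt v) by move=> /conn_outr; apply; apply/(tri_pt _ tT').
    have [/nv //|aw'] := cvw a ak; have [/nv //|bw'] := cvw b bk.
    by apply: nab; exact: conn_trans (conn_sym bw').
  have [wT|wT] := boolP (w \in [:: y; u; ws k]).
    have nw q : ~ conn T' q (pt w) by move=> /conn_outr; apply; apply/(tri_pt _ tT').
    have [av'|/nw //] := cvw a ak; have [bv'|/nw //] := cvw b bk.
    by apply: nab; exact: conn_trans (conn_sym bv').
  have vw := edge_off_tri tT' wv wT vT.
  have to s : s != k -> conn T' (pt (ws s)) (pt v).
    by move=> sk; have [//|sw'] := cvw s sk; exact: conn_trans vw.
  by apply: nab; apply: conn_trans (to a ak) (conn_sym (to b bk)).
(* A point of the old triangle off [T'] can be moved along its edge to [v] or [w], off [T']; so the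
   old triangle does not enter the side of [ws s]. *)
have offT q : conn T' (pt (ws s)) q -> ~ tri y v w q.
  move=> sq; have nT'q := conn_outr sq.
  have T'y : T' (pt y) by apply/(tri_pt _ tT'); rewrite !inE eqxx.
  have along a' b' : adj a' b' -> ar a' b' q -> b' \notin [:: y; u; ws k] -> q <> pt a' ->
      conn T' (pt (ws s)) (pt b').
    by move=> ab' qab nb' qa'; apply: conn_trans sq _; exact: (half_edge tT' ab' nb' qab qa').
  have qy : q <> pt y by move=> E; apply: nT'q; rewrite E.
  move=> /triE[qyv|qyw|qwv].
  - have [vT|vT] := boolP (v \in [:: y; u; ws k]); last by apply: sv; exact: along qyv vT qy.
    by apply: nT'q; apply/triE; constructor 2; rewrite -(inT' v yv' vu' vT).
  - have [wT|wT] := boolP (w \in [:: y; u; ws k]); last by apply: sw; exact: along qyw wT qy.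
    by apply: nT'q; apply/triE; constructor 2; rewrite -(inT' w yw' wu' wT).
  - have [vT|vT] := boolP (v \in [:: y; u; ws k]); last first.
      apply: sv; apply: along qwv vT _ => // qw; apply: sw; by rewrite -qw.
    have [wT|wT] := boolP (w \in [:: y; u; ws k]).
      by case/eqP: vw'; rewrite (inT' v yv' vu' vT) -(inT' w yw' wu' wT).
    apply: sw; rewrite arC in qwv; apply: along qwv wT _; first by rewrite adjC.
    by move=> qv; apply: nT'q; rewrite qv; apply/(tri_pt _ tT').
have /andP[ys su] := aw s.
have nsT' : ws s \notin [:: y; u; ws k].
  rewrite !inE !negb_or (inj_eq iw) sk andbT; apply/andP; split; apply/eqP => E.
    exact: (adj_neq ys).
  exact: (adj_neq su).
have ss : conn T' (pt (ws s)) (pt (ws s)).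
  by apply: conn_refl; apply: (contra_not _ (negP nsT')) => /(tri_pt _ tT').
have sT : ws s \notin [:: y; v; w] by apply/negP => /(tri_pt _ T); exact: offT ss.
have uT : u \notin [:: y; v; w] by rewrite !inE !negb_or uy uv.
have us : conn (tri y v w) (pt u) (pt (ws s)) by apply: edge_off_tri => //; rewrite adjC.
have sub q : conn T' (pt (ws s)) q -> conn (tri y v w) (pt u) q.
  move=> [C [Cs CK cC] Cq]; apply: conn_trans us _; apply: (connI cC Cs Cq) => z Cz.
  by apply: offT; exact: connI cC Cs Cz CK.
apply: (IH (ws s) u (ws k) tT' ys nsT'); rewrite ltnS in cn'; apply: leq_trans cn'.
apply: proper_card; apply/properP; split.
  apply/fintype.subsetP => x; rewrite !finset.in_set => /andP[-> /asboolP h]; apply/asboolP; exact: sub.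
exists u; first by rewrite finset.in_set yu; apply/asboolP; apply: conn_refl => /(tri_pt _ T); exact/negP.
rewrite finset.in_set yu; apply/asboolP => /conn_outr; apply; apply/(tri_pt _ tT').
by rewrite !inE eqxx orbT.
Qed.

Hypothesis maxG : maximal_graph G.

(* The neighbours of [y] inside a smallest nonempty side of a triangle at [y]
   have no third common neighbour with [y]. *)
Lemma exists_ear y : (3 < #|V|)%N -> exists v, adj y v /\ (#|cn y v| <= 2)%N.
Proof.
move=> V4; apply: contrapT => none.
have H v : adj y v -> (2 < #|cn y v|)%N.
  by move=> yv; rewrite ltnNge; apply/negP => h; apply: none; exists v.
have [v yv] := has_neighbour maxG y (leq_trans (isT : 1 < 4)%N V4).
have [ws [iw aw]] := three_common (H v yv).
have /andP[y0 a0] := aw 0; have /andP[y1 a1] := aw 1.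
apply: (@ear_step y H _ (ws 1) v (ws 0) _ y1 _ (ltnSn _)); first by apply/and3P.
rewrite !inE !negb_or (inj_eq iw) andbT; apply/andP; split; apply/eqP => E.
  exact: (adj_neq y1).
exact: (adj_neq a1).
Qed.

Lemma common_ge2 u v : (3 < #|V|)%N -> adj u v -> (1 < #|cn u v|)%N.
Proof.
move=> V4 uv; have [w [w' [ww uw wv uw' w'v]]] := edge_two_common maxG V4 uv.
apply: (@leq_trans #|[set w; w']%SET|); first by rewrite cards2 ww.
apply: subset_leq_card; apply/fintype.subsetP => x; rewrite !inE.
by case/orP => /eqP ->; rewrite ?uw ?wv ?uw' ?w'v.
Qed.

End Ear.

(** * Common neighbours of the ends of a brace *)

Section Suspension.
Variable R : realType.
Notation pl := (plane R).
Variable V : finType.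
Variable G : plane_graph R V.
Implicit Types (u v w y : V) (p q c : pl).
Notation adj := (adj G).
Notation pt := (pg_pt G).
Notation ar u v := (pg_arc G [set u; v]%SET).
Notation path2 := (path2 G).

Lemma path2_edge x k z a b c : adj x k -> adj k z -> adj a b -> a \notin [:: x; k; z] ->
  ar a b c -> path2 x k z c -> c = pt b /\ b \in [:: x; k; z].
Proof.
move=> xk kz ab; rewrite !inE !negb_or => /and3P[ax ak az] abc.
move=> [h|h].
  have [] := edge_meet ab xk _ abc h; first by apply: edge_neq; rewrite ax.
  move=> d [d1 d2 ->]; move: d1 d2; rewrite !inE => /orP[] /eqP->.
    by rewrite (negbTE ax) (negbTE ak).
  by case/orP => ->; rewrite ?orbT.
have [] := edge_meet ab kz _ abc h; first by apply: edge_neq; rewrite ak.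
move=> d [d1 d2 ->]; move: d1 d2; rewrite !inE => /orP[] /eqP->.
  by rewrite (negbTE ak) (negbTE az).
by case/orP => ->; rewrite ?orbT.
Qed.

Lemma edge_off_cycle x k l z a b : adj x k -> adj k z -> adj x l -> adj l z -> adj a b ->
  a \notin [:: x; k; l; z] -> b \notin [:: x; k; l; z] ->
  conn (path2 x k z `|` path2 x l z) (pt a) (pt b).
Proof.
move=> xk kz xl lz ab; rewrite !inE !negb_or => /and4P[ax ak al az] /and4P[bx bk bl bz].
have aE := adj_arc ab; apply: (arc_conn aE); [exact: arcl aE|exact: arcr aE|] => e abe [h|h].
  have [|_] := path2_edge xk kz ab _ abe h; first by rewrite !inE !negb_or ax ak.
  by rewrite !inE (negbTE bx) (negbTE bk) (negbTE bz).
have [|_] := path2_edge xl lz ab _ abe h; first by rewrite !inE !negb_or ax al.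
by rewrite !inE (negbTE bx) (negbTE bl) (negbTE bz).
Qed.

Variables (W : {set V}) (x z : V).
Hypothesis maxG : maximal_graph G.
Hypothesis V4 : (3 < #|V|)%N.
Hypothesis HBr : forall u, u \notin W -> exists x' z',
  [/\ x' \in W, z' \in W, x' != z' & adj x' u /\ adj u z'].
Hypothesis HW : forall u a, u \notin W -> a \notin W -> adj u a -> #|cn G u a| <> 2%N.
Hypothesis xW : x \in W.
Hypothesis zW : z \in W.
Hypothesis xz : x != z.
Hypothesis nxz : ~~ adj x z.

Definition poles := [set y | [&& y \notin W, adj x y & adj y z]]%SET.

Let I := {y | y \in poles}.
Let B (i : I) := path2 x (val i) z.
Let m (i : I) := pt (val i).

Let poleP (i : I) : [/\ val i \notin W, adj x (val i) & adj (val i) z].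
Proof. by have := valP i; rewrite finset.in_set => /and3P[]. Qed.

Let aB i : arc R (B i) (pt x) (pt z).
Proof. by have [_ h1 h2] := poleP i; apply: path2_arc => //; exact/eqP. Qed.

Let BB (i j : I) c : i != j -> B i c -> B j c -> c = pt x \/ c = pt z.
Proof.
move=> ij; have [_ h1 h2] := poleP i; have [_ h3 h4] := poleP j.
by apply: path2_path2 => //; exact/eqP.
Qed.

Let mB (i : I) : B i (m i).
Proof. by have [_ h1 h2] := poleP i; apply/(path2_pt _ h1 h2); rewrite !inE eqxx orbT. Qed.

Let nW (i : I) w : w \in W -> val i != w.
Proof. by move=> wW; have [h _ _] := poleP i; apply: contraNneq h => ->. Qed.

Let mx (i : I) : m i <> pt x. Proof. by apply: pt_neq; apply/eqP; exact: nW. Qed.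
Let mz (i : I) : m i <> pt z. Proof. by apply: pt_neq; apply/eqP; exact: nW. Qed.

Let on_cycle (i j : I) u : (B i `|` B j) (pt u) <-> u \in [:: x; val i; val j; z].
Proof.
have [_ h1 h2] := poleP i; have [_ h3 h4] := poleP j; split.
  move=> [/(path2_pt _ h1 h2)|/(path2_pt _ h3 h4)]; rewrite !inE => /or3P[] ->; by rewrite ?orbT.
rewrite !inE => /or4P[] /eqP->; [left|left|right|left];
  first [apply/(path2_pt _ h1 h2); by rewrite !inE eqxx ?orbT|apply/(path2_pt _ h3 h4); by rewrite !inE eqxx ?orbT].
Qed.

Let edge_conn (i j : I) u v : adj u v -> u \notin [:: x; val i; val j; z] ->
  v \notin [:: x; val i; val j; z] -> conn (B i `|` B j) (pt u) (pt v).
Proof.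
by have [_ h1 h2] := poleP i; have [_ h3 h4] := poleP j; exact: edge_off_cycle.
Qed.

(** A vertex [u] outside [W] on this side can have only [x] and [z] as neighbours in [W]. It is then
    a pole itself, whose marker contradicts emptiness. *)
Let empty_no_vertex (i j : I) p : i != j -> empty_side B m i j p ->
  (forall w, w \in W -> w != x -> w != z -> ~ conn (B i `|` B j) p (pt w)) ->
  forall u, ~ conn (B i `|` B j) p (pt u).
Proof.
move=> ij es noW u pu; have nu : u \notin [:: x; val i; val j; z].
  by apply/negP => /on_cycle; exact: conn_outr pu.
have := nu; rewrite !inE !negb_or => /and4P[ux ui uj uz].
have [uW|uW] := boolP (u \in W); first exact: (noW u).
have [x' [z' [x'W z'W xz' [xu uz']]]] := HBr uW.
have inxz v : v \in W -> adj u v -> v = x \/ v = z.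
  move=> vW uv; have [->|vx] := eqVneq v x; first by left.
  have [->|vz] := eqVneq v z; [by right|exfalso].
  apply: (noW v vW vx vz); apply: conn_trans pu _; apply: edge_conn => //.
  by rewrite !inE !negb_or vx vz ![v == _]eq_sym !(nW _ vW).
have [a1 a2] : adj x u /\ adj u z.
  have := inxz x' x'W; have := inxz z' z'W; rewrite [adj u x']adjC => h1 h2.
  case: (h2 xu) (h1 uz') => e1 [] e2; rewrite e1 e2 in xz' xu uz'; rewrite ?eqxx // in xz'.
  by rewrite adjC uz' adjC.
have up : u \in poles by rewrite finset.in_set uW a1.
apply: (es.2 (exist _ u up)) => //; by apply/eqP => E; [move: ui|move: uj]; rewrite -E eqxx.
Qed.

(** Such an edge meets the bundle at most in its ends, so all its inner points lie in one face,
    including those close to the pole. *)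
Let edge_bundle (i : I) u c : adj (val i) u -> u != x -> u != z -> inner G [set val i; u]%SET c ->
  ~ bundle B c /\ touches (bundle B) c (m i).
Proof.
move=> iu ux uz ic; have [ec [ci cu]] := (innerE _ iu).1 ic.
have meets d : ar (val i) u d -> bundle B d -> d = pt (val i) \/ d = pt u.
  move=> ed [k _ kd]; have [_ h1 h2] := poleP k.
  have [ki|ki] := eqVneq k i; last first.
    have [|-> _] := path2_edge h1 h2 iu _ ed kd; last by right.
    by rewrite !inE !negb_or (nW _ xW) (nW _ zW) andbT /= (inj_eq val_inj) eq_sym.
  have [| | |-> _] := path2_edge h1 h2 (a := u) (b := val i) _ _ _ kd; last by left.
  - by rewrite adjC.
  - rewrite !inE !negb_or ux uz andbT /= ki; apply/eqP => E; exact: (adj_neq iu).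
  - by rewrite arC.
have nc : ~ bundle B c by move=> /(meets c ec) [].
split=> // r r0; have [g [cg ig g0 g1 gA]] := arcW (adj_arc iu).
have /nbhs_ballP[d /= d0 Hd] : nbhs (0 : R) (g @^-1` (ball (g 0) r)) by apply: cg; exact: nbhsx_ballx.
pose t : R := Num.min (d / 2) (1 / 2).
have [t0 td t1] : [/\ 0 < t, t < d & t <= 1 / 2].
  by rewrite /t; case: (leP (d / 2) (1 / 2)) => *; split; lra.
have [g0t gt1] : g t <> pt (val i) /\ g t <> pt u.
  rewrite -g0 -g1; split=> /ig E.
    have : t = 0 by apply: E; lra.
    lraF.
  have : t = 1 by apply: E; lra.
  lraF.
have At : ar (val i) u (g t) by apply/gA; exists t => //; lra.
exists (g t); first by rewrite /m -g0; apply: Hd; rewrite /ball /=; apply/ltr_normlP; split; lra.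
apply: (arc_conn (adj_arc iu) ec At) => e ee be.
by case: (meets e ee be) => ->; [left|right].
Qed.

(** The face containing the inner points of the edge touches the pole, hence is one of the two empty
    sides. The other end [u] is not inside that side, so it lies on its cycle. *)
Let pole_neighbours (i a1 a2 : I) p1 p2 u : i != a1 -> i != a2 ->
  empty_side B m i a1 p1 -> empty_side B m i a2 p2 -> ~ conn (bundle B) p1 p2 ->
  (forall v, ~ conn (B i `|` B a1) p1 (pt v)) -> (forall v, ~ conn (B i `|` B a2) p2 (pt v)) ->
  adj (val i) u -> u != x -> u != z -> u = val a1 \/ u = val a2.
Proof.
move=> ia1 ia2 es1 es2 n12 no1 no2 iu ux uz.
have [c ic] := inner_exists iu; have [nc tc] := edge_bundle iu ux uz ic.
have [ec [ci cu]] := (innerE _ iu).1 ic.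
have side a p : i != a -> empty_side B m i a p -> (forall v, ~ conn (B i `|` B a) p (pt v)) ->
    conn (bundle B) p c -> u = val a.
  move=> ia es no pc; apply: contrapT => /eqP ua; apply: (no u).
  apply: conn_trans (conn_sub (cycle_bundle (B := B) (i := i) (j := a)) pc) _.
  have [_ h1 h2] := poleP i; have [_ h3 h4] := poleP a.
  have ui : u != val i by apply/eqP => E; apply: (adj_neq iu).
  apply: (arc_conn (adj_arc iu) ec (arcr (adj_arc iu))) => e ee [h|h].
    left; have [| | |-> _] := path2_edge h1 h2 (a := u) (b := val i) _ _ _ h.
    - by rewrite adjC.
    - by rewrite !inE !negb_or ux uz ui.
    - by rewrite arC.
    - by split=> //; split=> //; apply: pt_neq; exact/eqP.
  have [|_] := path2_edge h3 h4 iu _ ee h.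
    by rewrite !inE !negb_or (nW _ xW) (nW _ zW) andbT /= (inj_eq val_inj).
  by rewrite !inE (negbTE ux) (negbTE ua) (negbTE uz).
have bE := bundleE B i.
have nb a p : empty_side B m i a p -> ~ bundle B p.
  by move=> es; apply: conn_outl; apply: (empty_side_bundle aB BB mB mx mz es); exact: conn_refl es.1.
have tch a p : i != a -> empty_side B m i a p -> touches (bundle B) p (m i).
  by move=> ia es; apply: (empty_side_touches aB BB mB mx mz ia es); left.
have [] : [\/ conn (bundle B) p1 p2, conn (bundle B) p2 c | conn (bundle B) p1 c].
  move: (nb _ _ es1) (nb _ _ es2) nc (tch _ _ ia1 es1) (tch _ _ ia2 es2) tc.
  rewrite bE => *; apply: (two_sides (c := m i) (@bundle_but_compact _ _ _ _ _ aB i) (aB i)) => //.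
  by move=> d id [k ki kd]; rewrite eq_sym in ki; exact: BB ki id kd.
- by [].
- by move=> h; right; exact: side ia2 es2 no2 h.
- by move=> h; left; exact: side ia1 es1 no1 h.
Qed.

Let pole_witness (i : I) : (3 < #|poles|)%N -> exists w a p,
  [/\ w \in W :\: [set x; z]%SET, i != a, empty_side B m i a p & conn (B i `|` B a) p (pt w)].
Proof.
move=> p4; have cI : #|{: I}| = #|poles| by rewrite card_sig.
have pick (s : seq I) : (size s <= 3)%N -> exists k : I, k \notin s.
  by move=> s3; apply: out_of_set; rewrite cI; exact: leq_ltn_trans p4.
have [a] := pick [:: i] isT; rewrite !inE eq_sym => ia.
have [b] := pick [:: i; a] isT; rewrite !inE !negb_or ![b == _]eq_sym => /andP[ib ab].
have [a1 [p1 [a2 [p2 [[ia1 ia2 a12] [es1 es2 n12]]]]]] := two_wedges aB BB mB mx mz ia ib ab.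
apply: contrapT => none.
have noW j p : i != j -> empty_side B m i j p -> forall u, ~ conn (B i `|` B j) p (pt u).
  move=> ij es; apply: empty_no_vertex => // w wW wx wz pw; apply: none; exists w, j, p.
  by split=> //; rewrite !inE negb_or wx wz.
have no1 := noW a1 p1 ia1 es1; have no2 := noW a2 p2 ia2 es2.
have N u := pole_neighbours (u := u) ia1 ia2 es1 es2 n12 no1 no2.
(* The fourth pole: its path and that of [i] separate [a1] from [a2], which are therefore not
   adjacent. *)
have [k] := pick [:: i; a1; a2] isT; rewrite !inE !negb_or => /and3P[ki ka1 ka2].
have nW12 : ~~ adj (val a1) (val a2).
  apply/negP => a12'; apply: (opposite_sides aB BB mB mx mz ia1 ia2 ki ka1 ka2 es1 es2 n12).
  by apply: edge_conn => //; rewrite !inE !negb_or !(nW _ xW) !(nW _ zW) /= andbT !(inj_eq val_inj) ![_ == i]eq_sym ![_ == k]eq_sym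
    ?ia1 ?ia2 ?ka1 ?ka2.
have [iW xi iz] := poleP i; have [a1W xa1 a1z] := poleP a1; have [a2W xa2 a2z] := poleP a2.
(* The edge from [i] to [x] has at least two common neighbours. As [z] is not adjacent to [x], only
   [a1] and [a2] are available, and both must be adjacent to [i]. *)
have [i1 i2] : adj (val i) (val a1) /\ adj (val i) (val a2).
  have ix : adj (val i) x by rewrite adjC.
  have c2 := common_ge2 maxG V4 ix.
  have sub : cn G (val i) x \subset [set val a1; val a2]%SET.
    apply/fintype.subsetP => w; rewrite finset.in_set => /andP[iw wx].
    have wx' : w != x by apply/eqP; exact: adj_neq wx.
    have wz' : w != z by apply/eqP => E; move: nxz; rewrite adjC -E wx.
    by rewrite !inE; case: (N w iw wx' wz') => ->; rewrite eqxx ?orbT.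
  have E : cn G (val i) x = [set val a1; val a2]%SET.
    apply/eqP; rewrite eqEcard sub cards2; apply: leq_trans c2.
    by case: (_ != _).
  have h1 : val a1 \in cn G (val i) x by rewrite E !inE eqxx.
  have h2 : val a2 \in cn G (val i) x by rewrite E !inE eqxx orbT.
  by move: h1 h2; rewrite !finset.in_set => /andP[-> _] /andP[-> _].
apply: (HW iW a1W i1).
have -> : cn G (val i) (val a1) = [set x; z]%SET.
  apply/finset.setP => w; rewrite finset.in_set !inE; apply/andP/orP.
    move=> [iw wa1]; have [->|wx] := eqVneq w x; first by left.
    have [_|wz] := eqVneq w z; first by right.
    case: (N w iw wx wz) => E; first by case: (adj_neq wa1).
    by move: nW12; rewrite adjC -E wa1.
  move=> [] /eqP->; first by rewrite adjC.
  by rewrite [adj z _]adjC.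
by rewrite cards2 xz.
Qed.

(** Each pole is assigned an element of [W] in an empty side at it. The element determines the face
    and, by [same_pair], the two poles next to it, so no element is assigned three times. *)
Lemma card_poles : (3 < #|poles|)%N -> (#|poles| <= 2 * #|W :\: [set x; z]%SET|)%N.
Proof.
move=> p4; have [f Hf] := choice (fun i => pole_witness i p4).
have cI : #|{: I}| = #|poles| by rewrite card_sig.
set W' := (W :\: [set x; z])%SET in Hf *.
have fW i : f i \in W' by have [a [p []]] := Hf i.
rewrite -cI -[X in (X <= _)%N]sum1_card (partition_big f (fun w => w \in W')) //= mulnC -sum_nat_const.
apply: leq_sum => w wW; rewrite sum1_card leqNgt; apply/negP => c3.
have s3 : (2 < size (enum [pred i | f i == w]))%N by rewrite -cardE.
have := enum_uniq [pred i | f i == w].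
have inE' i : i \in enum [pred i | f i == w] -> f i = w by rewrite mem_enum inE => /eqP.
case: (enum _) s3 inE' => [|i1 [|i2 [|i3 s]]] // _ inE'.
rewrite /= !inE !negb_or => /andP[/and3P[i12 i13 _] /andP[/andP[i23 _] _]].
have [f1 f2 f3] : [/\ f i1 = w, f i2 = w & f i3 = w].
  by split; apply: inE'; rewrite !inE eqxx ?orbT.
have [a1 [p1 [_ ia1 es1 c1]]] := Hf i1; have [a2 [p2 [_ ia2 es2 c2]]] := Hf i2.
have [a3 [p3 [_ ia3 es3 c3']]] := Hf i3; rewrite f1 in c1; rewrite f2 in c2; rewrite f3 in c3'.
have to i a p : empty_side B m i a p -> conn (B i `|` B a) p (pt w) -> conn (bundle B) p (pt w).
  by move=> es; exact: (empty_side_bundle aB BB mB mx mz es).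
have c12 := conn_trans (to _ _ _ es1 c1) (conn_sym (to _ _ _ es2 c2)).
have c13 := conn_trans (to _ _ _ es1 c1) (conn_sym (to _ _ _ es3 c3')).
have [[E|E] _] := same_pair aB BB mB mx mz ia1 ia2 es1 es2 c12; first by rewrite E eqxx in i12.
have [[E'|E'] _] := same_pair aB BB mB mx mz ia1 ia3 es1 es3 c13; first by rewrite E' eqxx in i13.
by rewrite E E' eqxx in i23.
Qed.

End Suspension.

(** * Stereographic projection *)

Section Stereographic.
Variable R : realType.
Notation pl := (plane R).
Notation sp := 'rV[R]_3.
Implicit Types (p n : sp) (q : pl).

(** Clamping the parameter extends the map to the whole line. The values stay in [A] everywhere,
    which keeps them off the pole of the projection. *)
Lemma is_arc_loop (A : set sp) a b : is_arc A a b -> exists g : R -> sp,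
  [/\ continuous g, forall s t : R, 0 <= s <= 1 -> 0 <= t <= 1 -> g s = g t -> s = t,
     g 0 = a, g 1 = b & (forall t, A (g t)) /\ forall x, A x <-> exists2 t : R, 0 <= t <= 1 & g t = x].
Proof.
move=> [g [/subspace_continuousP cg /set_injP ig g0 g1 <-]].
have c01 t : 0 <= clamp t <= 1.
  by rewrite /clamp le_min ler01 le_max lexx ge_min lexx.
exists (g \o clamp (R := R)); split.
- move=> t; have ct : [set` `[0, 1]] (clamp t) by rewrite /= in_itv /=; exact: c01.
  apply: cvg_trans (cg _ ct) => U; rewrite /= !nbhs_simpl /= => Hw.
  have := @clamp_continuous R t _ Hw; rewrite !nbhs_simpl /=.
  apply: filterS => s /=; apply; rewrite in_itv /=; exact: c01.
- by move=> s t hs ht; rewrite /= !clamp_id //; exact: ig.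
- by rewrite /= clamp_id // lexx ler01.
- by rewrite /= clamp_id // lexx ler01.
split; first by move=> t; exists (clamp t) => //=; rewrite in_itv /=; exact: c01.
move=> x; split=> [[t]|[t ht <-]].
  by rewrite /= in_itv /= => ht <-; exists t; rewrite //= clamp_id.
by exists t; rewrite /= ?in_itv //= clamp_id.
Qed.

Lemma is_arcI (g : R -> sp) (A : set sp) : continuous g ->
  (forall s t : R, 0 <= s <= 1 -> 0 <= t <= 1 -> g s = g t -> s = t) ->
  (forall x, A x <-> exists2 t : R, 0 <= t <= 1 & g t = x) -> is_arc A (g 0) (g 1).
Proof.
move=> cg ig gA; exists g; split=> //; [exact: continuous_subspaceT|exact/set_injP|].
apply/seteqP; split=> x.
  by move=> [t]; rewrite /= in_itv /= => ht <-; apply/gA; exists t.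
by move/gA => [t ht <-]; exists t; rewrite //= in_itv.
Qed.

Lemma is_arc_sym (A : set sp) a b : is_arc A a b -> is_arc A b a.
Proof.
move/is_arc_loop => [g [cg ig g0 g1 [_ gA]]].
have := @is_arcI (fun t => g (1 + t * -1)) A; rewrite mul0r addr0 mul1r subrr g0 g1; apply.
- move=> t; apply: continuous_comp; [exact: aff_continuous|exact: cg].
- move=> s t hs ht /ig E; have : 1 + s * -1 = 1 + t * -1 by apply: E; lra.
  lra.
- by move=> x; rewrite gA; split=> -[t ht <-]; exists (1 + t * -1); [lra|congr g; lra|lra|by []].
Qed.

Definition vec3 (a b c : R) : sp := \row_(i < 3) [:: a; b; c]`_i.

Definition o0 : 'I_3 := ord0.
Definition o1 : 'I_3 := lift ord0 ord0.
Definition o2 : 'I_3 := lift ord0 (lift ord0 ord0).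

Lemma ord3_ind (P : 'I_3 -> Prop) : P o0 -> P o1 -> P o2 -> forall i, P i.
Proof.
move=> P0 P1 P2 i; case: (unliftP ord0 i) => [j|] -> //.
case: (unliftP ord0 j) => [k|] -> //.
case: (unliftP ord0 k) => [[]//|] -> //.
Qed.

Lemma sphereE p : sphere2 p <-> p 0 o0 ^+ 2 + p 0 o1 ^+ 2 + p 0 o2 ^+ 2 = 1.
Proof. by rewrite /sphere2 /= !big_ord_recl big_ord0 addr0 addrA. Qed.

Lemma sp_eq p n : p 0 o0 = n 0 o0 -> p 0 o1 = n 0 o1 -> p 0 o2 = n 0 o2 -> p = n.
Proof. by move=> e0 e1 e2; apply/rowP; apply: ord3_ind. Qed.

Lemma vec3_continuous (T : topologicalType) (f g h : T -> R) :
  continuous f -> continuous g -> continuous h -> continuous (fun t => vec3 (f t) (g t) (h t)).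
Proof.
move=> cf cg ch t; apply/cvg_ballP => e e0.
have /cvg_ballP/(_ _ e0) Hf := cf t; have /cvg_ballP/(_ _ e0) Hg := cg t.
have /cvg_ballP/(_ _ e0) Hh := ch t.
near=> s; split=> // i; apply: ord3_ind; rewrite !mxE /=; near: s; [exact: Hf|exact: Hg|exact: Hh].
Unshelve. all: by end_near. Qed.

Lemma vec_coord_continuous i : continuous (fun p : sp => p 0 i).
Proof.
move=> /= p s /= /(nbhs_ballP (p 0 i))[e e0 es].
by apply/nbhs_ballP; exists e => //= p' [_ pp']; exact/es/pp'.
Qed.

Lemma vec3E a b c : [/\ vec3 a b c 0 o0 = a, vec3 a b c 0 o1 = b & vec3 a b c 0 o2 = c].
Proof. by split; rewrite mxE. Qed.

(* Stereographic projection from [n] onto the tangent plane at its antipode,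
   followed by the projection along the third axis, injective when [n 0 2 != 0]. *)
Section Pole.
Variable n : sp.
Hypothesis nS : sphere2 n.
Hypothesis n2 : n 0 o2 != 0.

Definition dot p := p 0 o0 * n 0 o0 + p 0 o1 * n 0 o1 + p 0 o2 * n 0 o2.
Definition stereo p : pl := ((p 0 o0 - n 0 o0) / (1 - dot p), (p 0 o1 - n 0 o1) / (1 - dot p)).
(** Completes [q] to the vector of the tangent plane at the antipode of [n], that is, with inner
    product [-1] with [n]. *)
Definition third q : R := - (1 + q.1 * n 0 o0 + q.2 * n 0 o1) / n 0 o2.
Definition sqnorm q : R := q.1 ^+ 2 + q.2 ^+ 2 + third q ^+ 2.
(** The second intersection of the sphere with the line from [n] in the direction
    [w = (q.1, q.2, third q)]: on the points [n + t w] the equation of the sphere becomes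
    [t |w|^2 = 2] for nonzero [t]. *)
Definition unstereo q : sp := vec3 (n 0 o0 + 2 / sqnorm q * q.1) (n 0 o1 + 2 / sqnorm q * q.2)
  (n 0 o2 + 2 / sqnorm q * third q).

Lemma third_dot q : q.1 * n 0 o0 + q.2 * n 0 o1 + third q * n 0 o2 = -1.
Proof. by rewrite /third divfK //; lra. Qed.

Lemma sqnorm_gt0 q : 0 < sqnorm q.
Proof.
have D := third_dot q; rewrite /sqnorm lt_neqAle !addr_ge0 ?sqr_ge0 // andbT eq_sym.
apply/eqP => E; have [e1 [e2 e3]] : q.1 = 0 /\ q.2 = 0 /\ third q = 0.
  have := sqr_ge0 q.1; have := sqr_ge0 q.2; have := sqr_ge0 (third q) => h3 h2 h1.
  by split; [|split]; apply/eqP; rewrite -(sqrf_eq0 (_ : R)); apply/eqP; lra.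
by move: D; rewrite e1 e2 e3; lraF.
Qed.

Lemma unstereo_sphere q : sphere2 (unstereo q).
Proof.
apply/sphereE; have /sphereE N := nS; have D := third_dot q; have s0 := sqnorm_gt0 q.
have [-> -> ->] := vec3E (n 0 o0 + 2 / sqnorm q * q.1) (n 0 o1 + 2 / sqnorm q * q.2)
  (n 0 o2 + 2 / sqnorm q * third q).
set s := sqnorm q in s0 *; have sE : q.1 ^+ 2 + q.2 ^+ 2 + third q ^+ 2 = s by [].
have E : (2 / s) * s = 2 by rewrite divfK // gt_eqF.
set t := 2 / s in E *.
transitivity ((n 0 o0 ^+ 2 + n 0 o1 ^+ 2 + n 0 o2 ^+ 2) +
  2 * t * (q.1 * n 0 o0 + q.2 * n 0 o1 + third q * n 0 o2) +
  t * (t * (q.1 ^+ 2 + q.2 ^+ 2 + third q ^+ 2))); first by ring.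
by rewrite N D sE E; ring.
Qed.

Lemma dot_unstereo q : 1 - dot (unstereo q) = 2 / sqnorm q.
Proof.
have /sphereE N := nS; have D := third_dot q; rewrite /dot.
have [-> -> ->] := vec3E (n 0 o0 + 2 / sqnorm q * q.1) (n 0 o1 + 2 / sqnorm q * q.2)
  (n 0 o2 + 2 / sqnorm q * third q).
set t := 2 / sqnorm q.
transitivity (1 - (n 0 o0 ^+ 2 + n 0 o1 ^+ 2 + n 0 o2 ^+ 2) -
  t * (q.1 * n 0 o0 + q.2 * n 0 o1 + third q * n 0 o2)); first by ring.
by rewrite N D; ring.
Qed.

Lemma unstereoK q : stereo (unstereo q) = q.
Proof.
have t0 : 2 / sqnorm q != 0 by rewrite gt_eqF // divr_gt0 // sqnorm_gt0.
rewrite /stereo dot_unstereo.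
have [-> -> _] := vec3E (n 0 o0 + 2 / sqnorm q * q.1) (n 0 o1 + 2 / sqnorm q * q.2)
  (n 0 o2 + 2 / sqnorm q * third q).
rewrite ![n _ _ + _]addrC !addrK ![2 / _ * _]mulrC !mulfK //.
by case: (q).
Qed.

Lemma dot_pole p : sphere2 p -> p <> n -> 1 - dot p != 0.
Proof.
move=> /sphereE P pn; have /sphereE N := nS; apply/eqP => E; apply: pn.
have S : (p 0 o0 - n 0 o0) ^+ 2 + (p 0 o1 - n 0 o1) ^+ 2 + (p 0 o2 - n 0 o2) ^+ 2 = 0.
  transitivity ((p 0 o0 ^+ 2 + p 0 o1 ^+ 2 + p 0 o2 ^+ 2) + (n 0 o0 ^+ 2 + n 0 o1 ^+ 2 + n 0 o2 ^+ 2)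
     - 2 * dot p); first by rewrite /dot; ring.
  by rewrite P N; lra.
have := sqr_ge0 (p 0 o0 - n 0 o0); have := sqr_ge0 (p 0 o1 - n 0 o1); have := sqr_ge0 (p 0 o2 - n 0 o2).
move=> h3 h2 h1; apply: sp_eq; apply/eqP; rewrite -subr_eq0 -sqrf_eq0; apply/eqP; lra.
Qed.

Lemma stereoK p : sphere2 p -> p <> n -> unstereo (stereo p) = p.
Proof.
move=> pS pn; have d0 := dot_pole pS pn; have /sphereE P := pS; have /sphereE N := nS.
have T : third (stereo p) = (p 0 o2 - n 0 o2) / (1 - dot p).
  rewrite /third /stereo /=; apply: (mulIf n2); rewrite divfK //; apply: (mulIf d0).
  rewrite mulNr mulrDl mulrDl mul1r.
  rewrite (mulrAC _ (n 0 o0)) divfK // (mulrAC _ (n 0 o1)) divfK // (mulrAC _ (n 0 o2)) divfK //.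
  rewrite /dot; have : n 0 o0 ^+ 2 + n 0 o1 ^+ 2 + n 0 o2 ^+ 2 = 1 by [].
  move=> NN; rewrite -[X in - (X - _ + _ + _)]NN; ring.
have S : sqnorm (stereo p) = 2 / (1 - dot p).
  rewrite /sqnorm T /stereo /=; apply: (mulIf d0); rewrite divfK //.
  rewrite !expr_div_n -!mulrDl expr2 invfM mulrA divfK //.
  apply: (mulIf d0); rewrite divfK //.
  transitivity ((p 0 o0 ^+ 2 + p 0 o1 ^+ 2 + p 0 o2 ^+ 2) + (n 0 o0 ^+ 2 + n 0 o1 ^+ 2 + n 0 o2 ^+ 2)
     - 2 * dot p); first by rewrite /dot; ring.
  by rewrite P N; ring.
have E : 2 / sqnorm (stereo p) = 1 - dot p.
  by rewrite S invf_div mulrCA divff ?mulr1.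
rewrite /unstereo E T; have [e0 e1 e2] := vec3E (n 0 o0 + (1 - dot p) * (stereo p).1)
   (n 0 o1 + (1 - dot p) * (stereo p).2) (n 0 o2 + (1 - dot p) * ((p 0 o2 - n 0 o2) / (1 - dot p))).
by apply: sp_eq; rewrite ?e0 ?e1 ?e2 /stereo /= mulrC divfK // subrKC.
Qed.

Lemma unstereo_inj : injective unstereo.
Proof. exact: can_inj unstereoK. Qed.

Lemma stereo_inj p p' : sphere2 p -> p <> n -> sphere2 p' -> p' <> n -> stereo p = stereo p' -> p = p'.
Proof. by move=> h1 h2 h3 h4 E; rewrite -(stereoK h1 h2) E stereoK. Qed.

Lemma unstereo_continuous : continuous unstereo.
Proof.
have c1 : continuous (fun q : pl => q.1) by move=> q; exact: cvg_fst.
have c2 : continuous (fun q : pl => q.2) by move=> q; exact: cvg_snd.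
have cst (c : R) : continuous (fun _ : pl => c) by move=> q; exact: cvg_cst.
have c3 : continuous third.
  move=> q; apply: cvgM; last exact: cst; apply: cvgN; apply: cvgD.
    by apply: cvgD; [exact: cst|apply: cvgM; [exact: c1|exact: cst]].
  by apply: cvgM; [exact: c2|exact: cst].
have cX (f : pl -> R) : continuous f -> continuous (fun q => f q ^+ 2).
  by move=> cf q; under eq_fun do rewrite expr2; apply: cvgM; exact: cf.
have cs : continuous sqnorm.
  by move=> q; apply: cvgD; [apply: cvgD|]; [exact: (cX _ c1)|exact: (cX _ c2)|exact: (cX _ c3)].
have ct : continuous (fun q => 2 / sqnorm q).
  move=> q; apply: cvgM; [exact: cst|apply: cvgV; [|exact: cs]].
  by rewrite gt_eqF // sqnorm_gt0.
apply: vec3_continuous => q; (apply: cvgD; [exact: cst|apply: cvgM; [exact: ct|]]).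
- exact: c1.
- exact: c2.
- exact: c3.
Qed.

Lemma stereo_continuous (g : R -> sp) : continuous g -> (forall t, sphere2 (g t)) ->
  (forall t, g t <> n) -> continuous (fun t => stereo (g t)).
Proof.
move=> cg gS gn.
have cc i : continuous (fun t => g t 0 i).
  by move=> t; apply: (continuous_comp (f := g) (g := fun p : sp => p 0 i)); [exact: cg|exact: vec_coord_continuous].
have cst (c : R) : continuous (fun _ : R => c) by move=> q; exact: cvg_cst.
have cd : continuous (fun t => (1 - dot (g t))^-1).
  move=> t; apply: cvgV; first exact: (dot_pole (gS t) (gn t)).
  apply: cvgB; [exact: cst|]; apply: cvgD; [apply: cvgD|]; (apply: cvgM; [exact: cc|exact: cst]).
apply: pair_continuous => t; apply: cvgM; (try exact: cd); apply: cvgB; (try exact: cst); exact: cc.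
Qed.

Lemma stereo_arc (A : set sp) a b : is_arc A a b -> A `<=` sphere2 (R := R) -> ~ A n ->
  arc R (stereo @` A) (stereo a) (stereo b).
Proof.
move=> /is_arc_loop[g [cg ig <- <- [gA Ag]]] AS An.
have gS t : sphere2 (g t) by apply: AS.
have gn t : g t <> n by move=> E; apply: An; rewrite -E.
apply: (@arcI R _ (fun t => stereo (g t))).
- exact: stereo_continuous.
- by move=> s t hs ht /stereo_inj h; apply: ig => //; apply: h.
- move=> x; split=> [[y /Ag[t ht <-] <-]|[t ht <-]]; first by exists t.
  by exists (g t) => //; apply: gA.
Qed.

Lemma unstereo_arc (D : set pl) a b : arc R D a b -> is_arc (unstereo @` D) (unstereo a) (unstereo b).
Proof.
move=> /arcW[g [cg ig <- <- gD]].
apply: (@is_arcI (fun t => unstereo (g t))).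
- by move=> t; apply: continuous_comp; [exact: cg|exact: unstereo_continuous].
- by move=> s t hs ht /unstereo_inj; exact: ig.
- move=> x; split=> [[y /gD[t ht <-] <-]|[t ht <-]]; first by exists t.
  by exists (g t) => //; apply/gD; exists t.
Qed.

End Pole.

End Stereographic.

Lemma set2_eq (T : finType) (a b u v : T) : u != v -> [set a; b]%SET = [set u; v]%SET ->
  a = u /\ b = v \/ a = v /\ b = u.
Proof.
move=> uv E; have : a \in [set u; v]%SET by rewrite -E !inE eqxx.
rewrite !inE => /orP[] /eqP au.
  have : v \in [set a; b]%SET by rewrite E !inE eqxx orbT.
  by rewrite !inE au eq_sym (negbTE uv) => /eqP bv; left.
have : u \in [set a; b]%SET by rewrite E !inE eqxx.
by rewrite !inE au (negbTE uv) => /eqP bv; right.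
Qed.

(** * From sphere drawings to plane drawings *)

Section Transfer.
Variables (R : realType) (V : finType).
Notation pl := (plane R).
Notation sp := 'rV[R]_3.
Variable P : sphere_graph R V.

Lemma sp_hausdorff : hausdorff_space sp.
Proof. exact: norm_hausdorff. Qed.

Lemma sg_edgeP e : e \in sg_edges P -> exists u v, [/\ e = [set u; v]%SET, u != v &
  is_arc (sg_arc P e) (sg_point P u) (sg_point P v)].
Proof.
move=> eE; have /eqP/cards2P[u [v [uv Ee]]] := sg_simple eE.
by exists u, v; split=> //; rewrite Ee; apply: sg_arcP; rewrite -Ee.
Qed.

(** Seen in the chart from the north pole, the drawing is a finite union of closed sets with empty
    interior, which nested balls avoid one after the other. *)
Lemma pole_exists : exists n : sp, [/\ sphere2 n, n 0 o2 != 0,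
  forall e, e \in sg_edges P -> ~ sg_arc P e n & forall v, sg_point P v <> n].
Proof.
pose n0 : sp := vec3 0 0 1; have [e0 e1 e2] := @vec3E R 0 0 1.
have n0S : sphere2 n0 by apply/sphereE; rewrite e0 e1 e2 !expr0n expr1n /= !add0r.
have n02 : n0 0 o2 != 0 by rewrite e2 oner_neq0.
pose psi := unstereo n0.
have cpsi : continuous psi := unstereo_continuous n02.
have ipsi : injective psi := unstereo_inj n0S n02.
pose F (i : {set V} + V) : set sp := match i with inl e => sg_arc P e | inr v => [set sg_point P v] end.
pose D (i : {set V} + V) := if i is inl e then e \in sg_edges P else true.
have FD i : D i -> closed (F i) /\ forall (c : pl) (r : R), 0 < r -> exists2 z, ball c r z & ~ F i (psi z).
  case: i => [e eE|v _] /=.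
    have [u [v [_ _ /is_arc_loop[g [cg ig g0 g1 [_ gA]]]]]] := sg_edgeP eE.
    have aE := arcI cg ig gA.
    split; first by apply: compact_closed; [exact: sp_hausdorff|exact: arc_compact aE].
    by move=> c r r0; exact: (arc_empty_interior sp_hausdorff c cpsi ipsi aE r0).
  split; first by apply: compact_closed; [exact: sp_hausdorff|exact: compact_set1].
  move=> c r r0; have [E|E] := pselect (psi c = sg_point P v); last first.
    by exists c => //; exact: ballxx.
  pose c' : pl := (c.1 + r / 2, c.2).
  exists c'; first by apply/plballP => /=; split; lra.
  rewrite /= -E => /ipsi h; move: (congr1 fst h) => /=; lraF.
have avoid (s : seq ({set V} + V)) : forall (c : pl) (r : R), 0 < r -> exists c' (r' : R),
    [/\ 0 < r', forall z, ball c' r' z -> ball c r z &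
        forall i, i \in s -> D i -> forall z, ball c' r' z -> ~ F i (psi z)].
  elim: s => [|i s IH] c r r0; first by exists c, r; split.
  have [c1 [r1 [r10 sub1 H1]]] := IH c r r0.
  have [Di|nDi] := boolP (D i); last first.
    exists c1, r1; split=> // j; rewrite inE => /orP[/eqP->|]; last exact: H1.
    by rewrite (negbTE nDi).
  have [cF eF] := FD i Di; have [z1 b1 n1] := eF c1 r1 r10.
  have cl : closed (psi @^-1` F i) by move/continuous_closedP: cpsi; apply.
  have [r2 r20 H2] := closed_ball_miss cl n1; have [r3 r30 H3] := ball_inner b1.
  exists z1, (Num.min r2 r3); split; first by rewrite lt_min r20.
    by move=> z bz; apply: sub1; apply: H3; apply: le_ball bz; rewrite ge_min lexx orbT.
  move=> j; rewrite inE => /orP[/eqP-> _ z bz|js Dj z bz].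
    by apply: H2; apply: le_ball bz; rewrite ge_min lexx.
  by apply: (H1 j) => //; apply: H3; apply: le_ball bz; rewrite ge_min lexx orbT.
(* Starting from the ball of radius [1/2] about the origin keeps the third coordinate
   [1 - 2 / sqnorm] nonzero, since there [sqnorm] is less than [2]. *)
have [c [r [r0 sub H]]] := avoid (enum {: {set V} + V}) (0, 0) 2^-1 (ltac:(by rewrite invr_gt0)).
have bc : ball c r c by exact: ballxx.
exists (psi c); split.
- exact: unstereo_sphere.
- have /plballP[/= h1 h2 h3 h4] := sub c bc.
  have [_ _ E] := vec3E (n0 0 o0 + 2 / sqnorm n0 c * c.1) (n0 0 o1 + 2 / sqnorm n0 c * c.2)
    (n0 0 o2 + 2 / sqnorm n0 c * third n0 c).
  rewrite /psi /unstereo E e2; have t1 : third n0 c = -1.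
    by rewrite /third e0 e1 e2 !mulr0 !addr0 divr1.
  have s0 := sqnorm_gt0 n02 c; rewrite t1 mulrN1 subr_eq0 eq_sym.
  apply/eqP => E2; have : sqnorm n0 c = 2 by have := divfK (lt0r_neq0 s0) 2; rewrite E2 mul1r.
  rewrite /sqnorm t1 => S; have : c.1 ^+ 2 < 4^-1 /\ c.2 ^+ 2 < 4^-1 by split; nra.
  case; lraF.
- by move=> e eE; apply: (H (inl e)) => //; rewrite mem_enum.
- by move=> v E; apply: (H (inr v) _ isT c bc) => //=; rewrite mem_enum.
Qed.

Variable n : sp.
Hypothesis nS : sphere2 n.
Hypothesis n2 : n 0 o2 != 0.
Hypothesis nA : forall e, e \in sg_edges P -> ~ sg_arc P e n.
Hypothesis nV : forall v, sg_point P v <> n.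
Notation st := (stereo n).

Let st_inj p p' : sphere2 p -> p <> n -> sphere2 p' -> p' <> n -> st p = st p' -> p = p'.
Proof. exact: stereo_inj. Qed.

Let on_arc e p : e \in sg_edges P -> sg_arc P e p -> sphere2 p /\ p <> n.
Proof.
by move=> eE ep; split; [exact: sg_arc_sphere ep|move=> pn; apply: (nA eE); rewrite -pn].
Qed.

Let on_pt v : sphere2 (sg_point P v) /\ sg_point P v <> n.
Proof. by split; [exact: sg_point_sphere|exact: nV]. Qed.

Lemma project_inj : injective (fun v => st (sg_point P v)).
Proof.
move=> u v; have [u1 u2] := on_pt u; have [v1 v2] := on_pt v.
by move=> /st_inj E; apply: (@sg_point_inj _ _ P); exact: E.
Qed.

Lemma project_arc u v : [set u; v]%SET \in sg_edges P ->
  arc R (st @` sg_arc P [set u; v]%SET) (st (sg_point P u)) (st (sg_point P v)).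
Proof.
move=> uv; apply: stereo_arc => //; [exact: sg_arcP|exact: sg_arc_sphere|exact: nA].
Qed.

Lemma project_vertex v e : e \in sg_edges P -> (st @` sg_arc P e) (st (sg_point P v)) -> v \in e.
Proof.
move=> eE [p ep E]; have [p1 p2] := on_arc eE ep; have [v1 v2] := on_pt v.
by apply: (sg_vertex_arc eE); rewrite -(st_inj p1 p2 v1 v2 E).
Qed.

Lemma project_cross e f z : e \in sg_edges P -> f \in sg_edges P -> e != f ->
  (st @` sg_arc P e) z -> (st @` sg_arc P f) z -> exists v, [/\ v \in e, v \in f & z = st (sg_point P v)].
Proof.
move=> eE fE ef [p ep <-] [p' fp' E].
have [p1 p2] := on_arc eE ep; have [p'1 p'2] := on_arc fE fp'.
have pp' := st_inj p'1 p'2 p1 p2 E; rewrite pp' in fp'.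
have [v] := sg_noncrossing eE fE ef (conj ep fp').
by rewrite /= inE => /andP[ve vf] <-; exists v.
Qed.

Definition projected : plane_graph R V :=
  PlaneGraph (@sg_simple _ _ P) project_inj project_arc project_vertex project_cross.

(** An arc contradicting maximality in the plane lifts to the sphere, where it can be added to [P]
    as an edge [N] without crossings. *)
Lemma projected_maximal : triangulation P -> maximal_graph projected.
Proof.
move=> [_ maxP] u v D uv nuv aD DX; have nuv' : [set u; v]%SET \notin sg_edges P by [].
pose N := [set u; v]%SET.
have aN : is_arc (unstereo n @` D) (sg_point P u) (sg_point P v).
  have := unstereo_arc nS n2 aD; rewrite /= !stereoK //; (try exact: nV); exact: sg_point_sphere.
have DS p : (unstereo n @` D) p -> sphere2 p by move=> [q _ <-]; exact: unstereo_sphere.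
have meet p : (unstereo n @` D) p -> support projected (st p) -> p = sg_point P u \/ p = sg_point P v.
  move=> [q Dq <-]; rewrite unstereoK // => Xq.
  have h w : unstereo n (st (sg_point P w)) = sg_point P w by rewrite stereoK //; exact: sg_point_sphere.
  by case: (DX q Dq Xq) => ->; rewrite /= h; [left|right].
pose E' := (N |: sg_edges P)%SET.
pose A' e := if e == N then unstereo n @` D else sg_arc P e.
have inE' e : e \in E' -> e = N \/ e != N /\ e \in sg_edges P.
  by rewrite !inE; have [->|ne] := eqVneq e N; [left|right].
have A'N : A' N = unstereo n @` D by rewrite /A' eqxx.
have A'E e : e != N -> A' e = sg_arc P e by move=> ne; rewrite /A' (negbTE ne).
have sE' : simple_graph E'.
  move=> e /inE'[->|[_ eE]]; last exact: (sg_simple eE).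
  by rewrite cards2; case: eqVneq uv.
have arcS e : e \in E' -> (A' e `<=` sphere2 (R := R))%classic.
  move=> /inE'[->|[ne eE]]; first by rewrite A'N.
  by rewrite A'E //; exact: sg_arc_sphere.
have arcP a b : [set a; b]%SET \in E' -> is_arc (A' [set a; b]%SET) (sg_point P a) (sg_point P b).
  move=> /inE'[abN|[ne eE]]; last by rewrite A'E //; exact: sg_arcP.
  have uv' : u != v by apply/eqP.
  by rewrite abN A'N; have [[-> ->]|[-> ->]] := set2_eq uv' abN; [|exact: is_arc_sym].
have uN : u \in N /\ v \in N by rewrite !inE !eqxx orbT.
have vtx w e : e \in E' -> A' e (sg_point P w) -> w \in e.
  move=> /inE'[->|[ne eE]]; last by rewrite A'E //; exact: sg_vertex_arc.
  rewrite A'N => /meet/(_ (pt_support projected w)).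
  by case=> /(@sg_point_inj _ _ P) ->; case: uN.
have crossN e : e \in sg_edges P ->
    ((unstereo n @` D) `&` sg_arc P e `<=` sg_point P @` [set` N :&: e])%classic.
  move=> eE p [pD pe].
  have Xp : support projected (st p) by left; exists e => //; exists p.
  have [pu|pv] := meet p pD Xp.
    by exists u => //; rewrite /= inE uN.1 (sg_vertex_arc eE) // -pu.
  by exists v => //; rewrite /= inE uN.2 (sg_vertex_arc eE) // -pv.
have cross e f : e \in E' -> f \in E' -> e != f ->
    (A' e `&` A' f `<=` sg_point P @` [set` e :&: f])%classic.
  move=> /inE'[->|[ne eE]] /inE'[->|[nf fE]]; first by rewrite eqxx.
  - by move=> _; rewrite A'N A'E //; exact: crossN.
  - by move=> _; rewrite A'N A'E // classical_sets.setIC finset.setIC; exact: crossN.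
  - by rewrite !A'E //; exact: sg_noncrossing.
pose Q := SphereGraph sE' (@sg_point_inj _ _ P) (@sg_point_sphere _ _ P) arcS arcP vtx cross.
have PQ : sphere_subgraph P Q.
  split=> //; first by apply: finset.subsetUr.
  by move=> e eE; rewrite /= A'E //; apply/eqP => eN; move: nuv'; rewrite -/N -eN eE.
have := maxP Q PQ; rewrite /= => E; move: nuv'; rewrite -E !inE.
by rewrite eqxx.
Qed.

End Transfer.

(** * Irreducible braced triangulations *)

Section ThreeCycles.
Variable V : finType.
Implicit Types (u v w x y z : V) (E : {set {set V}}).

Lemma three_cycle_rot x y z : three_cycle x y z = three_cycle y z x.
Proof. by apply/finset.setP => e; rewrite /three_cycle !inE -orbA orbC. Qed.

Lemma three_cycle_swap x y z : three_cycle x y z = three_cycle y x z.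
Proof.
rewrite /three_cycle [[set y; x]%SET]finset.setUC [[set x; z]%SET]finset.setUC.
by rewrite [[set z; y]%SET]finset.setUC -finset.setUA [X in _ :|: X]finset.setUC finset.setUA.
Qed.

Lemma three_cycle_through E C u v : C \in three_cycles E -> [set u; v]%SET \in C ->
  exists w, [/\ C = three_cycle u v w, u != v, w != u, w != v &
    [set u; w]%SET \in E /\ [set w; v]%SET \in E].
Proof.
rewrite finset.in_set => /andP[CE /existsP[x /existsP[y /existsP[z /andP[uq /eqP Cxyz]]]]] uvC.
suff [w [Cw uw]] : exists w, C = three_cycle u v w /\ uniq [:: u; v; w].
  exists w; move: uw; rewrite /= !inE !negb_or andbT => /andP[/andP[uv uw] vw].
  split=> //; try by rewrite eq_sym.
  split; apply: (fintype.subsetP CE); rewrite Cw /three_cycle !inE.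
    by rewrite [[set u; w]%SET]finset.setUC eqxx orbT.
  by rewrite [[set w; v]%SET]finset.setUC eqxx !orbT.
have main a b c : uniq [:: a; b; c] -> C = three_cycle a b c -> [set u; v]%SET = [set a; b]%SET ->
    exists w, C = three_cycle u v w /\ uniq [:: u; v; w].
  move=> uabc Cabc E'; have ab : a != b by move: uabc; rewrite /= !inE negb_or => /andP[/andP[]].
  exists c; have [[-> ->]|[-> ->]] := set2_eq ab E'; first by [].
  split; first by rewrite three_cycle_swap.
  by move: uabc; rewrite /= !inE !negb_or !andbT eq_sym => /andP[/andP[-> ->] ->].
have : [set u; v]%SET \in three_cycle x y z by rewrite -Cxyz.
rewrite /three_cycle !inE => /orP[/orP[]|] /eqP E'.
- exact: (main x y z).
- apply: (main y z x) => //; last by rewrite Cxyz three_cycle_rot.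
  by move: uq; rewrite (perm_uniq (s2 := [:: y; z; x])) // -(perm_rot 1).
- apply: (main z x y) => //; last by rewrite Cxyz -three_cycle_rot.
  by move: uq; rewrite (perm_uniq (s2 := [:: z; x; y])) // -(perm_rot 2).
Qed.

(** Translates contractibility into a number of common neighbours: a 3-cycle through an edge is
    determined by its third vertex. *)
Lemma three_cycles_count E u v : simple_graph E -> [set u; v]%SET \in E ->
  #|[set C in three_cycles E | [set u; v]%SET \in C]%SET| =
  #|[set w | ([set u; w]%SET \in E) && ([set w; v]%SET \in E)]%SET|.
Proof.
move=> sE uvE; set S := (X in _ = #|X|).
have neq x y : [set x; y]%SET \in E -> x != y by move=> /sE; rewrite cards2; case: (x != y).
have uv := neq _ _ uvE.
have -> : [set C in three_cycles E | [set u; v]%SET \in C]%SET = [set three_cycle u v w | w in S]%SET.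
  apply/finset.setP => C; rewrite finset.in_set; apply/andP/imsetP.
    move=> [CE uvC]; have [w [-> _ _ _ [h1 h2]]] := three_cycle_through CE uvC.
    by exists w => //; rewrite finset.in_set h1 h2.
  move=> [w]; rewrite finset.in_set => /andP[uw wv] ->; split; last by rewrite /three_cycle !inE eqxx.
  rewrite finset.in_set; apply/andP; split.
    apply/fintype.subsetP => e; rewrite /three_cycle !inE => /orP[/orP[]|] /eqP-> //.
      by rewrite finset.setUC.
    by rewrite finset.setUC.
  apply/existsP; exists u; apply/existsP; exists v; apply/existsP; exists w.
  by rewrite eqxx andbT /= !inE negb_or uv (neq _ _ uw) eq_sym (neq _ _ wv).
apply: card_in_imset => w w'; rewrite !finset.in_set => /andP[uw wv] /andP[uw' w'v] E'.
have : [set v; w]%SET \in three_cycle u v w' by rewrite -E' /three_cycle !inE eqxx orbT.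
have vw : v != w by rewrite eq_sym (neq _ _ wv).
rewrite /three_cycle !inE => /orP[/orP[]|] /eqP.
- move=> /(set2_eq uv)[[vu _]|[_ wu]]; first by rewrite vu eqxx in uv.
  by move: (neq _ _ uw); rewrite wu eqxx.
- by move=> /set2_eq []; [rewrite eq_sym (neq _ _ w'v)| case|case=> <- -> ].
- have w'u : w' != u by rewrite eq_sym (neq _ _ uw').
  move=> /(set2_eq w'u)[[vw' _]|[vu _]]; last by rewrite vu eqxx in uv.
  by move: (neq _ _ w'v); rewrite vw' eqxx.
Qed.

Lemma card_bigcup_le (I J : finType) (A : {set I}) (F : I -> {set J}) :
  (#|(\bigcup_(i in A) F i)%SET| <= \sum_(i in A) #|F i|)%N.
Proof.
elim/big_ind2: _ => [|m A1 n A2 h1 h2|//]; first by rewrite cards0.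
by apply: leq_trans (leq_of_leqif (leq_card_setU _ _)) _; exact: leq_add.
Qed.

End ThreeCycles.

(** * Counting vertices by braces *)

Section Braces.
Variables (R : realType) (V : finType) (G : braced_triangulation R V).
Hypothesis hG : irreducible_bt G.
Notation P := (bt_graph G).
Notation B := (bt_braces G).
Hypothesis V4 : (3 < #|V|)%N.
Variable n : 'rV[R]_3.
Hypothesis nS : sphere2 n.
Hypothesis n2 : n 0 o2 != 0.
Hypothesis nA : forall e, e \in sg_edges P -> ~ sg_arc P e n.
Hypothesis nV : forall v, sg_point P v <> n.
Let D : plane_graph R V := projected nS n2 nA nV.
Let maxD : maximal_graph D := projected_maximal (bt_triangulation G).
Implicit Types (u v w x z : V).

Definition brace_ends : {set V} := (\bigcup_(f in B) f)%SET.
Notation W := brace_ends.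

Lemma brace_end f x : f \in B -> x \in f -> x \in W.
Proof. by move=> fB xf; apply/finset.bigcupP; exists f. Qed.

Lemma card_brace_ends : (#|W| <= 2 * #|B|)%N.
Proof.
apply: leq_trans (card_bigcup_le _ _) _.
rewrite mulnC -sum_nat_const; apply: leq_sum => f fB.
by rewrite (bt_brace_pair fB).
Qed.

Lemma braced_edge u v : adj D u v -> #|cn D u v| = 2%N -> exists t,
  [/\ [set u; t]%SET \in bt_edges G, [set t; v]%SET \in bt_edges G &
      [set u; t]%SET \in B \/ [set t; v]%SET \in B].
Proof.
move=> uv c2; have uE : [set u; v]%SET \in sg_edges P by [].
have contr : contractible P [set u; v]%SET.
  by split=> //; rewrite three_cycles_count //; exact: sg_simple.
have [C CE [uvC [f fB fC]]] : exists2 C, C \in three_cycles (bt_edges G) &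
    [set u; v]%SET \in C /\ exists2 f, f \in B & f \in C.
  by apply: contrapT => h; apply: (hG uE).
have [t [Ct _ _ _ [h1 h2]]] := three_cycle_through CE uvC.
exists t; split=> //; move: fC; rewrite Ct /three_cycle !inE => /orP[/orP[]|] /eqP fE.
- by have := bt_brace_nonadjacent fB; rewrite fE uE.
- by right; rewrite finset.setUC -fE.
- by left; rewrite finset.setUC -fE.
Qed.

Lemma braceless_edge u a : u \notin W -> a \notin W -> adj D u a -> #|cn D u a| <> 2%N.
Proof.
move=> uW aW ua c2; have [t [_ _ [h|h]]] := braced_edge ua c2.
  by move: uW; rewrite (brace_end h) // !inE eqxx.
by move: aW; rewrite (brace_end h) // !inE eqxx orbT.
Qed.

(** An ear at [u] gives a neighbour [v] such that [u v] lies in a 3-cycle with a brace. As [u] is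
    not an end of a brace, the brace joins [v] to the third vertex [t], and [u t] is an edge of
    [P]. *)
Lemma brace_of_vertex u : u \notin W -> exists x z,
  [/\ [set x; z]%SET \in B, x != z, adj D x u & adj D u z].
Proof.
move=> uW; have [v [uv c2]] := exists_ear maxD u V4.
have c2' : #|cn D u v| = 2%N by apply/eqP; rewrite eqn_leq c2 (common_ge2 maxD V4 uv).
have [t [h1 _ [h|h]]] := braced_edge uv c2'.
  by move: uW; rewrite (brace_end h) // !inE eqxx.
exists v, t; rewrite finset.setUC h; split=> //; last first.
- move: h1; rewrite finset.in_setU => /orP[//|h1].
  by move: uW; rewrite (brace_end h1) // !inE eqxx.
- by rewrite adjC.
- by have := bt_brace_pair h; rewrite cards2 eq_sym; case: eqVneq.
Qed.

Definition brace_poles (f : {set V}) : {set V} :=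
  [set u | (u \notin W) && [forall x, (x \in f) ==> adj D x u]]%SET.

(** Apart from the ends of [f] there are at most [2 * #|B| - 2] ends of braces, and each serves two
    poles. Up to three poles are within the bound because [#|B|] is at least [2]. *)
Lemma card_brace_poles f : (2 <= #|B|)%N -> f \in B -> (#|brace_poles f| <= 4 * #|B| - 4)%N.
Proof.
move=> b2 fB; have /eqP/cards2P[x [z [xz fE]]] := bt_brace_pair fB.
have xW : x \in W by rewrite (brace_end fB) // fE !inE eqxx.
have zW : z \in W by rewrite (brace_end fB) // fE !inE eqxx orbT.
have nxz : ~~ adj D x z by have := bt_brace_nonadjacent fB; rewrite fE.
have -> : brace_poles f = poles D W x z.
  apply/finset.setP => u; rewrite !finset.in_set; congr (_ && _).
  apply/forallP/andP => [h|[xu uz] y].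
    by split; [have := h x|rewrite adjC; have := h z]; rewrite fE !inE eqxx ?orbT.
  by apply/implyP; rewrite fE !inE => /orP[] /eqP->; rewrite // adjC.
have [p3|p4] := leqP #|poles D W x z| 3; first by lia.
have HBr u : u \notin W -> exists x' z', [/\ x' \in W, z' \in W, x' != z' & adj D x' u /\ adj D u z'].
  move=> uW; have [x' [z' [fB' xz' h1 h2]]] := brace_of_vertex uW; exists x', z'; split=> //.
    by rewrite (brace_end fB') // !inE eqxx.
  by rewrite (brace_end fB') // !inE eqxx orbT.
have := card_poles maxD V4 HBr braceless_edge xW zW xz nxz p4.
have : (#|W :\: [set x; z]%SET| = #|W| - 2)%N.
  rewrite cardsDS; first by rewrite cards2 xz.
  by apply/fintype.subsetP => y; rewrite !inE => /orP[] /eqP->.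
have := card_brace_ends; lia.
Qed.

Lemma card_vertices : (2 <= #|B|)%N -> (#|V| <= 4 * #|B| ^ 2 - 2 * #|B|)%N.
Proof.
move=> b2; have cover : [set: V]%SET \subset W :|: (\bigcup_(f in B) brace_poles f)%SET.
  apply/fintype.subsetP => u _; rewrite finset.in_setU; have [//|uW] := boolP (u \in W).
  have [x [z [fB xz xu uz]]] := brace_of_vertex uW.
  apply/finset.bigcupP; exists [set x; z]%SET => //; rewrite finset.in_set uW; apply/forallP => y.
  by apply/implyP; rewrite !inE => /orP[] /eqP->; rewrite // adjC.
have := subset_leq_card cover; rewrite cardsT => h.
have h2 := leq_trans h (leq_of_leqif (leq_card_setU _ _)).
have h3 : (#|(\bigcup_(f in B) brace_poles f)%SET| <= #|B| * (4 * #|B| - 4))%N.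
  apply: leq_trans (card_bigcup_le _ _) _; rewrite -sum_nat_const.
  by apply: leq_sum => f fB; exact: card_brace_poles.
have := card_brace_ends; nia.
Qed.

End Braces.

Theorem theorem2p5 (R : realType) (V : finType) (G : braced_triangulation R V)
    (b : nat) (hb : b = #|bt_braces G|) (hb2 : (2 <= b)%N)
    (hG : irreducible_bt G) :
  (#|V| <= 4 * b ^ 2 - 2 * b)%N.
Proof.
(* The lemmas on common neighbours need a fourth vertex; with at most three vertices the bound,
   which is at least [12], holds anyway. *)
have [V3|V4] := leqP #|V| 3; first by nia.
have [n [nS n2 nA nV]] := pole_exists (bt_graph G).
by rewrite hb in hb2 *; exact: (card_vertices hG V4 nS n2 nA nV).
Qed.
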